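(* Let $q\in\{1,2\}$ and $\lambda>0$. Assume $\max_{l\in[p]}\mathbb{E}[X_l^4]<\infty$ and $\mathbb{E}[Y^2]<\infty$, and let $M_\mu<\infty$ be such that $\mathrm{supp}(\mu)\subseteq[0,M_\mu]$. Then for every $\beta\in\mathbb{R}_+^p$ and $l\in[p]$: (a) in the case $q=1$, $$\partial_{\beta_l}\mathcal{J}(\beta)=-\frac1\lambda\left(\iint\left|\mathrm{Cov}\big(R_{\beta,\omega}(\beta\odot X;Y),e^{i\zeta_lX_l}\big)\right|^2\frac{d\zeta_l}{\pi\zeta_l^2}\,\widetilde Q(\omega)\,d\omega+O(\sqrt\lambda)\right);$$ (b) in the case $q=2$, $$\partial_{\beta_l}\mathcal{J}(\beta)=-\frac1\lambda\left(\int\left|\mathrm{Cov}\big(R_{\beta,\omega}(\beta^{1/2}\odot X;Y),X_l\big)\right|^2\widetilde Q(\omega)\,d\omega+O(\sqrt\lambda)\right).$$ Here $O(\sqrt\lambda)$ denotes a remainder term whose absolute value is upper bounded by $C\sqrt\lambda$, where $C>0$ is a constant depending only on $\mathbb{E}[X_l^4]$, $\mathbb{E}[Y^2]$ and $M_\mu$.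
   Context: $(X,Y)$ is a random pair in $\mathbb{R}^p\times\mathbb{R}$ with $\mathbb{E}[Y]=0$; $[p]=\{1,\dots,p\}$. Kernel: $h(x)=\int_0^\infty e^{-tx}\mu(dt)$ with $\mu$ a finite nonnegative measure on $[0,\infty)$, $\mu((0,\infty))>0$; it is assumed that (i) $\int_0^\infty t^{-1}\mu(dt)<\infty$, (ii) $\mathrm{supp}(\mu)$ is compact, (iii) if $q=2$, $0\notin\mathrm{supp}(\mu)$. The kernel is $k(x,x')=h(\|x-x'\|_q^q)$ on $\mathbb{R}^p$, where $\|z\|_q^q=\sum_i|z_i|^q$, and $\mathcal{H}$ is its reproducing kernel Hilbert space. For $\beta\in\mathbb{R}_+^p$, $\beta^{1/q}\odot x=(\beta_1^{1/q}x_1,\dots,\beta_p^{1/q}x_p)$, and $\mathcal{J}(\beta)=\min_{f\in\mathcal{H}}\tfrac12\mathbb{E}[(Y-f(\beta^{1/q}\odot X))^2]+\tfrac\lambda2\|f\|_{\mathcal{H}}^2$, with minimizer $f_\beta$ and residual $r_\beta(x;y)=y-f_\beta(x)$. Partial derivatives at $\beta_l=0$ are right derivatives. $R_{\beta,\omega}(\beta^{1/q}\odot X;Y)=e^{i\langle\omega,\beta^{1/q}\odot X\rangle}\,r_\beta(\beta^{1/q}\odot X;Y)$ for $\omega\in\mathbb{R}^p$. $\widetilde Q(\omega)=\int_0^\infty t\,q_t(\omega)\,\mu(dt)$ with $q_t(\omega)=\prod_{i=1}^p\psi_t(\omega_i)$, $\psi_t(u)=t^{-1/q}\psi(t^{-1/q}u)$,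 where $\psi(u)=\frac1{\pi(1+u^2)}$ if $q=1$ and $\psi(u)=\frac1{2\sqrt\pi}e^{-u^2/4}$ if $q=2$. For complex random variables $\mathrm{Cov}(U,V)=\mathbb{E}[UV]-\mathbb{E}[U]\mathbb{E}[V]$. Integrals over $\omega$ are over $\mathbb{R}^p$ and over $\zeta_l$ over $\mathbb{R}$.
   Formalization: In (a) the double integral carries an extra factor 1/2 (the printed formula fails for p=1, X=Y=±1, μ=δ_1, β=0 as λ→0), and the constant C may also depend on the total mass μ([0,∞)), as rescaling μ and λ together shows it must. *)

(* Defs.v *)
From HB Require Import structures.
From mathcomp Require Import all_boot all_order all_algebra.
From mathcomp Require Import all_classical all_reals all_analysis.
From mathcomp Require Import complex.

Set Implicit Arguments.
Unset Strict Implicit.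
Unset Printing Implicit Defensive.

Import Order.TTheory GRing.Theory Num.Theory.
Import numFieldNormedType.Exports.

Local Open Scope classical_set_scope.
Local Open Scope ring_scope.
Local Open Scope complex_scope.

(* Points of R^p are represented as p.-tuple R, whose sigma-algebra is the
   product one. The library has no n-fold product measure; it is built here by
   recursion on n, so that [mpower (@lebesgue_measure R) p] is the Lebesgue
   measure on R^p. *)
Definition tuple_cons (T : Type) n (xv : T * n.-tuple T) : n.+1.-tuple T :=
  [tuple of xv.1 :: xv.2].

Lemma measurable_tuple_cons d (T : measurableType d) n :
  measurable_fun [set: T * n.-tuple T] (@tuple_cons T n).
Proof. exact: measurable_cons. Qed.

Definition mcons d (T : measurableType d) (R : realType)
    (m1 : set T -> \bar R) n (m2 : set (n.-tuple T) -> \bar R) :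
    set (n.+1.-tuple T) -> \bar R :=
  pushforward (m1 \x m2)%E (@tuple_cons T n).

Section mcons_measure.
Context d (T : measurableType d) (R : realType).
Variables (m1 : {sigma_finite_measure set T -> \bar R}) (n : nat).
Variable m2 : {sigma_finite_measure set (n.-tuple T) -> \bar R}.
Local Open Scope ereal_scope.

Let mpre (A : set (n.+1.-tuple T)) :
  measurable A -> measurable (@tuple_cons T n @^-1` A).
Proof.
by move=> mA; rewrite -[X in measurable X]setTI; exact: measurable_tuple_cons.
Qed.

Let mcons0 : mcons m1 m2 set0 = 0.
Proof. by rewrite /mcons /pushforward preimage_set0 measure0. Qed.

Let mcons_ge0 A : 0 <= mcons m1 m2 A.
Proof. exact: (measure_ge0 (m1 \x m2)). Qed.

Let mcons_sigma_additive : semi_sigma_additive (mcons m1 m2).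
Proof.
move=> F mF tF mUF; rewrite /mcons /pushforward preimage_bigcup.
apply: measure_semi_sigma_additive.
- by move=> i; exact: mpre.
- apply/trivIsetP => /= i j _ _ ij; rewrite -preimage_setI.
  by move/trivIsetP : tF => /(_ _ _ _ _ ij) ->//; rewrite preimage_set0.
- by rewrite -preimage_bigcup; exact: mpre.
Qed.

HB.instance Definition _ := isMeasure.Build _ _ _ (mcons m1 m2)
  mcons0 mcons_ge0 mcons_sigma_additive.

Let mcons_sigma_finite : sigma_finite setT (mcons m1 m2).
Proof.
pose f (t : n.+1.-tuple T) : T * n.-tuple T :=
  (tnth t ord0, [tuple of behead t]).
have mf : measurable_fun setT f.
  by apply/measurable_fun_pair; [exact: measurable_tnth|exact: measurable_behead].
have /sigma_finiteP[G [TG ndG Goo]] := sigma_finiteT m1.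
have /sigma_finiteP[H [TH ndH Hoo]] := sigma_finiteT m2.
pose F k := G k `*` H k.
have FT : setT = \bigcup_k F k.
  rewrite -setXTT TG TH predeqE => -[x y]; split.
    move=> [/= [j _ Gx] [k _ Hy]]; exists (maxn j k) => //; split.
    - by move: x Gx; exact/subsetPset/ndG/leq_maxl.
    - by move: y Hy; exact/subsetPset/ndH/leq_maxr.
  by move=> [j _ []/= ? ?]; split; exists j.
have Foo k : measurable (F k) /\ (m1 \x m2) (F k) < +oo.
  have [? ?] := Goo k; have [? ?] := Hoo k.
  split; first exact: measurableX.
  by rewrite product_measure1E// lte_mul_pinfty// ge0_fin_numE.
exists (fun k => f @^-1` F k).
  by rewrite -preimage_bigcup -FT preimage_setT.
move=> k; have [mFk Fk] := Foo k; split.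
  by rewrite -[X in measurable X]setTI; exact: mf.
have fK xv : f (tuple_cons xv) = xv.
  case: xv => x v; rewrite /f /tuple_cons/= tnth0; congr (_, _).
  exact/val_inj.
rewrite /mcons /pushforward (_ : _ @^-1` _ = F k)//.
by apply/seteqP; split=> xv /=; rewrite fK.
Qed.

HB.instance Definition _ := @Measure_isSigmaFinite.Build _ _ _ (mcons m1 m2)
  mcons_sigma_finite.
End mcons_measure.

Fixpoint mpower d (T : measurableType d) (R : realType)
    (m : {sigma_finite_measure set T -> \bar R}) (n : nat) :
    {sigma_finite_measure set (n.-tuple T) -> \bar R} :=
  match n with
  | 0 => \d_ [tuple]
  | n'.+1 => mcons m (mpower m n')
  end.

Section support.
Context {R : realType} (mu : set (measurableTypeR R) -> \bar R).

Definition msupport : set R :=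
  [set x | forall U : set R, open U -> U x -> (0 < mu U)%E].

(* [inve] satisfies 0^-1 = +oo. *)
Record kernel_measure (q : nat) : Prop := KernelMeasure {
  kmeas_neg : mu `]-oo, 0[ = 0%E ;
  kmeas_pos : (0 < mu `]0%R, +oo[)%E ;
  kmeas_inv : (\int[mu]_(t in `[0%R, +oo[) (t%:E)^-1 < +oo)%E ;
  kmeas_compact : compact msupport ;
  kmeas_supp0 : q = 2 -> ~ msupport 0 }.

End support.

Definition hnorm {R : realType} {T : Type}
    (dot : (T -> R) -> (T -> R) -> R) (f : T -> R) : R := Num.sqrt (dot f f).

Section rkhs.
Context {R : realType} {T : Type}.
Variables (k : T -> T -> R) (H : set (T -> R)) (dot : (T -> R) -> (T -> R) -> R).

(* [H] with the inner product [dot] is the reproducing kernel Hilbert space of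
   [k]; the values of [dot] outside [H] are irrelevant. *)
Record is_rkhs : Prop := IsRKHS {
  rkhs_zero : H (fun=> 0) ;
  rkhs_lin : forall a f g, H f -> H g -> H (fun x => a * f x + g x) ;
  rkhs_dotC : forall f g, H f -> H g -> dot f g = dot g f ;
  rkhs_dotl : forall a f g e, H f -> H g -> H e ->
    dot (fun x => a * f x + g x) e = a * dot f e + dot g e ;
  rkhs_dot_ge0 : forall f, H f -> 0 <= dot f f ;
  rkhs_dot_eq0 : forall f, H f -> dot f f = 0 -> f = (fun=> 0) ;
  rkhs_complete : forall u : nat -> T -> R, (forall n, H (u n)) ->
    (forall e, 0 < e -> exists N, forall m n, (N <= m)%N -> (N <= n)%N ->
       hnorm dot (fun x => u m x - u n x) < e) ->
    exists2 f, H f & hnorm dot (fun x => u n x - f x) @[n --> \oo] --> (0 : R) ;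
  rkhs_kernel : forall x, H (fun y => k y x) ;
  rkhs_repr : forall f x, H f -> f x = dot f (fun y => k y x) }.

End rkhs.

Section kernel_ridge.
Context {R : realType}.
Implicit Types (p q : nat) (mu : set (measurableTypeR R) -> \bar R).

Definition laplace mu (x : R) : R :=
  fine (\int[mu]_(t in `[0%R, +oo[) (expR (- t * x))%:E)%E.

Definition lq_kernel p q mu (x y : p.-tuple R) : R :=
  laplace mu (\sum_(i < p) `|tnth x i - tnth y i| ^+ q).

Definition scale p q (beta x : p.-tuple R) : p.-tuple R :=
  [tuple (tnth beta i) `^ (q%:R^-1) * tnth x i | i < p].

Context d (Om : measurableType d) (P : probability Om R) (p q : nat).
Variables (X : Om -> p.-tuple R) (Y : Om -> R) (lambda : R).
Variables (H : set (p.-tuple R -> R)).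
Variable dot : (p.-tuple R -> R) -> (p.-tuple R -> R) -> R.

Definition objective (beta : p.-tuple R) (f : p.-tuple R -> R) : R :=
  2^-1 * fine 'E_P[fun w => (Y w - f (scale q beta (X w))) ^+ 2]
  + lambda / 2 * dot f f.

Definition Jobj (beta : p.-tuple R) : R := inf [set objective beta f | f in H].

Definition fmin (beta : p.-tuple R) : p.-tuple R -> R :=
  xget (fun=> 0)
    [set f | H f /\ forall g, H g -> objective beta f <= objective beta g].

Definition residual (beta x : p.-tuple R) (y : R) : R := y - fmin beta x.

Definition expi (t : R) : R[i] := cos t +i* sin t.

Definition residual_wave (beta om x : p.-tuple R) (y : R) : R[i] :=
  expi (\sum_(i < p) tnth om i * tnth x i) * (residual beta x y)%:C.

End kernel_ridge.

Section complex_covariance.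
Context {R : realType} d (Om : measurableType d) (P : probability Om R).
Implicit Types U V : Om -> R[i].

Definition cexpectation U : R[i] :=
  fine 'E_P[fun w => complex.Re (U w)] +i* fine 'E_P[fun w => complex.Im (U w)].

Definition ccov U V : R[i] :=
  cexpectation (fun w => U w * V w) - cexpectation U * cexpectation V.

Definition sqmod (z : R[i]) : R := (complex.Re z) ^+ 2 + (complex.Im z) ^+ 2.

End complex_covariance.

Section spectral_weight.
Context {R : realType}.

Definition psi (q : nat) (u : R) : R :=
  if q == 1%N then (pi * (1 + u ^+ 2))^-1
  else (2 * Num.sqrt pi)^-1 * expR (- (u ^+ 2 / 4)).

(* At t = 0 this is 0, but the value there is immaterial because of the factor
   t in [Qtilde]. *)
Definition psi_t (q : nat) (t u : R) : R :=
  t `^ (- q%:R^-1) * psi q (t `^ (- q%:R^-1) * u).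

Definition q_t p (q : nat) (t : R) (om : p.-tuple R) : R :=
  \prod_(i < p) psi_t q t (tnth om i).

Definition Qtilde (mu : set (measurableTypeR R) -> \bar R) p q
    (om : p.-tuple R) : \bar R :=
  (\int[mu]_(t in `[0%R, +oo[) (t * q_t q t om)%:E)%E.

End spectral_weight.

Section partial_derivative.
Context {R : realType} (p : nat).

Definition shift_coord (b : p.-tuple R) (l : 'I_p) (h : R) : p.-tuple R :=
  [tuple tnth b i + (if i == l then h else 0) | i < p].

(* Right derivative on the face b_l = 0 of the orthant, two-sided derivative
   elsewhere. *)
Definition is_partial (F : p.-tuple R -> R) (b : p.-tuple R) (l : 'I_p)
    (dF : R) : Prop :=
  h^-1 * (F (shift_coord b l h) - F b)
    @[h --> (if tnth b l == 0 then 0^'+ else 0^')] --> dF.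

End partial_derivative.

(* Main.v *)
Require Import Defs.
From HB Require Import structures.
From mathcomp Require Import all_boot all_order all_algebra.
From mathcomp Require Import all_classical all_reals all_analysis.
From mathcomp Require Import measurable_realfun.
From mathcomp Require Import complex ring lra.

(** Let [r] be the residual of the ridge minimizer at [beta]. For a kernel [kap] on
    pairs of sample points write [B_kap(a, b) = E[a(w) b(w') kap(w, w')]], with [w]
    and [w'] independent. Let [D] be the sum of the [beta_i |X_i - X_i'|^q], put
    [K = h(D)], let [G] be the integral of [t exp (- t D)] against [mu], and let
    [u = |X_l - X_l'|^q].

    Derivative. By the representer formula the problem can be written in terms of
    [r] and [K], and for every square-integrable [a]
      [J = E[Y a] - E[a^2] / 2 - B_K(a, a) / (2 lambda)
           + E[(r - a)^2] / 2 + B_K(r - a, r - a) / (2 lambda)]    ([dual_gap]).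
    Taking for [a] the residual at another [beta] compares the two optimal values
    from both sides ([J_lower]). The bounds agree to first order, because they
    also force the residuals to be close; as [D] is affine in [beta_l] with slope
    [u], the derivative is [B_(G u)(r, r) / (2 lambda)] ([envelope_cvg],
    [J_partial]).

    Main term. The kernel [exp (- t D)] is the Fourier transform of the density
    [q_t] at the difference of the scaled inputs, so that [B_G(a, a)] is the
    integral of [|E[a exp (i <om, .>)]|^2] against [Qtilde] ([spectral_Q]). It
    remains to separate the variables in [u]. If [q = 2] and [x] is the centered
    [X_l], then [u = x^2 + x'^2 - 2 x x'], and the cross term gives [B_G(r x, r x)],
    which is the integral of squared covariances ([sqmod_ccov]). If [q = 1], the
    absolute value is the mixture of the [1 - cos (z v)] with weight [1 / (pi z^2)]
    ([integral_cosk]), and the same separation is done for the centered [cos (z x)]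
    and [sin (z x)] at each frequency [z] ([absdist_spectral]).

    Remainder. In both cases what is left is [B_G(r g, r)], where [g] is [x^2] or a
    centered mean distance ([potential]). By Cauchy-Schwarz its square is at most
    [B_G(r g, r g) B_G(r, r)]. The first factor is controlled by moments. For the
    second, [t <= M] on the support of [mu] gives [B_G(r, r) <= M B_K(r, r)], and
    comparing the minimizer with the zero function gives
    [B_K(r, r) <= lambda E[Y^2]] ([gram_resid_bnd], [remainder_bnd]). *)

Set Implicit Arguments.
Unset Strict Implicit.
Unset Printing Implicit Defensive.

Import Order.TTheory GRing.Theory Num.Theory.
Import numFieldNormedType.Exports.

Local Open Scope classical_set_scope.
Local Open Scope ring_scope.
Local Open Scope complex_scope.

(** * Integrals of real-valued functions *)

(** Integrability stated for real-valued functions, so that the arguments below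
    can compute in [R] instead of the extended reals. *)
Definition integ d (T : measurableType d) (R : realType)
  (m : {measure set T -> \bar R}) (f : T -> R) : Prop :=
  m.-integrable setT (EFin \o f).

Section integ.
Context d (T : measurableType d) (R : realType) (m : {measure set T -> \bar R}).
Implicit Types f g : T -> R.

Lemma integ_measurable f : integ m f -> measurable_fun setT f.
Proof. by move=> /measurable_int /measurable_EFinP. Qed.

Lemma integ_le f g : measurable_fun setT f -> (forall x, `|f x| <= g x) ->
  integ m g -> integ m f.
Proof.
move=> mf fg; apply: le_integrable => //; first exact/measurable_EFinP.
by move=> x _ /=; rewrite lee_fin (le_trans (fg x))// ler_norm.
Qed.

Lemma integD f g : integ m f -> integ m g -> integ m (fun x => f x + g x).
Proof. by move=> fi gi; exact: (integrableD measurableT fi gi). Qed.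

Lemma integB f g : integ m f -> integ m g -> integ m (fun x => f x - g x).
Proof. by move=> fi gi; exact: (integrableB measurableT fi gi). Qed.

Lemma integZ c f : integ m f -> integ m (fun x => c * f x).
Proof. by move=> fi; exact: (integrableZl measurableT c fi). Qed.

Lemma integ_abs f : integ m f -> integ m (fun x => `|f x|).
Proof. exact: integrable_norm. Qed.

Lemma eq_integ f g : f =1 g -> integ m f -> integ m g.
Proof. by move=> /funext ->. Qed.

Lemma integMb f g c : integ m f -> measurable_fun setT g ->
  (forall x, `|g x| <= c) -> integ m (fun x => f x * g x).
Proof.
move=> fi mg gc; apply: (@integ_le _ (fun x => c * `|f x|)).
- by apply: measurable_funM => //; exact: integ_measurable.
- by move=> x; rewrite normrM mulrC ler_wpM2r.
- by apply: integZ; exact: integ_abs.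
Qed.

Lemma RintD f g : integ m f -> integ m g ->
  (\int[m]_x (f x + g x) = \int[m]_x f x + \int[m]_x g x)%R.
Proof. exact: RintegralD. Qed.

Lemma RintB f g : integ m f -> integ m g ->
  (\int[m]_x (f x - g x) = \int[m]_x f x - \int[m]_x g x)%R.
Proof. exact: RintegralB. Qed.

Lemma RintZ c f : integ m f -> (\int[m]_x (c * f x) = c * \int[m]_x f x)%R.
Proof. exact: RintegralZl. Qed.

Lemma le_Rint f g : integ m f -> integ m g -> (forall x, f x <= g x) ->
  (\int[m]_x f x <= \int[m]_x g x)%R.
Proof. by move=> fi gi fg; apply: le_Rintegral. Qed.

Lemma normr_Rint f g : integ m f -> integ m g -> (forall x, `|f x| <= g x) ->
  `|(\int[m]_x f x)%R| <= (\int[m]_x g x)%R.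
Proof.
move=> fi gi fg; apply: (le_trans (le_normr_Rintegral measurableT fi)).
by apply: le_Rint => //; exact: integ_abs.
Qed.

Lemma EFin_Rint f : integ m f -> ((\int[m]_x f x)%R%:E = \int[m]_x (f x)%:E)%E.
Proof. by move=> fi; rewrite /Rintegral fineK//; exact: integrable_fin_num. Qed.

Lemma integ_ge0P f : measurable_fun setT f -> (forall x, 0 <= f x) ->
  (\int[m]_x (f x)%:E < +oo)%E -> integ m f.
Proof.
move=> mf f0 foo; apply/integrableP; split; first exact/measurable_EFinP.
by under eq_integral => x _ do rewrite /= ger0_norm//.
Qed.

Lemma integralZ_ge0 (c : R) f : 0 <= c -> measurable_fun setT f ->
  (forall x, 0 <= f x) ->
  (\int[m]_x (c * f x)%:E = c%:E * \int[m]_x (f x)%:E)%E.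
Proof.
move=> c0 mf f0; under eq_integral do rewrite EFinM.
rewrite ge0_integralZl_EFin//; first by move=> x _; rewrite lee_fin.
exact/measurable_EFinP.
Qed.

Lemma eq_Rint f g : f =1 g -> (\int[m]_x f x = \int[m]_x g x)%R.
Proof. by move=> /funext ->. Qed.

Lemma Rint_cvg (f_ : nat -> T -> R) f g :
  (forall n, measurable_fun setT (f_ n)) ->
  (forall x, f_ ^~ x @ \oo --> f x) ->
  integ m g -> (forall n x, `|f_ n x| <= g x) ->
  integ m f /\ (\int[m]_x f_ n x)%R @[n --> \oo] --> (\int[m]_x f x)%R.
Proof.
move=> mf cf ig fg.
have mlim : measurable_fun setT f.
  by apply: (measurable_fun_cvg mf) => x _; exact: cf.
have fi : integ m f.
  apply: integ_le ig => // x.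
  have : `|f_ n x| @[n --> \oo] --> `|f x| by apply: cvg_norm; exact: cf.
  by move=> cn; apply: (ler_cvg_to cn (cvg_cst (g x))); exact: nearW.
split=> //.
have := @dominated_convergence _ _ _ m setT measurableT
  (fun n => EFin \o f_ n) (EFin \o f) (EFin \o g).
case.
- by move=> n; exact/measurable_EFinP.
- exact/measurable_EFinP.
- apply: aeW => x _; apply/fine_cvgP; split; first exact: nearW.
  exact: cf.
- by [].
- by apply: aeW => x n _; rewrite /= lee_fin.
- move=> _ _ H.
  have fn n : integ m (f_ n) by apply: integ_le ig.
  have := H; rewrite -(EFin_Rint fi).
  under eq_fun => n do rewrite -(EFin_Rint (fn n)).
  by move=> /fine_cvgP[_].
Qed.
End integ.

(** * Fubini under a product majorant *)

(** A majorant [g x * c y] makes every section and every partial integral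
    integrable; all the exchanges of integrals below are of this kind, except
    for those of nonnegative functions. *)
Section fubini_dom.
Context d1 d2 (T1 : measurableType d1) (T2 : measurableType d2) (R : realType).
Variables (m1 : {sigma_finite_measure set T1 -> \bar R}).
Variables (m2 : {sigma_finite_measure set T2 -> \bar R}).

Lemma integ_prod (g : T1 -> R) (c : T2 -> R) : integ m1 g -> integ m2 c ->
  integ (m1 \x m2)%E (fun z => g z.1 * c z.2).
Proof.
move=> ig ic.
have mg := integ_measurable ig; have mc := integ_measurable ic.
have mgc : measurable_fun setT (fun z : T1 * T2 => (g z.1 * c z.2)%:E).
  apply/measurable_EFinP; apply: measurable_funM.
    by apply: measurableT_comp => //; exact: measurable_fst.
  by apply: measurableT_comp => //; exact: measurable_snd.
apply/(integrable12ltyP m1 m2 mgc) => /=.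
under eq_integral => x _.
  under eq_integral => y _ do rewrite normrM EFinM.
  rewrite ge0_integralZl_EFin//=; last first.
    by apply/measurable_EFinP; apply: measurableT_comp.
  over.
rewrite /=.
have := ic => /integrableP[_ /=] icoo.
rewrite -(@fineK _ (\int[m2]_x (`|c x|)%:E)%E); last first.
  by rewrite ge0_fin_numE//; apply: integral_ge0 => //.
rewrite ge0_integralZr//; last 2 first.
- by apply/measurable_EFinP; apply: measurableT_comp.
- by rewrite lee_fin; apply: fine_ge0; apply: integral_ge0.
rewrite lte_mul_pinfty//; first exact: integral_ge0.
- by rewrite ge0_fin_numE//; [have := ig => /integrableP[]|exact: integral_ge0].
- by rewrite ltry.
Qed.

Section dominated.
Variables (F : T1 * T2 -> R) (g : T1 -> R) (c : T2 -> R).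
Hypothesis mF : measurable_fun setT F.
Hypothesis Fgc : forall x y, `|F (x, y)| <= g x * c y.
Hypothesis ig : integ m1 g.
Hypothesis ic : integ m2 c.

Lemma fubini_dom_prod : integ (m1 \x m2)%E F.
Proof.
apply: integ_le (integ_prod ig ic) => // -[x y]; exact: Fgc.
Qed.

Lemma fubini_dom_sec1 x : integ m2 (fun y => F (x, y)).
Proof.
apply: (integ_le _ _ (integZ (g x) ic)) => [|y]; last exact: Fgc.
by apply: measurableT_comp => //; exact: pair1_measurable.
Qed.

Lemma fubini_dom_sec2 y : integ m1 (fun x => F (x, y)).
Proof.
apply: (integ_le _ _ (integZ (c y) ig)) => [|x]; last by rewrite mulrC; exact: Fgc.
by apply: measurableT_comp => //; exact: pair2_measurable.
Qed.

Lemma fubini_dom_int1 : integ m1 (fun x => \int[m2]_y F (x, y))%R.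
Proof.
rewrite /integ.
have := integrable_fubini_F (fubini_dom_prod).
rewrite /fubini_F /=; congr (integrable _ _ _).
by apply/funext => x /=; rewrite EFin_Rint//; exact: fubini_dom_sec1.
Qed.

Lemma fubini_dom_int2 : integ m2 (fun y => \int[m1]_x F (x, y))%R.
Proof.
have ip := fubini_dom_prod.
apply: (integ_le _ _ (integZ (\int[m1]_x g x)%R ic)).
  apply/measurable_EFinP; have := measurable_fubini_G ip.
  by congr (measurable_fun _ _); apply/funext => y /=; rewrite (EFin_Rint (fubini_dom_sec2 y)).
move=> y; rewrite mulrC -(RintZ _ ig).
apply: normr_Rint (fubini_dom_sec2 y) (integZ (c y) ig) _ => x.
by rewrite mulrC; exact: Fgc.
Qed.

Lemma fubini_domE1 : (\int[(m1 \x m2)%E]_z F z = \int[m1]_x \int[m2]_y F (x, y))%R.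
Proof.
rewrite /Rintegral -(integral12_prod_meas1 fubini_dom_prod)/=; congr fine.
apply: eq_integral => x _ /=.
by rewrite (EFin_Rint (fubini_dom_sec1 x)).
Qed.

Lemma fubini_domE2 : (\int[(m1 \x m2)%E]_z F z = \int[m2]_y \int[m1]_x F (x, y))%R.
Proof.
rewrite /Rintegral -(integral21_prod_meas1 fubini_dom_prod)/=; congr fine.
apply: eq_integral => x _ /=.
by rewrite (EFin_Rint (fubini_dom_sec2 x)).
Qed.

Lemma fubini_dom : (\int[m1]_x \int[m2]_y F (x, y) =
  \int[m2]_y \int[m1]_x F (x, y))%R.
Proof. by rewrite -fubini_domE1 fubini_domE2. Qed.

End dominated.
End fubini_dom.

(** * Closure properties of measurable functions *)

Section measurable_closure.
Context d (T : measurableType d) (R : realType).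
Implicit Types f : T -> R.

Lemma mf_cont (h : R -> R) f : continuous h -> measurable_fun setT f ->
  measurable_fun setT (fun x => h (f x)).
Proof.
move=> ch mf; have mh := continuous_measurable_fun ch.
exact: (measurableT_comp mh mf).
Qed.

Lemma mf_exp f : measurable_fun setT f -> measurable_fun setT (fun x => expR (f x)).
Proof. exact: (mf_cont (@continuous_expR R)). Qed.

Lemma mf_cos f : measurable_fun setT f -> measurable_fun setT (fun x => cos (f x)).
Proof. exact: (mf_cont (@continuous_cos R)). Qed.

Lemma mf_sin f : measurable_fun setT f -> measurable_fun setT (fun x => sin (f x)).
Proof. exact: (mf_cont (@continuous_sin R)). Qed.

Lemma mf_norm f : measurable_fun setT f -> measurable_fun setT (fun x => `|f x|).
Proof. by move=> mf; apply: measurableT_comp. Qed.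

Lemma mf_opp f : measurable_fun setT f -> measurable_fun setT (fun x => - f x).
Proof. exact: measurable_funN. Qed.

Lemma mf_cst (c : R) : measurable_fun [set: T] (fun=> c : R).
Proof. exact: measurable_cst. Qed.

(** Because [x^-1 = x * (x^2)^-1] and [y^-1 = exp (- ln y)] for [0 < y]. *)
Lemma mf_inv f : measurable_fun setT f -> measurable_fun setT (fun x => (f x)^-1).
Proof.
move=> mf; pose g (x : T) := if f x == 0 then 0 else expR (- ln (f x ^+ 2)).
have -> : (fun x => (f x)^-1) = (fun x => f x * g x).
  apply/funext => x; rewrite /g; have [->|f0] := eqVneq (f x) 0.
    by rewrite invr0 mulr0.
  rewrite expRN lnK ?posrE ?exprn_even_gt0//.
  by rewrite expr2 invfM mulrA divff// mul1r.
apply: measurable_funM => //; apply: measurable_fun_ifT => //.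
- exact: measurable_fun_eqr.
- apply: mf_exp; apply: mf_opp.
  by apply: (measurableT_comp (@measurable_ln R)); exact: measurable_funX.
Qed.

Lemma mf_indic (D : set R) f : measurable D -> measurable_fun setT f ->
  measurable_fun setT (fun x => \1_D (f x) : R).
Proof.
move=> mD mf; have mi : measurable_fun setT (\1_D : R -> R) by exact: measurable_indic.
exact: (measurableT_comp mi mf).
Qed.

Lemma mf_sum (I : Type) (r : seq I) (F : I -> T -> R) :
  (forall i, measurable_fun setT (F i)) ->
  measurable_fun setT (fun x => \sum_(i <- r) F i x).
Proof. by move=> mF; apply: measurable_sum. Qed.

Lemma mf_prod (I : Type) (r : seq I) (F : I -> T -> R) :
  (forall i, measurable_fun setT (F i)) ->
  measurable_fun setT (fun x => \prod_(i <- r) F i x).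
Proof.
move=> mF; elim: r => [|i r IH].
  by under eq_fun do rewrite big_nil; exact: mf_cst.
by under eq_fun do rewrite big_cons; exact: measurable_funM.
Qed.
End measurable_closure.

Lemma mf_comp1 d1 d2 d3 (T1 : measurableType d1) (T2 : measurableType d2)
    (T3 : measurableType d3) (f : T1 -> T3) : measurable_fun setT f ->
  measurable_fun setT (fun z : T1 * T2 => f z.1).
Proof. by move=> mf; exact: (measurableT_comp mf measurable_fst). Qed.

Lemma mf_comp2 d1 d2 d3 (T1 : measurableType d1) (T2 : measurableType d2)
    (T3 : measurableType d3) (f : T2 -> T3) : measurable_fun setT f ->
  measurable_fun setT (fun z : T1 * T2 => f z.2).
Proof. by move=> mf; exact: (measurableT_comp mf measurable_snd). Qed.

Ltac mfun := repeat first
  [ assumption | exact: mf_cst | exact: measurable_fst | exact: measurable_snd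
  | exact: measurable_id
  | apply: mf_exp | apply: mf_cos | apply: mf_sin | apply: mf_norm
  | apply: mf_opp | apply: mf_inv
  | apply: (@mf_indic _ _ _ _ _ (measurable_itv _))
  | apply: measurable_funX | apply: measurable_funB | apply: measurable_funD
  | apply: measurable_funM
  | apply: mf_sum => ? | apply: mf_prod => ? | by [] ].

(** * Real integrals: primitives, scaling and parameters *)

Lemma scaleRE (R : realType) (a b : R) : a *: (b : R^o) = a * b.
Proof. by []. Qed.

Section classical_integrals.
Context {R : realType}.
Local Notation leb := (@lebesgue_measure R).

(** The fundamental theorem on [-n, n], and dominated convergence in [n]. *)
Lemma Rint_FTC (F f : R -> R) (l l' : R) : (forall x : R, is_derive x 1 F (f x)) ->
  continuous f -> integ leb f ->
  F x @[x --> +oo] --> l -> F x @[x --> -oo] --> l' ->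
  (\int[leb]_x f x = l - l')%R.
Proof.
move=> dF cf fi Fl Fl'.
pose f_ n := f \_ `[- n.+1%:R, n.+1%:R].
have mf : measurable_fun setT f by exact: integ_measurable fi.
have mfn n : measurable_fun [set: R] (f_ n).
  apply/(measurable_restrictT _ _).1; first exact: measurable_itv.
  exact: measurable_funTS.
have cF : continuous F.
  by move=> x; apply: differentiable_continuous; apply/derivable1_diffP; case: (dF x).
have [_ H] : integ leb f /\
    (\int[leb]_x f_ n x)%R @[n --> \oo] --> (\int[leb]_x f x)%R.
  apply: (@Rint_cvg _ _ _ leb f_ f (fun x => `|f x|)).
  - exact: mfn.
  - move=> x; apply: cvg_near_cst.
    exists (Num.trunc `|x|).+1 => // n /= xn.
    rewrite /f_ patchE ifT// inE/= in_itv/= -ler_norml.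
    have /ltW/le_trans := truncnS_gt `|x|; apply.
    by rewrite ler_nat ltnW// ltnS ltnW.
  - exact: integ_abs.
  - by move=> n x; rewrite /f_ patchE; case: ifPn => // _; rewrite normr0.
have E n : (\int[leb]_x f_ n x)%R = F n.+1%:R - F (- n.+1%:R).
  rewrite /f_ -Rintegral_mkcond /Rintegral.
  rewrite (@continuous_FTC2 _ f F)//.
  - by rewrite (@lt_trans _ _ 0)// oppr_lt0.
  - exact: continuous_subspaceT.
  - split.
    + by move=> x _; case: (dF x).
    + by apply: cvg_at_right_filter; exact: cF.
    + by apply: cvg_at_left_filter; exact: cF.
  - by move=> x _; rewrite derive1E; case: (dF x).
have SN : (n.+1%:R : R) @[n --> \oo] --> +oo.
  by rewrite (cvg_shiftS (fun n => n%:R : R)); exact: cvgr_idn.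
have HR : (\int[leb]_x f_ n x)%R @[n --> \oo] --> l - l'.
  under eq_fun do rewrite E.
  apply: cvgB.
    apply: (cvg_comp (fun n : nat => n.+1%:R : R) F) Fl.
    exact: SN.
  apply: (cvg_comp (fun n : nat => - n.+1%:R : R) F) Fl'.
  apply/cvgNrNy; exact: SN.
exact: (cvg_unique _ H HR).
Qed.

Lemma continuous_scale (c : R) (f : R -> R) : continuous f ->
  continuous (fun x => f (c * x)).
Proof.
move=> cf x; apply: (@continuous_comp _ _ _ (fun x => c * x) f); last exact: cf.
by apply: cvgM; [exact: cvg_cst|exact: cvg_id].
Qed.

Lemma integ_scale0 (c : R) (f : R -> R) : 0 < c -> continuous f -> (forall x, 0 <= f x) ->
  (\int[leb]_x (f x)%:E = \int[leb]_x (c * f (c * x))%:E)%E.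
Proof.
move=> c0 cf f0.
have dc (x : R) : is_derive x (1 : R) ( *%R c) c.
  by apply: is_derive_eq; rewrite /GRing.scale/= mulr1.
have dE : derive1 ( *%R c) = cst c.
  by apply/funext => x; rewrite derive1E; case: (dc x).
rewrite (@increasing_ge0_integration_by_substitutionT _ ( *%R c) f)//.
- by apply: eq_integral => x _; rewrite dE /= mulrC.
- by move=> x y xy; rewrite ltr_pM2l.
- by rewrite dE => x; exact: cvg_cst.
- by rewrite dE; exact: is_cvg_cst.
- by rewrite dE; exact: is_cvg_cst.
- exact: gt0_cvgMrNy.
- exact: gt0_cvgMry.
Qed.

(** Split [f] as [(f + |f|) - |f|] to reduce to nonnegative functions. *)
Lemma Rint_scale (c : R) (f : R -> R) : 0 < c -> continuous f -> integ leb f ->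
  integ leb (fun x => c * f (c * x)) /\
  (\int[leb]_x (c * f (c * x)) = \int[leb]_x f x)%R.
Proof.
move=> c0 cf fi.
have main (g : R -> R) : continuous g -> (forall x, 0 <= g x) -> integ leb g ->
    integ leb (fun x => c * g (c * x)) /\
    (\int[leb]_x (c * g (c * x)) = \int[leb]_x g x)%R.
  move=> cg g0 gi; rewrite /Rintegral -(integ_scale0 c0 cg g0); split=> //.
  apply: integ_ge0P.
  - apply: measurable_funM => //; apply: continuous_measurable_fun.
    exact: continuous_scale.
  - by move=> x; rewrite mulr_ge0// ltW.
  - by rewrite -(integ_scale0 c0 cg g0) -EFin_Rint// ltry.
have ca : continuous (fun x => `|f x|).
  by move=> x; apply: cvg_norm; exact: cf.
have [i1 e1] := main _ ca (fun=> normr_ge0 _) (integ_abs fi).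
have [i2 e2] := main (fun x => f x + `|f x|) (fun x => cvgD (cf x) (ca x))
  (fun x => ltac:(by rewrite -lerBlDr sub0r lerNl -normrN ler_norm))
  (integD fi (integ_abs fi)).
have E x : c * f (c * x) = c * (f (c * x) + `|f (c * x)|) - c * `|f (c * x)|.
  by rewrite mulrDr addrK.
rewrite (eq_Rint leb E) RintB// e1 e2 RintD//; last exact: integ_abs.
split; last by rewrite addrK.
by apply: (@eq_integ _ _ _ leb _ _ (fun x => esym (E x))); exact: integB.
Qed.

(** The domination is only asked on the unit ball around [a], because the
    derivatives used for the Cauchy transform grow with the parameter. *)
Lemma is_derive_Rint (f df : R -> R -> R) (G : R -> R) (a : R) :
  (forall u, integ leb (f u)) ->
  (forall u x : R, is_derive u 1 (f ^~ x) (df u x)) ->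
  (forall u x, `|u - a| < 1 -> `|df u x| <= G x) -> integ leb G ->
  is_derive a 1 (fun u => \int[leb]_x f u x)%R (\int[leb]_x df a x)%R.
Proof.
move=> fi dfE hG iG.
have d1E (u x : R) : partial1of2 f u x = df u x.
  by rewrite partial1of2E; case: (dfE u x).
have Ia : `]a - 1, a + 1[%classic a by rewrite /= in_itv/=; apply/andP; split; lra.
have hb (u y : R) : `]a - 1, a + 1[%classic u -> setT y -> `|partial1of2 f u y| <= `|G y|.
  rewrite /= in_itv/= => /andP[u1 u2] _; rewrite d1E (le_trans _ (ler_norm _))//.
  by apply: hG; rewrite ltr_norml; apply/andP; split; lra.
have hd (u y : R) : `]a - 1, a + 1[%classic u -> setT y -> derivable (f ^~ y) u 1.
  by move=> _ _; case: (dfE u y).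
have D := @derivable_under_integral R _ _ leb f setT measurableT a _ _ Ia
  (fun u _ => fi u) hd _ (fun y => normr_ge0 _) (integ_abs iG) hb.
have E := @differentiation_under_integral R _ _ leb f setT measurableT a _ _ Ia
  (fun u _ => fi u) hd _ (fun y => normr_ge0 _) (integ_abs iG) hb.
have <- : derive1 (fun u => \int[leb]_x f u x)%R a = (\int[leb]_x df a x)%R.
  by rewrite E; apply: eq_Rint => x; rewrite d1E.
by rewrite derive1E; apply: DeriveDef.
Qed.

End classical_integrals.

(** * The Fourier transform of the Gaussian *)

Section gauss_transform.
Context {R : realType}.
Local Notation leb := (@lebesgue_measure R).
Local Notation gauss := (@gauss_fun R).

Lemma integ_gauss : integ leb gauss. Proof. exact: integrableT_gauss. Qed.

Lemma continuous_cosM (v : R) : continuous (fun x : R => cos (v * x)).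
Proof. by apply: continuous_scale; exact: continuous_cos. Qed.

Lemma continuous_sinM (v : R) : continuous (fun x : R => sin (v * x)).
Proof. by apply: continuous_scale; exact: continuous_sin. Qed.

(** [|x| exp (- x^2)] is at most a constant times [exp (- (x / 2)^2)]. *)
Lemma integ_xgauss : integ leb (fun x : R => x * gauss x).
Proof.
have [i _] := @Rint_scale R (2^-1) gauss ltac:(by rewrite invr_gt0)
   (@continuous_gauss_fun R) integ_gauss.
apply: (@integ_le _ _ _ leb _ (fun x => 2 * (2^-1 * gauss (2^-1 * x)))).
- by apply: measurable_funM => //; exact: measurable_gauss_fun.
- move=> x; rewrite mulrA divff// mul1r normrM (ger0_norm (gauss_fun_ge0 x)).
  rewrite /gauss_fun.
  have -> : - (x ^+ 2) = - (2^-1 * x) ^+ 2 - (3/4) * x ^+ 2 by field.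
  rewrite expRD mulrCA ler_piMr ?expR_ge0//.
  rewrite -ler_pdivlMr ?expR_gt0// div1r -expRN opprK.
  apply: (le_trans _ (expR_ge1Dx _)).
  by rewrite -(real_normK (num_real x)); nra.
- exact: integZ.
Qed.

Lemma cvgy_gauss_bnd (h : R -> R) : (forall x, `|h x| <= 1) ->
  h x * gauss x @[x --> +oo] --> 0.
Proof.
move=> h1; apply/norm_cvg0P.
apply: (@squeeze_cvgr _ _ _ _ (cst 0) gauss).
- apply: nearW => x /=; rewrite normr_ge0/= normrM (ger0_norm (gauss_fun_ge0 x)).
  by rewrite ler_piMl// gauss_fun_ge0.
- exact: cvg_cst.
- exact: cvg_gauss_fun.
Qed.

Lemma gaussN x : gauss (- x) = gauss x.
Proof. by rewrite /gauss_fun sqrrN. Qed.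

Lemma cvgNy_gauss_bnd (h : R -> R) : (forall x, `|h x| <= 1) ->
  h x * gauss x @[x --> -oo] --> 0.
Proof.
move=> h1; apply/cvgNy_compNP.
have -> : (fun x => h x * gauss x) \o -%R = (fun x => h (- x) * gauss x).
  by apply/funext => x /=; rewrite gaussN.
exact: (@cvgy_gauss_bnd (fun x => h (- x))).
Qed.

Lemma is_derive_gauss (x : R) : is_derive x 1 gauss (- (2 * x) * gauss x).
Proof.
apply: is_derive_eq.
by rewrite !scaleRE /gauss_fun; ring.
Qed.

(** The derivative of [sin (v x) exp (- x^2)] has integral 0. *)
Lemma gauss_ibp (v : R) : (\int[leb]_x (x * gauss x * sin (v * x)) =
  v / 2 * \int[leb]_x (gauss x * cos (v * x)))%R.
Proof.
have i1 : integ leb (fun x => x * gauss x * sin (v * x)).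
  apply: (@integMb _ _ _ leb _ _ 1 integ_xgauss) => [|x]; last exact: sin_max.
  by mfun.
have i2 : integ leb (fun x => gauss x * cos (v * x)).
  apply: (@integMb _ _ _ leb _ _ 1 integ_gauss) => [|x]; last exact: cos_max.
  by mfun.
have := @Rint_FTC R (fun x => sin (v * x) * gauss x)
  (fun x => v * (gauss x * cos (v * x)) - 2 * (x * gauss x * sin (v * x))) 0 0.
rewrite (RintB (integZ v i2) (integZ 2 i1)) RintZ// RintZ// subr0 => H.
suff: v * \int[leb]_x (gauss x * cos (v * x)) -
  2 * \int[leb]_x (x * gauss x * sin (v * x)) = 0.
  by move=> /subr0_eq e; rewrite mulrAC e mulrC mulKf.
apply: H.
- move=> x; have dg := is_derive_gauss x.
  by apply: is_derive_eq; rewrite /GRing.scale/=; ring.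
- move=> x; apply: cvgB; apply: cvgM; try exact: cvg_cst.
  + by apply: cvgM; [exact: continuous_gauss_fun|exact: continuous_cosM].
  + apply: cvgM; last exact: continuous_sinM.
    by apply: cvgM; [exact: cvg_id|exact: continuous_gauss_fun].
- by apply: integB; apply: integZ.
- by apply: cvgy_gauss_bnd => x; exact: sin_max.
- by apply: cvgNy_gauss_bnd => x; exact: sin_max.
Qed.

Lemma gauss_derive (v : R) :
  is_derive v 1 (fun v => \int[leb]_x (gauss x * cos (v * x)))%R
    (- (v / 2 * \int[leb]_x (gauss x * cos (v * x))))%R.
Proof.
have i1 : integ leb (fun x => x * gauss x * sin (v * x)).
  apply: (@integMb _ _ _ leb _ _ 1 integ_xgauss) => [|x]; last exact: sin_max.
  by mfun.
rewrite -gauss_ibp -mulN1r -(RintZ _ i1).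
have -> : (\int[leb]_x (-1 * (x * gauss x * sin (v * x))) =
    \int[leb]_x (- (x * gauss x * sin (v * x))))%R.
  by apply: eq_Rint => x; rewrite mulN1r.
apply: (@is_derive_Rint R (fun v x => gauss x * cos (v * x))
  (fun v x => - (x * gauss x * sin (v * x))) (fun x => `|x * gauss x|)).
- move=> u.
  apply: (@integMb _ _ _ leb _ _ 1 integ_gauss) => [|x]; last exact: cos_max.
  by mfun.
- by move=> u x; apply: is_derive_eq; rewrite /GRing.scale/=; ring.
- by move=> u x _; rewrite normrN normrM ler_piMr// sin_max.
- by apply: integ_abs; exact: integ_xgauss.
Qed.

(** By [gauss_derive] the transform [F] solves [F' = - (v / 2) F], so that
    [F v * exp (v^2 / 4)] is constant. *)
Lemma gauss_cos (v : R) :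
  (\int[leb]_x (gauss x * cos (v * x)) = Num.sqrt pi * expR (- (v ^+ 2 / 4)))%R.
Proof.
pose F v := (\int[leb]_x (gauss x * cos (v * x)))%R.
pose g v := F v * expR (v ^+ 2 / 4).
have dg (x : R) : is_derive x 1 g 0.
  have dF : is_derive x 1 F (- (x / 2 * F x)) by exact: gauss_derive.
  rewrite /g; apply: is_derive_eq.
  by rewrite !scaleRE; field.
have g0 : g v = g 0 by apply: is_derive_0_is_cst.
have : g 0 = Num.sqrt pi.
  rewrite /g expr0n/= mul0r expR0 mulr1 /F.
  under eq_Rintegral do rewrite mul0r cos0 mulr1.
  by rewrite /Rintegral integralT_gauss.
rewrite -g0 /g => H; rewrite expRN -H -/(F v) mulfK//.
by rewrite gt_eqF// expR_gt0.
Qed.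

End gauss_transform.

(** * The integral of (1 - cos (v z)) / z^2 *)

(** Integrals over half-lines are rewritten as integrals over the line, so that
    Tonelli applies to measures on the whole space. *)
Lemma integral_indicM d (T : measurableType d) (R : realType)
    (m : {measure set T -> \bar R}) (D : set T) (g : T -> R) :
  (\int[m]_x (\1_D x * g x)%:E = \int[m]_(x in D) (g x)%:E)%E.
Proof.
rewrite [RHS]integral_mkcond; apply: eq_integral => x _.
by rewrite patchE indicE; case: (x \in D); rewrite ?mul1r ?mul0r.
Qed.

Section dirichlet.
Context {R : realType}.
Local Notation leb := (@lebesgue_measure R).

Lemma cvg_D1expRN : (x + 1) * expR (- x) @[x --> +oo] --> (0 : R).
Proof.
apply/norm_cvg0P.
apply: (@squeeze_cvgr _ _ _ _ (cst 0) (fun x => 2 * expR (- (2^-1 * x)))).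
- near=> x; rewrite /= normr_ge0/=.
  have x0 : 0 <= x by near: x; apply: nbhs_pinfty_ge; rewrite num_real.
  rewrite ger0_norm; last by rewrite mulr_ge0 ?expR_ge0// addr_ge0.
  have -> : - x = - (2^-1 * x) + - (2^-1 * x) by field.
  rewrite expRD mulrA ler_wpM2r ?expR_ge0//.
  rewrite -ler_pdivlMr ?expR_gt0// -expRN opprK.
  have := expR_ge1Dx (2^-1 * x); lra.
- exact: cvg_cst.
- rewrite -[X in _ --> X](mulr0 2); apply: cvgMl_tmp.
  apply: (cvg_comp (fun x : R => 2^-1 * x) (fun y => expR (- y))) (@cvgr_expR R).
  by apply: gt0_cvgMry; [rewrite invr_gt0|exact: cvg_id].
Unshelve. all: by end_near. Qed.

Lemma cvg_bnd_expRN (s c : R) (h : R -> R) : 0 < s -> (forall x, `|h x| <= c) ->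
  expR (- (s * x)) * h x @[x --> +oo] --> (0 : R).
Proof.
move=> s0 hc; apply/norm_cvg0P.
apply: (@squeeze_cvgr _ _ _ _ (cst 0) (fun x => c * expR (- (s * x)))).
- apply: nearW => x /=; rewrite normr_ge0/= normrM (ger0_norm (expR_ge0 _)).
  by rewrite mulrC ler_wpM2r// expR_ge0.
- exact: cvg_cst.
- rewrite -[X in _ --> X](mulr0 c); apply: cvgMl_tmp.
  apply: (cvg_comp (fun x : R => s * x) (fun y => expR (- y))) (@cvgr_expR R).
  by apply: gt0_cvgMry => //; exact: cvg_id.
Qed.

Lemma is_derive_continuous (F : R -> R) (x a : R) : is_derive x 1 F a ->
  {for x, continuous F}.
Proof.
by case=> d _; apply: differentiable_continuous; apply/derivable1_diffP.
Qed.

Lemma FTC_halfline (F f : R -> R) (l : R) : (forall x, 0 <= x -> 0 <= f x) ->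
  continuous f -> (forall x : R, is_derive x 1 F (f x)) ->
  F x @[x --> +oo] --> l ->
  (\int[leb]_(x in `[0%R, +oo[) (f x)%:E = (l - F 0)%:E)%E.
Proof.
move=> f0 cf dF Fl; rewrite (@ge0_continuous_FTC2y _ f F 0 l)//.
- exact: continuous_subspaceT.
- by apply: cvg_at_right_filter; apply: is_derive_continuous (dF 0).
- by move=> x _; rewrite derive1E; case: (dF x).
Qed.

Lemma continuous_expRNM (s : R) : continuous (fun x : R => expR (- (s * x))).
Proof.
move=> x; apply: (@continuous_comp _ _ _ (fun x => - (s * x)) expR).
  by apply: cvgN; apply: cvgM; [exact: cvg_cst|exact: cvg_id].
exact: continuous_expR.
Qed.

Lemma laplace_id (z : R) : 0 < z ->
  (\int[leb]_(s in `[0%R, +oo[) (s * expR (- (s * z)))%:E = (z ^- 2)%:E)%E.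
Proof.
move=> z0; have zn : z != 0 by rewrite gt_eqF.
pose F (s : R) := - (z ^- 2) * ((s * z + 1) * expR (- (s * z))).
have f0 (s : R) : 0 <= s -> 0 <= s * expR (- (s * z)).
  by move=> s0; rewrite mulr_ge0// expR_ge0.
have cf : continuous (fun s : R => s * expR (- (s * z))).
  move=> s; apply: cvgM; first exact: cvg_id.
  by under eq_fun do rewrite mulrC; rewrite mulrC; exact: continuous_expRNM.
have dF (s : R) : is_derive s 1 F (s * expR (- (s * z))).
  by rewrite /F; apply: is_derive_eq; rewrite !scaleRE; field.
have Fl : F s @[s --> +oo] --> 0.
  rewrite -[X in _ --> X](mulr0 (- (z ^- 2))); apply: cvgMl_tmp.
  apply: (cvg_comp (fun s : R => s * z) (fun y => (y + 1) * expR (- y))) cvg_D1expRN.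
  by apply: gt0_cvgMly => //; exact: cvg_id.
rewrite (FTC_halfline f0 cf dF Fl) /F mul0r oppr0 expR0 add0r !mulr1.
by congr EFin; ring.
Qed.

Lemma laplace_1Bcos (v s : R) : 0 < s ->
  (\int[leb]_(z in `[0%R, +oo[) ((1 - cos (v * z)) * expR (- (s * z)))%:E =
    (v ^+ 2 / (s * (s ^+ 2 + v ^+ 2)))%:E)%E.
Proof.
move=> s0; have sn : s != 0 by rewrite gt_eqF.
have qn : s ^+ 2 + v ^+ 2 != 0.
  by rewrite gt_eqF// ltr_wpDr ?sqr_ge0// exprn_gt0.
pose h (z : R) := - s^-1 + (s * cos (v * z) - v * sin (v * z)) / (s ^+ 2 + v ^+ 2).
pose F (z : R) := expR (- (s * z)) * h z.
have f0 (z : R) : 0 <= z -> 0 <= (1 - cos (v * z)) * expR (- (s * z)).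
  by move=> z0; rewrite mulr_ge0 ?expR_ge0// subr_ge0 cos_le1.
have cf : continuous (fun z : R => (1 - cos (v * z)) * expR (- (s * z))).
  move=> z; apply: cvgM; last exact: continuous_expRNM.
  by apply: cvgB; [exact: cvg_cst|exact: continuous_cosM].
have dF (z : R) : is_derive z 1 F ((1 - cos (v * z)) * expR (- (s * z))).
  rewrite /F /h; apply: is_derive_eq; rewrite !scaleRE; field.
  by rewrite sn qn.
have Fl : F z @[z --> +oo] --> 0.
  apply: (@cvg_bnd_expRN s (s^-1 + (s + `|v|) / (s ^+ 2 + v ^+ 2))) => // z.
  have q0 : 0 <= s ^+ 2 + v ^+ 2 by rewrite addr_ge0// sqr_ge0.
  rewrite (le_trans (ler_normD _ _))// normrN normfV gtr0_norm// lerD2l.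
  rewrite normrM normfV (ger0_norm q0) ler_wpM2r ?invr_ge0//.
  rewrite (le_trans (ler_normB _ _))// !normrM gtr0_norm// lerD//.
    by rewrite ler_piMr ?cos_max// ltW.
  by rewrite ler_piMr ?sin_max.
rewrite (FTC_halfline f0 cf dF Fl) /F /h !mulr0 oppr0 expR0 cos0 sin0.
by congr EFin; field; rewrite sn qn.
Qed.

Lemma integral_poisson (v : R) : 0 < v ->
  (\int[leb]_(s in `[0%R, +oo[) (v ^+ 2 / (s ^+ 2 + v ^+ 2))%:E =
   (v * (pi / 2))%:E)%E.
Proof.
move=> v0; have vn : v != 0 by rewrite gt_eqF.
have qn (s : R) : s ^+ 2 + v ^+ 2 != 0.
  by rewrite gt_eqF// ltr_wpDl ?sqr_ge0// exprn_gt0.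
pose F (s : R) := v * atan (s * v^-1).
have f0 (s : R) : 0 <= s -> 0 <= v ^+ 2 / (s ^+ 2 + v ^+ 2).
  by move=> _; rewrite divr_ge0 ?addr_ge0 ?sqr_ge0.
have cf : continuous (fun s : R => v ^+ 2 / (s ^+ 2 + v ^+ 2)).
  move=> s; apply: cvgM; first exact: cvg_cst.
  apply: cvgV; first exact: qn.
  by apply: cvgD; [exact: exprn_continuous|exact: cvg_cst].
have dF (s : R) : is_derive s 1 F (v ^+ 2 / (s ^+ 2 + v ^+ 2)).
  have da : is_derive (s * v^-1) 1 (@atan R) (1 + (s * v^-1) ^+ 2)^-1.
    exact: is_derive1_atan.
  rewrite /F; apply: is_derive_eq; rewrite !scaleRE; field.
  by rewrite vn qn.
have Fl : F s @[s --> +oo] --> v * (pi / 2).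
  apply: cvgMl_tmp.
  apply: (cvg_comp (fun s : R => s * v^-1) (@atan R)) (@cvgy_atan R).
  by apply: gt0_cvgMly; [rewrite invr_gt0|exact: cvg_id].
by rewrite (FTC_halfline f0 cf dF Fl) /F mul0r atan0 mulr0 subr0.
Qed.

(** For fixed [z] these are the negative type kernels whose mixture over [z] is
    the absolute value, see [integral_cosk]. At [z = 0] the value is 0. *)
Definition cosk (v z : R) : R := (1 - cos (v * z)) / z ^+ 2.

Lemma cosk_ge0 v z : 0 <= cosk v z.
Proof. by rewrite divr_ge0 ?sqr_ge0// subr_ge0 cos_le1. Qed.

Lemma measurable_cosk v : measurable_fun [set: R] (cosk v).
Proof. by rewrite /cosk; mfun. Qed.

(** Write [1 / z^2] as the integral of [s exp (- s z)] and exchange: the inner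
    integral is a Laplace transform of [1 - cos], and the outer one an
    arctangent. *)
Lemma cosk_halfline (v : R) : 0 < v ->
  (\int[leb]_(z in `[0%R, +oo[) (cosk v z)%:E = (v * (pi / 2))%:E)%E.
Proof.
move=> v0.
have alg (s : R) : 0 < s -> s * (v ^+ 2 / (s * (s ^+ 2 + v ^+ 2))) =
    v ^+ 2 / (s ^+ 2 + v ^+ 2).
  move=> s0; have sn : s != 0 by rewrite gt_eqF.
  have qn : s ^+ 2 + v ^+ 2 != 0 by rewrite gt_eqF// ltr_wpDr ?sqr_ge0// exprn_gt0.
  by field; rewrite sn qn.
pose A (z : R) := \1_(`[0%R, +oo[%classic) z * (1 - cos (v * z)).
pose f (zs : R * R) : R :=
  A zs.1 * (\1_(`]0%R, +oo[%classic) zs.2 * (zs.2 * expR (- (zs.2 * zs.1)))).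
have A0 z : 0 <= A z by rewrite mulr_ge0// subr_ge0 cos_le1.
have B0 (z s : R) : 0 <= \1_(`]0%R, +oo[%classic) s * (s * expR (- (s * z))).
  rewrite indicE; have [|_] := boolP (s \in _); rewrite ?mul0r// mul1r inE/= in_itv/= andbT.
  by move=> s0; rewrite mulr_ge0 ?expR_ge0// ltW.
have mA : measurable_fun setT A by rewrite /A; mfun.
have mf : measurable_fun setT f.
  have mA1 : measurable_fun setT (fun x : R * R => A x.1).
    exact: (mf_comp1 mA).
  by rewrite /f; mfun.
have mfE : measurable_fun setT (fun z => (f z)%:E) by exact/measurable_EFinP.
have f0 z : (0 <= (f z)%:E)%E by rewrite lee_fin mulr_ge0.
have L (z : R) : (\int[leb]_s (f (z, s))%:E =
    (\1_(`[0%R, +oo[%classic) z * cosk v z)%:E)%E.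
  have mB : measurable_fun setT
      (fun s : R => \1_(`]0%R, +oo[%classic) s * (s * expR (- (s * z)))) by mfun.
  rewrite /f/= (integralZ_ge0 leb (A0 z) mB (B0 z)) integral_indicM.
  have [z0|z0] := ltP 0 z; last first.
    have -> : A z = 0.
      rewrite /A indicE; have [|_] := boolP (z \in _); last by rewrite mul0r.
      rewrite inE/= in_itv/= andbT => z1.
      have -> : z = 0 by apply/eqP; rewrite eq_le z0 z1.
      by rewrite mulr0 cos0 subrr mulr0.
    rewrite mul0e indicE /cosk; have [|_] := boolP (z \in _); last by rewrite mul0r.
    rewrite inE/= in_itv/= andbT => z1.
    have -> : z = 0 by apply/eqP; rewrite eq_le z0 z1.
    by rewrite mulr0 cos0 subrr mul0r mulr0.
  rewrite integral_itv_obnd_cbnd; last first.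
    by apply/measurable_EFinP; apply: measurable_funTS; mfun.
  rewrite (laplace_id z0) -EFinM; congr EFin; rewrite /A /cosk.
  by rewrite [RHS]mulrA.
have Rr (s : R) : (\int[leb]_z (f (z, s))%:E =
    (\1_(`]0%R, +oo[%classic) s * (v ^+ 2 / (s ^+ 2 + v ^+ 2)))%:E)%E.
  rewrite [in RHS]indicE; have [|s0] := boolP (s \in _); last first.
    rewrite mul0r; apply: integral0_eq => z _.
    by rewrite /f/= indicE (negbTE s0) !mul0r mulr0.
  rewrite inE/= in_itv/= andbT => s0; rewrite mul1r.
  transitivity (\int[leb]_z (s * (\1_(`[0%R, +oo[%classic) z *
     ((1 - cos (v * z)) * expR (- (s * z)))))%:E)%E.
    apply: eq_integral => z _; rewrite /f/= [\1_(_) s]indicE mem_set ?mul1r; last first.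
      by rewrite /= in_itv/= s0.
    by rewrite /A; congr EFin; ring.
  have mC : measurable_fun setT (fun z : R => \1_(`[0%R, +oo[%classic) z *
     ((1 - cos (v * z)) * expR (- (s * z)))) by mfun.
  have C0 (z : R) : 0 <= \1_(`[0%R, +oo[%classic) z *
     ((1 - cos (v * z)) * expR (- (s * z))).
    by rewrite !mulr_ge0 ?expR_ge0// subr_ge0 cos_le1.
  rewrite (integralZ_ge0 leb (ltW s0) mC C0).
  rewrite integral_indicM (laplace_1Bcos v s0) -EFinM; congr EFin.
  exact: alg.
have := @fubini_tonelli _ _ _ _ R leb leb (fun z => (f z)%:E) mfE f0.
under eq_integral do rewrite L.
under [X in _ = X -> _]eq_integral do rewrite Rr.
rewrite !integral_indicM => ->.
rewrite integral_itv_obnd_cbnd ?(integral_poisson v0); first by [].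
by apply/measurable_EFinP; apply: measurable_funTS; mfun.
Qed.

Lemma integral_cosk (v : R) : (\int[leb]_z (cosk v z)%:E = (pi * `|v|)%:E)%E.
Proof.
wlog v0 : v / 0 < v => [H|].
  have [v0|v0|->] := ltrgt0P v.
  - by rewrite H// gtr0_norm.
  - rewrite -[RHS](_ : (pi * `| - v|)%:E = _); last by rewrite normrN ltr0_norm.
    rewrite -H ?oppr_gt0//; apply: eq_integral => z _.
    by rewrite /cosk mulNr cosN.
  - rewrite mulr0; apply: integral0_eq => z _.
    by rewrite /cosk mul0r cos0 subrr mul0r.
have m (D : set R) : measurable D -> measurable_fun D (fun z : R => (cosk v z)%:E).
  by move=> mD; apply/measurable_EFinP; apply: measurable_funTS; exact: measurable_cosk.
rewrite -(setUv `[0%R, +oo[%classic) ge0_integral_setU//=; last 4 first.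
- exact: measurableC.
- by rewrite setUv; apply: m.
- by move=> z _; rewrite lee_fin cosk_ge0.
- exact/disj_setPCl.
rewrite cosk_halfline// setCitvr integral_itv_bndo_bndc; last exact: m.
have -> : (\int[leb]_(x in `]-oo, 0%R]) (cosk v x)%:E)%E =
    (\int[leb]_(x in `]-oo, 0%R]) (cosk v (- x))%:E)%E.
  by apply: eq_integral => z _; rewrite /cosk mulrN cosN sqrrN.
rewrite -(@ge0_integration_by_substitution0 _ (fun z => (cosk v z)%:E)).
- by rewrite cosk_halfline// -EFinD gtr0_norm//; congr EFin; field.
- exact: m.
- by move=> z; rewrite lee_fin cosk_ge0.
Qed.
End dirichlet.

(** * The Fourier transform of the Cauchy density *)

(** The transform [cosI] is not obviously differentiable, its formal derivative
    having the integrand [x sin (v x) / (1 + x^2)]. Instead, [coskI] below is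
    twice differentiable under the integral sign, with second derivative [cosI],
    and [coskI v = pi |v| - pi + cosI v]. Hence [coskI'' = coskI - pi v + pi] on
    the half-line, which is solved with its two vanishing initial values. *)
Section cauchy.
Context {R : realType}.
Local Notation leb := (@lebesgue_measure R).

Definition cauchy (x : R) : R := (1 + x ^+ 2)^-1.

Lemma cauchy_ge0 x : 0 <= cauchy x.
Proof. by rewrite invr_ge0 addr_ge0// sqr_ge0. Qed.

Lemma cauchy_neq0 (x : R) : 1 + x ^+ 2 != 0.
Proof. by rewrite gt_eqF// ltr_wpDr// sqr_ge0. Qed.

Lemma continuous_cauchy : continuous cauchy.
Proof. exact: continuous_oneDsqrV. Qed.

Lemma integralT_cauchy : (\int[leb]_x (cauchy x)%:E = pi%:E)%E.
Proof.
have ev : cauchy =1 cauchy \o -%R by move=> x; rewrite /cauchy/= sqrrN.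
rewrite (ge0_symfun_integralT cauchy_ge0 continuous_cauchy ev).
have -> : [set x : R | 0 <= x] = `[0, +oo[%classic.
  by apply/seteqP; split => x/=; rewrite in_itv/= andbT.
by rewrite integral0y_oneDsqr -EFinM; congr EFin; field.
Qed.

Lemma integ_cauchy : integ leb cauchy.
Proof.
apply: integ_ge0P; last by rewrite integralT_cauchy ltry.
  by apply: continuous_measurable_fun; exact: continuous_cauchy.
exact: cauchy_ge0.
Qed.

Let cosI (v : R) := (\int[leb]_x (cauchy x * cos (v * x)))%R.
Let coskI (v : R) := (\int[leb]_x (cauchy x * cosk v x))%R.
Let sk (v x : R) := x * sin (v * x) / x ^+ 2.

Lemma integ_cosk v : integ leb (cosk v).
Proof.
apply: integ_ge0P; first exact: measurable_cosk.
- by move=> x; exact: cosk_ge0.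
- by rewrite integral_cosk ltry.
Qed.

Lemma measurable_cauchy : measurable_fun [set: R] cauchy.
Proof. by apply: continuous_measurable_fun; exact: continuous_cauchy. Qed.

Lemma cauchy_le1 x : cauchy x <= 1.
Proof. exact: oneDsqrV_le1. Qed.

Lemma integ_cauchyM (h : R -> R) c : measurable_fun [set: R] h ->
  (forall x, `|h x| <= c) -> integ leb (fun x => cauchy x * h x).
Proof. by move=> mh hc; apply: (@integMb _ _ _ leb _ _ c) integ_cauchy mh hc. Qed.

Lemma integ_cauchy_cos v : integ leb (fun x => cauchy x * cos (v * x)).
Proof.
apply: (@integ_cauchyM _ 1) => [|x]; last exact: cos_max.
by mfun.
Qed.

Lemma cauchy_coskE v : coskI v = pi * `|v| - pi + cosI v.
Proof.
have E x : cauchy x * cosk v x = cosk v x - (cauchy x - cauchy x * cos (v * x)).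
  rewrite /cauchy /cosk; have [->|x0] := eqVneq x 0.
    by rewrite mulr0 cos0 subrr mul0r mulr0 mulr1 subrr subr0.
  by field; rewrite cauchy_neq0 x0.
have i1 := integB integ_cauchy (integ_cauchy_cos v).
rewrite /coskI (eq_Rint leb E) (RintB (integ_cosk v) i1).
rewrite (RintB integ_cauchy (integ_cauchy_cos v)).
have -> : (\int[leb]_x cosk v x = pi * `|v|)%R by rewrite /Rintegral integral_cosk.
have -> : (\int[leb]_x cauchy x = pi)%R by rewrite /Rintegral integralT_cauchy.
by rewrite opprB addrA addrAC.
Qed.

Lemma sin_le_norm (x : R) : `|sin x| <= `|x|.
Proof.
wlog x0 : x / 0 <= x => [H|].
  by have [/H//|/ltW x0] := leP 0 x; rewrite -normrN -sinN -(normrN x) H// oppr_ge0.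
move: x0; rewrite le_eqVlt => /predU1P[<-|x0]; first by rewrite sin0.
have cs : {within `[0, x], continuous (@sin R)}.
  by apply: continuous_subspaceT => y; exact: continuous_sin.
have [c _] := MVT x0 (fun y _ => is_derive_sin y) cs.
rewrite sin0 !subr0 => ->; rewrite normrM ler_piMl// cos_max //.
Qed.

Lemma sk_le v x : `|sk v x| <= `|v|.
Proof.
rewrite /sk; have [->|x0] := eqVneq x 0; first by rewrite !mul0r normr0.
rewrite normrM normfV normrX ler_pdivrMr ?exprn_gt0 ?normr_gt0//.
rewrite normrM (le_trans (ler_wpM2l (normr_ge0 _) (sin_le_norm _)))//.
by rewrite normrM expr2 mulrCA.
Qed.

Lemma is_derive_coskI (v : R) : is_derive v 1 coskI (\int[leb]_x (cauchy x * sk v x))%R.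
Proof.
apply: (@is_derive_Rint R (fun v x => cauchy x * cosk v x)
  (fun v x => cauchy x * sk v x) (fun x => (`|v| + 1) * cauchy x)).
- move=> u; apply: (@integ_le _ _ _ leb _ (fun x => cosk u x)).
  + by apply: measurable_funM; [exact: measurable_cauchy|exact: measurable_cosk].
  + move=> x; rewrite (ger0_norm (mulr_ge0 (cauchy_ge0 x) (cosk_ge0 u x))).
    by rewrite ler_piMl ?cosk_ge0// cauchy_le1.
  + exact: integ_cosk.
- move=> u x; rewrite /cosk /sk; apply: is_derive_eq.
  by rewrite ?scaleRE /GRing.scale/=; ring.
- move=> u x uv; rewrite normrM (ger0_norm (cauchy_ge0 x)) mulrC.
  rewrite ler_wpM2r ?cauchy_ge0// (le_trans (sk_le _ _))//.
  have -> : u = v + (u - v) by ring.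
  by rewrite (le_trans (ler_normD _ _))// lerD2l ltW.
- by apply: integZ; exact: integ_cauchy.
Qed.

Lemma Rint_ae0 (f g : R -> R) : measurable_fun setT f -> measurable_fun setT g ->
  (forall x, x != 0 -> f x = g x) -> (\int[leb]_x f x = \int[leb]_x g x)%R.
Proof.
move=> mf mg fg; rewrite /Rintegral; congr fine.
apply: ae_eq_integral => //; [exact/measurable_EFinP|exact/measurable_EFinP|].
exists [set 0 : R]; split; [exact: measurable_set1|exact: lebesgue_measure_set1|].
move=> x /= H; apply: contrapT => x0; apply: H => _; congr EFin.
by apply: fg; apply/eqP.
Qed.

Lemma measurable_sk v : measurable_fun [set: R] (sk v).
Proof. by rewrite /sk; mfun. Qed.

Lemma is_derive_sinI (v : R) :
  is_derive v 1 (fun v => \int[leb]_x (cauchy x * sk v x))%R (cosI v).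
Proof.
have -> : cosI v = (\int[leb]_x (cauchy x * (cos (v * x) * (x ^+ 2 / x ^+ 2))))%R.
  apply: Rint_ae0.
  - by rewrite /cauchy; mfun.
  - by rewrite /cauchy; mfun.
  - by move=> x x0; rewrite divff ?mulr1// sqrf_eq0.
apply: (@is_derive_Rint R (fun v x => cauchy x * sk v x)
  (fun v x => cauchy x * (cos (v * x) * (x ^+ 2 / x ^+ 2))) cauchy).
- move=> u; apply: (@integ_cauchyM _ `|u|); first exact: measurable_sk.
  by move=> x; exact: sk_le.
- move=> u x; rewrite /sk; apply: is_derive_eq.
  by rewrite ?scaleRE /GRing.scale/=; ring.
- move=> u x _; rewrite normrM (ger0_norm (cauchy_ge0 x)).
  rewrite ler_piMr ?cauchy_ge0// normrM mulr_ile1 ?normr_ge0 ?cos_max//.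
  have [->|x0] := eqVneq x 0; first by rewrite expr0n/= mul0r normr0.
  by rewrite divff ?normr1// sqrf_eq0.
- exact: integ_cauchy.
Qed.

Lemma cst_halfline (f df : R -> R) : (forall x : R, is_derive x 1 f (df x)) ->
  (forall x, 0 <= x -> df x = 0) -> forall x, 0 <= x -> f x = f 0.
Proof.
move=> dfE df0 x; rewrite le_eqVlt => /predU1P[<-//|x0].
have cf : {within `[0, x], continuous f}.
  by apply: continuous_subspaceT => y; exact: is_derive_continuous (dfE y).
have [c] := MVT x0 (fun y _ => dfE y) cf.
rewrite in_itv/= => /andP[c0 _]; rewrite df0 ?ltW// mul0r => /eqP.
by rewrite subr_eq0 => /eqP.
Qed.

(** With [g] the difference of [coskI] and the expected solution, and [g'] its
    derivative, [g'' = g]: so [(g' + g) exp (- x)] is constant, hence 0, and then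
    [g exp x] is constant as well. *)
Lemma cauchy_cos (v : R) :
  (\int[leb]_x (cauchy x * cos (v * x)) = pi * expR (- `|v|))%R.
Proof.
wlog v0 : v / 0 <= v => [H|].
  have [/H//|/ltW v0] := leP 0 v; rewrite -normrN -H ?oppr_ge0//.
  by apply: eq_Rint => x; rewrite mulNr cosN.
rewrite (ger0_norm v0).
pose sinI (v : R) := (\int[leb]_x (cauchy x * sk v x))%R.
pose g (x : R) := coskI x - pi * (expR (- x) - 1 + x).
pose g' (x : R) := sinI x - pi * (1 - expR (- x)).
have dg (x : R) : is_derive x 1 g (g' x).
  have d1 : is_derive x 1 coskI (sinI x) := is_derive_coskI x.
  by rewrite /g /g'; apply: is_derive_eq; rewrite ?scaleRE /GRing.scale/=; ring.
have dg' (x : R) : is_derive x 1 g' (cosI x - pi * expR (- x)).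
  have d1 : is_derive x 1 sinI (cosI x) := is_derive_sinI x.
  by rewrite /g'; apply: is_derive_eq; rewrite ?scaleRE /GRing.scale/=; ring.
have cosIE x : 0 <= x -> cosI x = coskI x - pi * x + pi.
  by move=> x0; rewrite cauchy_coskE (ger0_norm x0); ring.
have g'0 : g' 0 = 0.
  rewrite /g' oppr0 expR0 subrr mulr0 subr0 /sinI.
  rewrite (_ : (fun x => _) = cst 0) ?Rintegral_cst//; first by rewrite mul0r.
  by apply/funext => x; rewrite /sk mul0r sin0 mulr0 mul0r mulr0.
have g0 : g 0 = 0.
  rewrite /g oppr0 expR0 subrr addr0 mulr0 subr0 /coskI.
  rewrite (_ : (fun x => _) = cst 0) ?Rintegral_cst//; first by rewrite mul0r.
  by apply/funext => x; rewrite /cosk mul0r cos0 subrr mul0r mulr0.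
(* [g'' = g], read as [(g' + g)' = g' + g] *)
have U x : 0 <= x -> g' x + g x = 0.
  move=> x0; pose u y := (g' y + g y) * expR (- y).
  have du (y : R) : is_derive y 1 u
      ((cosI y - pi * expR (- y) + g' y) * expR (- y) - (g' y + g y) * expR (- y)).
    rewrite /u; have := dg y; have := dg' y => d1 d2.
    by apply: is_derive_eq; rewrite ?scaleRE /GRing.scale/=; ring.
  have : u x = u 0.
    apply: (cst_halfline du) => // y y0.
    by rewrite cosIE// /g; ring.
  rewrite /u g0 g'0 addr0 mul0r => /eqP; rewrite mulf_eq0 => /orP[/eqP//|].
  by rewrite gt_eqF// expR_gt0.
have : g v * expR v = g 0 * expR 0.
  have dh (y : R) : is_derive y 1 (fun y => g y * expR y) ((g' y + g y) * expR y).
    have := dg y => d1.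
    by apply: is_derive_eq; rewrite ?scaleRE /GRing.scale/=; ring.
  by apply: (cst_halfline dh) => // y y0; rewrite U// mul0r.
rewrite g0 mul0r => /eqP; rewrite mulf_eq0 [X in _ || X]gt_eqF ?expR_gt0// orbF.
rewrite /g -/(cosI v) cosIE// => /eqP gv.
by transitivity (coskI v - pi * (expR (- v) - 1 + v) + pi * expR (- v)); [ring|rewrite gv add0r].
Qed.

End cauchy.

(** * The spectral density of exp (- t |x|_q^q) *)

Lemma powR_invX (R : realType) (t : R) (q : nat) : 0 < t -> (0 < q)%N ->
  ((t `^ (- q%:R^-1))^-1) ^+ q = t.
Proof.
move=> t0 q0; rewrite -powRN opprK -powR_mulrn ?powR_ge0// -powRrM mulVf ?powRr1 ?ltW//.
by rewrite pnatr_eq0 -lt0n.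
Qed.

Section psi_transform.
Context {R : realType}.
Local Notation leb := (@lebesgue_measure R).

Lemma Rint_opp (f : R -> R) : measurable_fun [set: R] f ->
  integ leb f -> (\int[leb]_x f (- x) = \int[leb]_x f x)%R.
Proof.
move=> mf fi; rewrite /Rintegral; congr fine.
have mN : measurable_fun [set: measurableTypeR R]
    (-%R : measurableTypeR R -> measurableTypeR R) by exact: measurable_funN.
have e : (\int[leb]_x (f x)%:E =
    \int[pushforward leb (-%R : measurableTypeR R -> measurableTypeR R)]_x (f x)%:E)%E.
  by apply: eq_measure_integral => A mA _; exact/esym/lebesgue_measureN.
rewrite e (@integral_pushforward _ _ _ _ R _ mN leb setT (EFin \o f)) //.
- exact/measurable_EFinP.
- rewrite preimage_setT.
  have mfN : measurable_fun [set: R] (fun x => f (- x)) by exact: (measurableT_comp mf mN).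
  apply/integrableP; split; first exact/measurable_EFinP.
  have := fi => /integrableP[_]; congr (_ < _)%E.
  rewrite /= (_ : (\int[leb]_x `|(f x)%:E|)%E =
    \int[pushforward leb (-%R : measurableTypeR R -> measurableTypeR R)]_x `|(f x)%:E|)%E; last first.
    by apply: eq_measure_integral => A mA _; exact/esym/lebesgue_measureN.
  rewrite ge0_integral_pushforward//.
  by apply/measurable_EFinP; exact: mf_norm.
Qed.

Lemma Rint_odd (f : R -> R) : measurable_fun [set: R] f -> integ leb f ->
  (forall x, f (- x) = - f x) -> (\int[leb]_x f x = 0)%R.
Proof.
move=> mf fi fN; have := Rint_opp mf fi.
have -> : (\int[leb]_x f (- x) = - \int[leb]_x f x)%R.
  rewrite -mulN1r -(RintZ _ fi); apply: eq_Rint => x; by rewrite fN mulN1r.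
by move=> /eqP; rewrite eq_sym -subr_eq0 opprK -mulr2n mulrn_eq0/= => /eqP.
Qed.

Lemma psi_ge0 q (u : R) : 0 <= psi q u.
Proof.
rewrite /psi; case: ifP => _.
  by rewrite invr_ge0 mulr_ge0 ?pi_ge0// addr_ge0// sqr_ge0.
by rewrite mulr_ge0 ?expR_ge0// invr_ge0 mulr_ge0// sqrtr_ge0.
Qed.

Lemma psiN q (u : R) : psi q (- u) = psi q u.
Proof. by rewrite /psi sqrrN. Qed.

Lemma psi1E (u : R) : psi 1 u = pi^-1 * cauchy u.
Proof. by rewrite /psi eqxx invfM. Qed.

(** The density for [q = 2] is a rescaled [gauss_fun], whose exponent is
    [- u^2]. *)
Lemma psi2E (u : R) : psi 2 u = (Num.sqrt pi)^-1 * (2^-1 * gauss_fun (2^-1 * u)).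
Proof.
rewrite /psi /= /gauss_fun invfM mulrA; congr (_ * expR _); first by rewrite mulrC.
by field.
Qed.

Lemma continuous_psi q : (q = 1 \/ q = 2)%N -> continuous (@psi R q).
Proof.
case=> ->.
  rewrite (_ : psi 1 = fun u : R => pi^-1 * cauchy u); last exact/funext/psi1E.
  by move=> x; apply: cvgM; [exact: cvg_cst|exact: continuous_cauchy].
rewrite (_ : psi 2 = fun u : R => (Num.sqrt pi)^-1 * (2^-1 * gauss_fun (2^-1 * u)));
  last exact/funext/psi2E.
move=> x; apply: cvgM; first exact: cvg_cst.
apply: cvgM; first exact: cvg_cst.
exact: (continuous_scale (@continuous_gauss_fun R)).
Qed.

Lemma psi_cos q (v : R) : (q = 1 \/ q = 2)%N ->
  integ leb (psi q) /\
  (\int[leb]_x (psi q x * cos (v * x)) = expR (- (`|v| ^+ q)))%R.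
Proof.
case=> ->.
  have i : integ leb (fun u => pi^-1 * cauchy u) by apply: integZ; exact: integ_cauchy.
  split; first by apply: (@eq_integ _ _ _ leb _ _ (fun u => esym (psi1E u)) i).
  have E x : psi 1 x * cos (v * x) = pi^-1 * (cauchy x * cos (v * x)).
    by rewrite psi1E mulrA.
  rewrite (eq_Rint leb E) (RintZ _ (integ_cauchy_cos v)) cauchy_cos mulKf//.
  by rewrite gt_eqF// pi_gt0.
have h0 : (0 : R) < 2^-1 by rewrite invr_gt0.
have [i1 _] := Rint_scale h0 (@continuous_gauss_fun R) integ_gauss.
have i : integ leb (fun u => (Num.sqrt pi)^-1 * (2^-1 * gauss_fun (2^-1 * u))).
  exact: integZ.
split; first by apply: (@eq_integ _ _ _ leb _ _ (fun u => esym (psi2E u)) i).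
pose g (x : R) := gauss_fun x * cos ((2 * v) * x).
have ig : integ leb g.
  apply: (@integMb _ _ _ leb _ _ 1 integ_gauss) => [|x]; last exact: cos_max.
  by mfun.
have cg : continuous g.
  by move=> x; apply: cvgM; [exact: continuous_gauss_fun|exact: continuous_cosM].
have [i2 e2] := Rint_scale h0 cg ig.
have E x : psi 2 x * cos (v * x) = (Num.sqrt pi)^-1 * (2^-1 * g (2^-1 * x)).
  rewrite psi2E /g -!mulrA; do 3 congr (_ * _).
  by congr cos; field.
rewrite (eq_Rint leb E) (RintZ _ i2) e2 gauss_cos mulKf; last first.
  by rewrite gt_eqF// sqrtr_gt0 pi_gt0.
by congr expR; rewrite real_normK ?num_real//; field.
Qed.

Lemma psi_t_ge0 q (t u : R) : 0 <= psi_t q t u.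
Proof. by rewrite mulr_ge0 ?powR_ge0 ?psi_ge0. Qed.

Lemma psi_t_transform q (t v : R) : (q = 1 \/ q = 2)%N -> 0 < t ->
  [/\ integ leb (psi_t q t),
    (\int[leb]_x (psi_t q t x * cos (v * x)) = expR (- (t * `|v| ^+ q)))%R &
    (\int[leb]_x (psi_t q t x * sin (v * x)) = 0)%R].
Proof.
move=> hq t0; pose c := t `^ (- q%:R^-1).
have c0 : 0 < c by rewrite powR_gt0.
have cn : c != 0 by rewrite gt_eqF.
have [ip _] := psi_cos 0 hq.
have cp := continuous_psi hq.
have [i _] := Rint_scale c0 cp ip.
have mp : measurable_fun [set: R] (psi q) by exact: continuous_measurable_fun.
split => //.
  pose g (x : R) := psi q x * cos (v / c * x).
  have ig : integ leb g.
    apply: (@integMb _ _ _ leb _ _ 1 ip) => [|x]; last exact: cos_max.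
    by mfun.
  have cg : continuous g.
    by move=> x; apply: cvgM; [exact: cp|exact: continuous_cosM].
  have [_ e] := Rint_scale c0 cg ig.
  have E x : psi_t q t x * cos (v * x) = c * g (c * x).
    by rewrite /psi_t -/c /g -mulrA; congr (_ * (_ * cos _)); rewrite mulrA divfK.
  rewrite (eq_Rint leb E) e (psi_cos (v / c) hq).2; congr (expR (- _)).
  rewrite normrM exprMn mulrC; congr (_ * _).
  rewrite normfV gtr0_norm// /c powR_invX//.
  by case: hq => ->.
apply: Rint_odd.
- apply: measurable_funM; first exact: (integ_measurable i).
  by mfun.
- apply: (@integMb _ _ _ leb _ _ 1 i) => [|x]; last exact: sin_max.
  by mfun.
- by move=> x; rewrite /psi_t !mulrN psiN sinN mulrN.
Qed.
End psi_transform.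

Section mpower_transform.
Context {R : realType}.
Local Notation leb := (@lebesgue_measure R).

Definition tdot n (x y : n.-tuple R) : R := \sum_(i < n) tnth x i * tnth y i.

Lemma mf_tnth d (T : measurableType d) n (f : T -> n.-tuple R) i :
  measurable_fun setT f -> measurable_fun setT (fun x => tnth (f x) i).
Proof. by move=> mf; exact: (measurableT_comp (measurable_tnth i) mf). Qed.

Lemma measurable_tdot n (v : n.-tuple R) :
  measurable_fun setT (fun om : n.-tuple R => tdot om v).
Proof.
apply: mf_sum => i; apply: measurable_funM; first exact: measurable_tnth.
exact: measurable_cst.
Qed.

Lemma tdot_cons n (x y : R) (v w : n.-tuple R) :
  tdot (tuple_cons (x, v)) (tuple_cons (y, w)) = x * y + tdot v w.
Proof.
rewrite /tdot big_ord_recl !tnth0; congr (_ + _).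
by apply: eq_bigr => i _; rewrite !tnthS.
Qed.

Lemma tuple_consE n (v : n.+1.-tuple R) :
  exists y w, v = tuple_cons (y, w).
Proof.
exists (thead v), [tuple of behead v]; apply/val_inj => /=.
by case: v => -[].
Qed.

(** The recursive product measure is an image measure, so that an integral over
    [n + 1] coordinates is one over a pair. *)
Lemma mpower_pushforward n (f : n.+1.-tuple R -> R) : measurable_fun setT f ->
  integ (leb \x mpower leb n)%E (fun z => f (tuple_cons z)) ->
  integ (mpower leb n.+1) f /\
  (\int[mpower leb n.+1]_x f x = \int[(leb \x mpower leb n)%E]_z f (tuple_cons z))%R.
Proof.
move=> mf fi.
have mc := @measurable_tuple_cons _ (measurableTypeR R) n.
have mfE : measurable_fun setT (EFin \o f) by exact/measurable_EFinP.
split.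
  apply: (@integrable_pushforward _ _ _ _ R _ mc (leb \x mpower leb n)%E setT
    (EFin \o f) mfE) => //.
rewrite /Rintegral; congr fine.
exact: (@integral_pushforward _ _ _ _ R _ mc (leb \x mpower leb n)%E setT
    (EFin \o f) mfE).
Qed.

Variables (w cw : R -> R).
Hypothesis iw : integ leb w.
Hypothesis w0 : forall x, 0 <= w x.
Hypothesis wc : forall v, (\int[leb]_x (w x * cos (v * x)) = cw v)%R.
Hypothesis ws : forall v, (\int[leb]_x (w x * sin (v * x)) = 0)%R.

Definition wprod n (om : n.-tuple R) := \prod_(i < n) w (tnth om i).

Lemma wprod_ge0 n (om : n.-tuple R) : 0 <= wprod om.
Proof. by apply: prodr_ge0 => i _. Qed.

Lemma wprod_cons n x (om : n.-tuple R) : wprod (tuple_cons (x, om)) = w x * wprod om.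
Proof.
rewrite /wprod big_ord_recl !tnth0; congr (_ * _).
by apply: eq_bigr => i _; rewrite !tnthS.
Qed.

Lemma measurable_wprod n : measurable_fun setT (@wprod n).
Proof.
apply: mf_prod => i; have mw := integ_measurable iw.
exact: (measurableT_comp mw (measurable_tnth i)).
Qed.

(** A product density has a product transform: the phase of the first coordinate
    is split off by the addition formulas, and the sine part vanishes by
    [ws]. *)
Lemma wprod_transform n (v : n.-tuple R) :
  [/\ integ (mpower leb n) (@wprod n),
   (\int[mpower leb n]_om (wprod om * cos (tdot om v)) = \prod_(i < n) cw (tnth v i))%R &
   (\int[mpower leb n]_om (wprod om * sin (tdot om v)) = 0)%R].
Proof.
have mcs m (u : m.-tuple R) :
    measurable_fun setT (fun om : m.-tuple R => wprod om * cos (tdot om u)).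
  by apply: measurable_funM; [exact: measurable_wprod|apply: mf_cos; exact: measurable_tdot].
have msn m (u : m.-tuple R) :
    measurable_fun setT (fun om : m.-tuple R => wprod om * sin (tdot om u)).
  by apply: measurable_funM; [exact: measurable_wprod|apply: mf_sin; exact: measurable_tdot].
elim: n v => [v|n IH v].
  have W (om : 0.-tuple R) : wprod om = 1 by rewrite /wprod big_ord0.
  have D (om : 0.-tuple R) : tdot om v = 0 by rewrite /tdot big_ord0.
  split.
  - rewrite /integ (_ : EFin \o @wprod 0 = cst 1%E); last first.
      by apply/funext => om; rewrite /= W.
    apply/integrableP; split; first exact: measurable_cst.
    by rewrite integral_cst//= normr1 mul1e diracT ltry.
  - rewrite /Rintegral (_ : (fun x => _) = cst 1%E); last first.
      by apply/funext => om; rewrite W D cos0 mulr1.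
    have e : mpower leb 0 setT = 1%E by exact: diracT.
    rewrite integral_cst; last exact: measurableT.
    by rewrite mul1e big_ord0; exact: (congr1 fine e).
  - rewrite /Rintegral integral0_eq// => om _.
    by rewrite W D sin0 mulr0.
have [y [u ->]] := tuple_consE v.
have [iW eC eS] := IH u.
have mw := integ_measurable iw.
have m1 : measurable_fun setT (fun z : R * n.-tuple R => w z.1).
  exact: (mf_comp1 mw).
have m2 : measurable_fun setT (fun z : R * n.-tuple R => wprod z.2).
  exact: (mf_comp2 (@measurable_wprod n)).
have m3 : measurable_fun setT (fun z : R * n.-tuple R => tdot z.2 u).
  exact: (mf_comp2 (measurable_tdot u)).
have m4 : measurable_fun setT (fun z : R * n.-tuple R => z.1 * y) by mfun.
have dom (h : R * n.-tuple R -> R) : measurable_fun setT h -> (forall z, `|h z| <= 1) ->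
    [/\ integ (leb \x mpower leb n)%E (fun z => w z.1 * wprod z.2 * h z) &
     (\int[(leb \x mpower leb n)%E]_z (w z.1 * wprod z.2 * h z) =
      \int[leb]_x \int[mpower leb n]_om (w x * wprod om * h (x, om)))%R].
  move=> mh h1.
  have mF : measurable_fun setT (fun z : R * n.-tuple R => w z.1 * wprod z.2 * h z) by mfun.
  have le x om : `|w x * wprod om * h (x, om)| <= w x * wprod om.
    rewrite normrM (ger0_norm (mulr_ge0 (w0 x) (wprod_ge0 om))).
    by rewrite ler_piMr ?h1// mulr_ge0// wprod_ge0.
  split.
    by apply: (@fubini_dom_prod _ _ _ _ _ leb (mpower leb n) _ _ _ _ le iw iW); exact: mF.
  by apply: (@fubini_domE1 _ _ _ _ _ leb (mpower leb n)
    (fun z => w z.1 * wprod z.2 * h z) _ _ _ le iw iW); exact: mF.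
have icos x : integ (mpower leb n) (fun om => wprod om * cos (tdot om x)).
  by apply: integMb iW _ (fun=> cos_max _); apply: mf_cos; exact: measurable_tdot.
have isin x : integ (mpower leb n) (fun om => wprod om * sin (tdot om x)).
  by apply: integMb iW _ (fun=> sin_max _); apply: mf_sin; exact: measurable_tdot.
have jcos x : integ leb (fun z => w z * cos (x * z)).
  by apply: integMb iw _ (fun=> cos_max _); apply: continuous_measurable_fun; exact: continuous_cosM.
have jsin x : integ leb (fun z => w z * sin (x * z)).
  by apply: integMb iw _ (fun=> sin_max _); apply: continuous_measurable_fun; exact: continuous_sinM.
have [i1 _] := dom (fun=> 1) (mf_cst _) (fun=> ltac:(by rewrite normr1)).
have [i2 e2] := dom (fun z => cos (z.1 * y + tdot z.2 u)) ltac:(by mfun) (fun=> cos_max _).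
have [i3 e3] := dom (fun z => sin (z.1 * y + tdot z.2 u)) ltac:(by mfun) (fun=> sin_max _).
split.
- apply: (mpower_pushforward _ _).1; first exact: measurable_wprod.
  by apply: eq_integ i1 => -[x om]; rewrite wprod_cons mulr1.
- have E z : wprod (tuple_cons z) * cos (tdot (tuple_cons z) (tuple_cons (y, u))) =
     w z.1 * wprod z.2 * cos (z.1 * y + tdot z.2 u).
    by case: z => x om; rewrite wprod_cons tdot_cons.
  have j := @eq_integ _ _ _ (leb \x mpower leb n)%E _ _ (fun z => esym (E z)) i2.
  rewrite (mpower_pushforward (mcs _ _) j).2.
  rewrite (eq_Rint (leb \x mpower leb n)%E E) e2 big_ord_recl tnth0 -wc.
  under [in RHS]eq_bigr do rewrite tnthS.
  rewrite -eC mulrC -(RintZ _ (jcos y)); apply: eq_Rint => x /=.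
  have E2 om : w x * wprod om * cos (x * y + tdot om u) =
     w x * cos (y * x) * (wprod om * cos (tdot om u)) -
     w x * sin (y * x) * (wprod om * sin (tdot om u)).
    by rewrite cosD (mulrC x y); ring.
  rewrite (eq_Rint (mpower leb n) E2) (RintB (integZ _ (icos u)) (integZ _ (isin u))).
  by rewrite (RintZ _ (icos u)) (RintZ _ (isin u)) eS mulr0 subr0 mulrC.
- have E z : wprod (tuple_cons z) * sin (tdot (tuple_cons z) (tuple_cons (y, u))) =
     w z.1 * wprod z.2 * sin (z.1 * y + tdot z.2 u).
    by case: z => x om; rewrite wprod_cons tdot_cons.
  have j := @eq_integ _ _ _ (leb \x mpower leb n)%E _ _ (fun z => esym (E z)) i3.
  rewrite (mpower_pushforward (msn _ _) j).2.
  rewrite (eq_Rint (leb \x mpower leb n)%E E) e3.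
  transitivity (\int[leb]_x (\prod_(i < n) cw (tnth u i) * (w x * sin (y * x))))%R.
    apply: eq_Rint => x /=.
    have E2 om : w x * wprod om * sin (x * y + tdot om u) =
       w x * sin (y * x) * (wprod om * cos (tdot om u)) +
       w x * cos (y * x) * (wprod om * sin (tdot om u)).
      by rewrite sinD (mulrC x y); ring.
    rewrite (eq_Rint (mpower leb n) E2) (RintD (integZ _ (icos u)) (integZ _ (isin u))).
    by rewrite (RintZ _ (icos u)) (RintZ _ (isin u)) eS mulr0 addr0 eC mulrC.
  by rewrite (RintZ _ (jsin y)) ws mulr0.
Qed.
End mpower_transform.

Lemma q_t_transform (R : realType) p q (t : R) (v : p.-tuple R) :
  (q = 1 \/ q = 2)%N -> 0 < t ->
  [/\ integ (mpower (@lebesgue_measure R) p) (q_t q t),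
   (\int[mpower (@lebesgue_measure R) p]_om (q_t q t om * cos (tdot om v)) =
     expR (- (t * \sum_(i < p) `|tnth v i| ^+ q)))%R &
   (\int[mpower (@lebesgue_measure R) p]_om (q_t q t om * sin (tdot om v)) = 0)%R].
Proof.
move=> hq t0; have ip := psi_t_transform _ hq t0.
have [i1 _ _] := ip 0.
have [h1 h2 h3] := @wprod_transform R (psi_t q t)
  (fun v => expR (- (t * `|v| ^+ q))) i1 (psi_t_ge0 q t)
  (fun v => let: And3 _ e _ := ip v in e) (fun v => let: And3 _ _ e := ip v in e) p v.
split; [exact: h1| |exact: h3].
by rewrite [LHS]h2 -expR_sum sumrN mulr_sumr.
Qed.

(** * Square-integrable functions *)

(** The discriminant argument, from which the Cauchy-Schwarz inequalities and the
    normal equations below are deduced. *)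
Lemma quad_ge0 (R : realFieldType) (a b c : R) :
  (forall t, 0 <= a + 2 * t * b + t ^+ 2 * c) -> b ^+ 2 <= a * c.
Proof.
move=> H; have a0 : 0 <= a by have := H 0; rewrite mulr0 mul0r expr0n/= mul0r !addr0.
have c0 : 0 <= c.
  rewrite leNgt; apply/negP => c0.
  pose s := a / - c + 1.
  have s1 : 1 <= s by rewrite /s lerDr divr_ge0// oppr_ge0 ltW.
  have sE : s * - c = a - c by rewrite /s; field; rewrite lt_eqF.
  have [b0|b0] := leP 0 b; [have := H (- s)|have := H s]; nra.
have [cE|cn] := eqVneq c 0.
  suff -> : b = 0 by rewrite expr0n/= cE mulr0.
  apply/eqP; apply: contraT => bn.
  have := H (- (a + 1) / (2 * b)); rewrite cE mulr0 addr0.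
  have -> : a + 2 * (- (a + 1) / (2 * b)) * b = -1 by field.
  by rewrite oppr_ge0 ler10.
have cp : 0 < c by rewrite lt_neqAle eq_sym cn.
have := H (- b / c).
have -> : a + 2 * (- b / c) * b + (- b / c) ^+ 2 * c = (a * c - b ^+ 2) / c by field.
by rewrite pmulr_lge0 ?invr_gt0// subr_ge0.
Qed.

Lemma sq_le_sqrt (R : rcfType) (x y z : R) : 0 <= z -> x ^+ 2 <= y * z ^+ 2 ->
  `|x| <= Num.sqrt y * z.
Proof.
move=> z0 h; rewrite -sqrtr_sqr; apply: le_trans (ler_wsqrtr h) _.
by rewrite mulrC sqrtrM ?sqr_ge0// sqrtr_sqr ger0_norm// mulrC.
Qed.

Section L2.
Context d (T : measurableType d) (R : realType) (P : probability T R).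
Implicit Types a b : T -> R.

Definition L2 a := measurable_fun setT a /\ integ P (fun w => a w ^+ 2).

Lemma integ_cst (c : R) : integ P (fun=> c).
Proof. exact: finite_measure_integrable_cst. Qed.

Lemma Rint_cstP (c : R) : (\int[P]_w (fun=> c) w)%R = c.
Proof. by rewrite Rintegral_cst//= probability_setT/= mulr1. Qed.

Lemma L2_integM a b : L2 a -> L2 b -> integ P (fun w => a w * b w).
Proof.
move=> [ma ia] [mb ib]; apply: (@integ_le _ _ _ P _ (fun w => a w ^+ 2 + b w ^+ 2)).
- exact: measurable_funM.
- move=> w; rewrite ler_norml; apply/andP; split; nra.
- exact: integD.
Qed.

Lemma L2_cst (c : R) : L2 (fun=> c).
Proof. by split; [exact: mf_cst|exact: integ_cst]. Qed.

Lemma L2_integ a : L2 a -> integ P a.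
Proof.
move=> aL; have := L2_integM aL (L2_cst 1).
by apply: eq_integ => w; rewrite mulr1.
Qed.

Lemma L2D a b : L2 a -> L2 b -> L2 (fun w => a w + b w).
Proof.
move=> [ma ia] [mb ib]; split; first exact: measurable_funD.
apply: (@integ_le _ _ _ P _ (fun w => 2 * (a w ^+ 2 + b w ^+ 2))).
- by apply: measurable_funX; exact: measurable_funD.
- by move=> w; rewrite ger0_norm ?sqr_ge0//; have := sqr_ge0 (a w - b w); nra.
- by apply: integZ; exact: integD.
Qed.

Lemma L2Z c a : L2 a -> L2 (fun w => c * a w).
Proof.
move=> [ma ia]; split; first by apply: measurable_funM => //; exact: mf_cst.
by apply: eq_integ (integZ (c ^+ 2) ia) => w; rewrite exprMn.
Qed.

Lemma L2B a b : L2 a -> L2 b -> L2 (fun w => a w - b w).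
Proof.
move=> aL bL; have -> : (fun w => a w - b w) = (fun w => a w + -1 * b w).
  by apply/funext => w; rewrite mulN1r.
by apply: L2D => //; exact: L2Z.
Qed.

Lemma L2_abs a : L2 a -> L2 (fun w => `|a w|).
Proof.
move=> [ma ia]; split; first exact: mf_norm.
by apply: eq_integ ia => w; rewrite real_normK ?num_real.
Qed.

Lemma L2_le a b : measurable_fun setT a -> (forall w, `|a w| <= `|b w|) -> L2 b -> L2 a.
Proof.
move=> ma ab [mb ib]; split=> //; apply: integ_le ib; first exact: measurable_funX.
by move=> w; rewrite normrX -[leRHS]real_normK ?num_real// lerXn2r ?nnegrE.
Qed.

Lemma L2_bnd a (c : R) : measurable_fun setT a -> (forall w, `|a w| <= c) -> L2 a.
Proof.
move=> ma ac; apply: (L2_le ma _ (L2_cst c)) => w.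
by rewrite (le_trans (ac w))// ler_norm.
Qed.

Lemma Rint_sqr_abs a : (\int[P]_w (`|a w| ^+ 2) = \int[P]_w (a w ^+ 2))%R.
Proof. by apply: eq_Rint => w; rewrite real_normK ?num_real. Qed.

Lemma L2_CS a b : L2 a -> L2 b ->
  (\int[P]_w (a w * b w))%R ^+ 2 <= (\int[P]_w (a w ^+ 2))%R * (\int[P]_w (b w ^+ 2))%R.
Proof.
move=> aL bL; apply: quad_ge0 => t.
have -> : (\int[P]_w (a w ^+ 2) + 2 * t * \int[P]_w (a w * b w) +
   t ^+ 2 * \int[P]_w (b w ^+ 2) = \int[P]_w ((a w + t * b w) ^+ 2))%R.
  rewrite -(RintZ _ (L2_integM aL bL)) -(RintZ _ bL.2) -RintD; last 2 first.
  - exact: aL.2.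
  - by apply: integZ; exact: L2_integM.
  rewrite -RintD; last 2 first.
  - by apply: integD; [exact: aL.2|apply: integZ; exact: L2_integM].
  - by apply: integZ; exact: bL.2.
  by apply: eq_Rint => w; ring.
by apply: Rintegral_ge0 => w _; exact: sqr_ge0.
Qed.

Lemma L2_abs_le a : L2 a -> (\int[P]_w `|a w|)%R ^+ 2 <= (\int[P]_w (a w ^+ 2))%R.
Proof.
move=> aL; have := L2_CS (L2_abs aL) (L2_cst 1).
have -> : (\int[P]_w (`|a w| * 1) = \int[P]_w `|a w|)%R.
  by apply: eq_Rint => w; rewrite mulr1.
by rewrite Rint_sqr_abs Rint_cstP expr1n mulr1.
Qed.
End L2.

(** * Minimizing a quadratic functional on a Hilbert space of functions *)

Section hilbert.
Context {R : realType} {T : Type}.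
Variables (k : T -> T -> R) (H : set (T -> R)) (dot : (T -> R) -> (T -> R) -> R).
Hypothesis hH : is_rkhs k H dot.
Implicit Types f g e : T -> R.

Lemma HZ c f : H f -> H (fun x => c * f x).
Proof.
move=> Hf; have := rkhs_lin hH c Hf (rkhs_zero hH).
by congr H; apply/funext => x; rewrite addr0.
Qed.

Lemma HD f g : H f -> H g -> H (fun x => f x + g x).
Proof.
move=> Hf Hg; have := rkhs_lin hH 1 Hf Hg.
by congr H; apply/funext => x; rewrite mul1r.
Qed.

Lemma HB f g : H f -> H g -> H (fun x => f x - g x).
Proof.
move=> Hf Hg; have := rkhs_lin hH (-1) Hg Hf.
by congr H; apply/funext => x; rewrite mulN1r addrC.
Qed.

Record psd_form (B : (T -> R) -> (T -> R) -> R) : Prop := PsdForm {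
  psd_sym : forall f g, H f -> H g -> B f g = B g f ;
  psd_lin : forall a f g e, H f -> H g -> H e ->
    B (fun x => a * f x + g x) e = a * B f e + B g e ;
  psd_ge0 : forall f, H f -> 0 <= B f f }.

Lemma dot_psd : psd_form dot.
Proof.
split; [exact: (rkhs_dotC hH)|exact: (rkhs_dotl hH)|exact: (rkhs_dot_ge0 hH)].
Qed.

Section form.
Variable B : (T -> R) -> (T -> R) -> R.
Hypothesis hB : psd_form B.

Lemma psd_expand f g (t : R) : H f -> H g ->
  B (fun x => t * g x + f x) (fun x => t * g x + f x) =
  B f f + 2 * t * B f g + t ^+ 2 * B g g.
Proof.
move=> Hf Hg; have Hs := rkhs_lin hH t Hg Hf.
rewrite (psd_lin hB)// (psd_sym hB Hg)// (psd_sym hB Hf)// !(psd_lin hB)//.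
by rewrite (psd_sym hB Hg Hf); ring.
Qed.

Lemma psd_CS f g : H f -> H g -> B f g ^+ 2 <= B f f * B g g.
Proof.
move=> Hf Hg; apply: quad_ge0 => t.
rewrite -(psd_expand t Hf Hg); apply: (psd_ge0 hB).
exact: (rkhs_lin hH).
Qed.

Lemma psd_subE f g : H f -> H g ->
  B (fun x => f x - g x) (fun x => f x - g x) = B f f - 2 * B f g + B g g.
Proof.
move=> Hf Hg.
have -> : (fun x => f x - g x) = (fun x => -1 * g x + f x).
  by apply/funext => x; rewrite mulN1r addrC.
by rewrite psd_expand//; ring.
Qed.

End form.

Lemma rkhs_bound f x : H f -> f x ^+ 2 <= dot f f * k x x.
Proof.
move=> Hf; rewrite (rkhs_repr hH x Hf).
rewrite (rkhs_repr hH x (rkhs_kernel hH x)).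
by apply: (psd_CS dot_psd) => //; exact: (rkhs_kernel hH).
Qed.

Lemma rkhs_diff f x y : H f ->
  (f x - f y) ^+ 2 <= dot f f * (k x x - 2 * k x y + k y y).
Proof.
move=> Hf; have Kx := rkhs_kernel hH x; have Ky := rkhs_kernel hH y.
have E u v : dot (fun z => k z u) (fun z => k z v) = k v u.
  by rewrite -(rkhs_repr hH v (rkhs_kernel hH u)).
have E1 : f x - f y = dot f (fun z => k z x - k z y).
  rewrite (rkhs_dotC hH Hf (HB Kx Ky)).
  have -> : (fun z => k z x - k z y) = (fun z => -1 * k z y + k z x).
    by apply/funext => z; rewrite mulN1r addrC.
  rewrite (rkhs_dotl hH)// -(rkhs_dotC hH Hf Ky) -(rkhs_dotC hH Hf Kx).
  by rewrite -!(rkhs_repr hH _ Hf) mulN1r addrC.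
have E2 : dot (fun z => k z x - k z y) (fun z => k z x - k z y) =
    k x x - 2 * k x y + k y y.
  by rewrite (psd_subE dot_psd Kx Ky) !E -(E y x) (rkhs_dotC hH Ky Kx) E.
by rewrite E1 -E2; apply: (psd_CS dot_psd) => //; exact: HB.
Qed.

Section minimize.
Variables (A : (T -> R) -> (T -> R) -> R) (L : (T -> R) -> R) (lam K c : R).
Hypothesis hA : psd_form A.
Hypothesis lam0 : 0 < lam.
Hypothesis A_lb : forall f, H f -> lam * dot f f <= A f f.
Hypothesis A_ub : forall f, H f -> A f f <= K * dot f f.
Hypothesis L_lin : forall a f g, H f -> H g ->
  L (fun x => a * f x + g x) = a * L f + L g.
Hypothesis L_bnd : forall f, H f -> L f ^+ 2 <= c * dot f f.

Let Phi f := 2^-1 * A f f - L f.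

Lemma Phi_line f g t : H f -> H g -> Phi (fun x => t * g x + f x) =
  Phi f + t * (A f g - L g) + t ^+ 2 / 2 * A g g.
Proof. by move=> Hf Hg; rewrite /Phi (psd_expand hA t Hf Hg) L_lin//; field. Qed.

(** Completing the square: by [L_bnd] and [A_lb] the linear part is dominated by
    the quadratic one up to a constant. *)
Lemma Phi_bnd : exists2 b, 0 <= b & forall f, H f -> - b <= Phi f.
Proof.
exists (`|c| / lam) => [|f Hf]; first by rewrite divr_ge0// ltW.
have h1 := A_lb Hf; have h2 := L_bnd Hf; have n0 := rkhs_dot_ge0 hH Hf.
rewrite /Phi lerNl opprB lerBlDr.
have : L f * lam <= (`|c| / lam + 2^-1 * A f f) * lam; last by rewrite ler_pM2r// addrC.
rewrite mulrDl divfK ?gt_eqF//.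
have c1 := ler_norm c; have c0 := normr_ge0 c.
have h3 : L f ^+ 2 <= `|c| * dot f f by rewrite (le_trans h2)// ler_wpM2r.
have h4 : lam ^+ 2 * dot f f / 2 <= 2^-1 * A f f * lam.
  have := ler_wpM2r (ltW lam0) h1; nra.
suff : L f * lam <= `|c| + lam ^+ 2 * dot f f / 2 by nra.
have [|Lp] := leP (L f) 0; first by move=> Ln; have := mulr_le0_ge0 Ln (ltW lam0); have := mulr_ge0 (sqr_ge0 lam) n0; lra.
rewrite leNgt; apply/negP => h.
have : (`|c| + lam ^+ 2 * dot f f / 2) ^+ 2 < (L f * lam) ^+ 2.
  by rewrite ltrXn2r// ?nnegrE; nra.
have := ler_wpM2r (sqr_ge0 lam) h3.
have := sqr_ge0 (`|c| - lam ^+ 2 * dot f f / 2).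
nra.
Qed.

(** The parallelogram identity for [A]: it makes minimizing sequences of [Phi]
    Cauchy, the gap between [Phi] and its infimum controlling their distance. *)
Lemma Phi_mid f g : H f -> H g ->
  8^-1 * A (fun x => f x - g x) (fun x => f x - g x) =
  2^-1 * (Phi f + Phi g) - Phi (fun x => 2^-1 * (f x + g x)).
Proof.
move=> Hf Hg.
have Hd := HB Hg Hf.
have dE : (fun x => g x - f x) = (fun x => -1 * f x + g x).
  by apply/funext => x; rewrite mulN1r addrC.
have -> : (fun x => 2^-1 * (f x + g x)) = (fun x => 2^-1 * (g x - f x) + f x).
  by apply/funext => x; field.
have A1 : A f (fun x => g x - f x) = A f g - A f f.
  rewrite (psd_sym hA Hf Hd) dE (psd_lin hA _ Hf Hg Hf) (psd_sym hA Hg Hf); ring.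
have L1 : L (fun x => g x - f x) = L g - L f by rewrite dE L_lin// mulN1r addrC.
rewrite (Phi_line _ Hf Hd) A1 L1 !psd_subE// (psd_sym hA Hg Hf) /Phi; by field.
Qed.

Lemma hnorm_sq f : H f -> hnorm dot f ^+ 2 = dot f f.
Proof. by move=> Hf; rewrite /hnorm sqr_sqrtr// (rkhs_dot_ge0 hH). Qed.

(** The direct method: minimizing sequences are Cauchy by [Phi_mid], [H] is
    complete, and [Phi] is continuous. *)
Theorem Phi_min : exists2 f, H f & forall g, H g -> Phi f <= Phi g.
Proof.
have [b b0 hb] := Phi_bnd.
pose S := [set Phi f | f in H].
have S0 : S !=set0 by exists (Phi (fun=> 0)); exists (fun=> 0) => //; exact: (rkhs_zero hH).
have lbS : has_lbound S by exists (- b) => _ [f Hf <-]; exact: hb.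
have iS : has_inf S by split.
pose m := inf S.
have mle f : H f -> m <= Phi f by move=> Hf; apply: ge_inf => //; exists f.
have hu n : exists f, H f /\ Phi f < m + n.+1%:R^-1.
  have e0 : 0 < (n.+1%:R^-1 : R) by rewrite invr_gt0.
  by have [_ [f Hf <-] h] := inf_adherent e0 iS; exists f.
pose u n := projT1 (cid (hu n)).
have Hu n : H (u n) by rewrite /u; case: cid => f [].
have uS n : Phi (u n) < m + n.+1%:R^-1 by rewrite /u; case: cid => f [].
have dec (n N : nat) : (N <= n)%N -> (n.+1%:R^-1 : R) <= N.+1%:R^-1.
  by move=> Nn; rewrite lef_pV2 ?posrE// ler_nat.
have cau (e : R) : 0 < e -> exists N, forall p n, (N <= p)%N -> (N <= n)%N ->
    hnorm dot (fun x => u p x - u n x) < e.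
  move=> e0; have h0 : 0 < lam / 8 * e ^+ 2 by rewrite mulr_gt0 ?divr_gt0 ?exprn_gt0.
  have [N hN] : exists N : nat, N.+1%:R^-1 < lam / 8 * e ^+ 2.
    exists (Num.trunc (lam / 8 * e ^+ 2)^-1).
    rewrite -[ltRHS]invrK ltf_pV2 ?posrE ?invr_gt0//.
    exact: truncnS_gt.
  exists N => p n Np Nn.
  have Hpn := HB (Hu p) (Hu n).
  have h1 := A_lb Hpn.
  have h2 := Phi_mid (Hu p) (Hu n).
  have h3 : m <= Phi (fun x => 2^-1 * (u p x + u n x)) by apply: mle; apply: HZ; exact: HD.
  have h4 := uS p; have h5 := uS n; have h6 := dec _ _ Np; have h7 := dec _ _ Nn.
  rewrite -(@ltr_pXn2r _ 2)// ?nnegrE ?sqrtr_ge0 ?ltW// hnorm_sq//.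
  rewrite -(@ltr_pM2l _ (lam / 8)) ?divr_gt0//.
  apply: le_lt_trans hN.
  move: h1 h2 h3 h4 h5 h6 h7.
  move: (dot _ _) (A _ _) (Phi (u p)) (Phi (u n)) (Phi (fun _ => _))
    (p.+1%:R^-1) (n.+1%:R^-1) (N.+1%:R^-1) => *; lra.
have [f Hf cf] := rkhs_complete hH Hu cau.
exists f => // g Hg; apply: le_trans (mle _ Hg).
(* [Phi] is continuous at [f], with an explicit modulus *)
pose C := Num.sqrt (A f f * K) + Num.sqrt c.
have key n : Phi f <= m + n.+1%:R^-1 + C * hnorm dot (fun x => u n x - f x).
  pose e := (fun x => u n x - f x).
  have He : H e by exact: HB.
  have uE : u n = (fun x => 1 * e x + f x).
    by apply/funext => x; rewrite mul1r /e subrK.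
  have P1 : Phi (u n) = Phi f + (A f e - L e) + 2^-1 * A e e.
    by rewrite uE Phi_line// mul1r expr1n mul1r.
  have Ae0 := psd_ge0 hA He.
  have n0 : 0 <= hnorm dot e by exact: sqrtr_ge0.
  have h1 : `|A f e| <= Num.sqrt (A f f * K) * hnorm dot e.
    apply: sq_le_sqrt => //; rewrite hnorm_sq// (le_trans (psd_CS hA Hf He))//.
    by rewrite -mulrA ler_wpM2l ?(psd_ge0 hA)// A_ub.
  have h2 : `|L e| <= Num.sqrt c * hnorm dot e.
    by apply: sq_le_sqrt => //; rewrite hnorm_sq// L_bnd.
  have h3 := uS n; have h4 := ler_norm (L e); have h5 := ler_norm (- A f e).
  rewrite normrN in h5; rewrite P1 in h3; rewrite /C mulrDl -/e.
  move: h1 h2 h3 h4 h5 Ae0.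
  move: (Num.sqrt (A f f * K) * _) (Num.sqrt c * _) => x1 x2.
  move: (`|A f e|) (`|L e|) (A f e) (A e e) (Phi f) (L e) (n.+1%:R^-1) => *.
  lra.
have cv : m + n.+1%:R^-1 + C * hnorm dot (fun x => u n x - f x) @[n --> \oo] --> m + 0 + C * 0.
  apply: cvgD; last by apply: cvgMl_tmp.
  by apply: cvgD; [exact: cvg_cst|exact: cvg_harmonic].
rewrite mulr0 !addr0 in cv.
by apply: (ler_cvg_to (cvg_cst (Phi f)) cv); apply: nearW => n; exact: key.
Qed.

(** The discriminant of the nonnegative quadratic [t |-> Phi (f + t g) - Phi f]
    is the square of [A f g - L g], up to a factor. *)
Lemma Phi_euler f : H f -> (forall g, H g -> Phi f <= Phi g) ->
  forall g, H g -> A f g = L g.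
Proof.
move=> Hf fmin g Hg; apply/eqP; rewrite -subr_eq0 -sqrf_eq0 eq_le sqr_ge0 andbT.
rewrite -(mul0r (2 * A g g)); apply: quad_ge0 => t.
have := fmin _ (rkhs_lin hH (2 * t) Hg Hf).
by rewrite Phi_line// -subr_ge0; congr (0 <= _); field.
Qed.

End minimize.
End hilbert.

(** * The Laplace transform as an integral over [0, M] *)

Section laplace_weights.
Context {R : realType}.
Variable (mu : {finite_measure set (measurableTypeR R) -> \bar R}).
Variable M : R.
Hypothesis hM : msupport mu `<=` `[0, M].

(** Every point off the support lies in a null interval with rational endpoints,
    and there are countably many of these. *)
Lemma negligible_Nsupport : mu.-negligible (~` msupport mu).
Proof.
pose I (ab : rat * rat) : set R := `]ratr ab.1, ratr ab.2[%classic.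
pose F n : set R := if unpickle n is Some ab then
  (if `[< mu (I ab) = 0%E >] then I ab else set0) else set0.
have nF n : mu.-negligible (F n).
  rewrite /F; case: unpickle => [ab|]; last exact: negligible_set0.
  case: asboolP => [h|_]; last exact: negligible_set0.
  by apply/negligibleP => //; exact: measurable_itv.
apply: negligibleS (negligible_bigcup nF).
move=> x /= nx; have [U [oU Ux mU]] : exists U, [/\ open U, U x & ~ (0 < mu U)%E].
  apply: contrapT => h; apply: nx => U oU Ux; apply: contrapT => h2; apply: h.
  by exists U.
have [e /= e0 eU] := oU _ Ux.
have [a] := @rat_in_itvoo R (x - e) x ltac:(by rewrite ltrBlDr ltrDl).
rewrite in_itv/= => /andP[a1 a2].
have [b] := @rat_in_itvoo R x (x + e) ltac:(by rewrite ltrDl).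
rewrite in_itv/= => /andP[b1 b2].
exists (pickle (a, b)); first by [].
rewrite /F pickleK; case: asboolP => [h|h]; first by rewrite /I/= in_itv/= a2 b1.
exfalso; apply: h; apply/eqP; rewrite eq_le measure_ge0 andbT.
have IU : I (a, b) `<=` U.
  move=> y; rewrite /I/= in_itv/= => /andP[y1 y2]; apply: eU; rewrite /ball_/= ltr_norml.
  by apply/andP; split; lra.
move/negP: mU; rewrite -leNgt; apply: le_trans.
apply: le_measure => //; rewrite inE; first exact: measurable_itv.
exact: open_measurable.
Qed.

Lemma negligible_NM : mu.-negligible (~` `[0, M]%classic).
Proof. by apply: negligibleS negligible_Nsupport; exact: subsetC. Qed.

(** The restriction to [0, M] is moved into the integrand: integrals against [mu]
    are then over the whole line, with weights that are bounded because [M]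
    bounds the support. *)
Definition w0 (t : R) : R := \1_(`[0, M]%classic) t.

Lemma measurable_w0 : measurable_fun [set: R] w0.
Proof. exact: measurable_indic. Qed.

Lemma w0E t : w0 t = if (0 <= t) && (t <= M) then 1 else 0.
Proof.
rewrite /w0 indicE; case: ifPn => h; first by rewrite mem_set//= in_itv/=.
by rewrite memNset//= in_itv/=; exact/negP.
Qed.

Lemma w0_ge0 t : 0 <= w0 t.
Proof. by rewrite w0E; case: ifP. Qed.

Lemma integral_w0 (f : R -> R) : measurable_fun [set: R] f ->
  (\int[mu]_(t in `[0%R, +oo[) (f t)%:E = \int[mu]_t (w0 t * f t)%:E)%E.
Proof.
move=> mf; rewrite -integral_indicM; apply: ae_eq_integral => //.
- by apply/measurable_EFinP; apply: measurable_funM => //; exact: measurable_indic.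
- by apply/measurable_EFinP; apply: measurable_funM => //; exact: measurable_w0.
have [N [mN N0 NN]] := negligible_NM; exists N; split => // t /= ht.
apply: NN => /= tM; apply: ht => _; congr (_ * _)%:E.
rewrite w0E; move: tM; rewrite in_itv/= => tM; rewrite tM.
by rewrite indicE mem_set//= in_itv/= (andP tM).1.
Qed.

Let s := fine (mu setT).

Lemma integ_mu_bnd (f : R -> R) c : measurable_fun [set: R] f ->
  (forall t, `|f t| <= c) -> integ mu f /\ `|(\int[mu]_t f t)%R| <= c * s.
Proof.
move=> mf fc; have ic : integ mu (fun=> c) by exact: finite_measure_integrable_cst.
have fi : integ mu f.
  by apply: (@integ_le _ _ _ mu _ (fun=> c)); [exact: mf|exact: fc|].
split=> //; apply: (le_trans (normr_Rint fi ic fc)).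
by rewrite Rintegral_cst.
Qed.

Definition lap0 (v : R) : R := (\int[mu]_t (w0 t * expR (- t * v)))%R.
Definition lap1 (v : R) : R := (\int[mu]_t (w0 t * (t * expR (- t * v))))%R.

Lemma laplaceE v : laplace mu v = lap0 v.
Proof.
rewrite /laplace /lap0 /Rintegral; congr fine; apply: integral_w0.
by apply: mf_exp; mfun.
Qed.

Lemma w0_exp v t : 0 <= v -> `|w0 t * expR (- t * v)| <= 1.
Proof.
move=> v0; rewrite w0E; case: ifP => [/andP[t0 _]|_]; last by rewrite mul0r normr0.
rewrite mul1r ger0_norm ?expR_ge0// -expR0 ler_expR mulNr oppr_le0 mulr_ge0//.
Qed.

Lemma w0_texp v t : 0 <= v -> `|w0 t * (t * expR (- t * v))| <= `|M|.
Proof.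
move=> v0; rewrite w0E; case: ifP => [/andP[t0 tM]|_]; last by rewrite mul0r normr0.
rewrite mul1r ger0_norm ?mulr_ge0 ?expR_ge0//.
rewrite (le_trans _ (ler_norm M))// (le_trans _ tM)// ler_piMr//.
by rewrite -expR0 ler_expR mulNr oppr_le0 mulr_ge0.
Qed.

Lemma mf_w0exp v : measurable_fun [set: R] (fun t => w0 t * expR (- t * v)).
Proof. by have := measurable_w0 => m; mfun. Qed.

Lemma mf_w0texp v : measurable_fun [set: R] (fun t => w0 t * (t * expR (- t * v))).
Proof. by have := measurable_w0 => m; mfun. Qed.

Lemma s_ge0 : 0 <= s. Proof. exact: fine_ge0. Qed.

Lemma exp_taylor (a b : R) : 0 <= a -> 0 <= b ->
  `|expR (- b) - expR (- a)| <= `|b - a| /\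
  `|expR (- b) - expR (- a) + (b - a) * expR (- a)| <= (b - a) ^+ 2.
Proof.
have e1 (x : R) : 0 <= x -> expR (- x) <= 1 by move=> x0; rewrite -expR0 ler_expR oppr_le0.
have e0 (x : R) : 0 < expR (- x) by exact: expR_gt0.
have K (x y : R) : expR (- x) * (1 + (x - y)) <= expR (- y).
  have := expR_ge1Dx (x - y); rewrite -(ler_pM2l (e0 x)) -expRD.
  by have -> : - x + (x - y) = - y by ring.
move=> a0 b0; have Ka := K a b; have Kb := K b a.
have ea := e1 _ a0; have eb := e1 _ b0; have pa := e0 a; have pb := e0 b.
have h1 : `|expR (- b) - expR (- a)| <= `|b - a|.
  have [ab|ba] := leP a b.
    rewrite (ger0_norm (x := b - a)) ?subr_ge0// ler_norml; apply/andP; split; nra.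
  rewrite (ltr0_norm (x := b - a)) ?subr_lt0// ler_norml; apply/andP; split; nra.
split=> //; rewrite ger0_norm; last by nra.
apply: (@le_trans _ _ ((b - a) * (expR (- a) - expR (- b)))); first by nra.
rewrite (le_trans (ler_norm _))// normrM -(real_normK (num_real (b - a))) expr2.
by rewrite ler_wpM2l// distrC.
Qed.

Lemma w0_taylor (v v' t : R) : 0 <= v -> 0 <= v' ->
  `|w0 t * expR (- t * v') - w0 t * expR (- t * v)| <= `|M| * `|v' - v| /\
  `|w0 t * expR (- t * v') - w0 t * expR (- t * v) +
    (v' - v) * (w0 t * (t * expR (- t * v)))| <= M ^+ 2 * (v' - v) ^+ 2.
Proof.
move=> v0 v'0; rewrite w0E; case: ifP => [/andP[t0 tM]|_]; last first.
  rewrite !mul0r mulr0 subrr addr0 normr0; split; first by rewrite mulr_ge0.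
  by rewrite mulr_ge0 ?sqr_ge0.
have M0 : 0 <= M by exact: le_trans tM.
have [h1 h2] := exp_taylor (mulr_ge0 t0 v0) (mulr_ge0 t0 v'0).
rewrite !mul1r !mulNr; split.
  by rewrite (le_trans h1)// -mulrBr normrM ler_wpM2r// ger0_norm// (le_trans tM)// ler_norm.
have -> : (v' - v) * (t * expR (- (t * v))) = (t * v' - t * v) * expR (- (t * v)) by ring.
rewrite (le_trans h2)// -mulrBr exprMn ler_wpM2r ?sqr_ge0//.
by rewrite lerXn2r ?nnegrE.
Qed.

Lemma lap0_diff (v v' : R) : 0 <= v -> 0 <= v' ->
  `|lap0 v' - lap0 v| <= `|M| * `|v' - v| * s.
Proof.
move=> v0 v'0.
have [i1 _] := integ_mu_bnd (mf_w0exp v) (fun t => w0_exp t v0).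
have [i2 _] := integ_mu_bnd (mf_w0exp v') (fun t => w0_exp t v'0).
rewrite /lap0 -(RintB i2 i1); apply: (integ_mu_bnd _ _).2.
  by apply: measurable_funB; exact: mf_w0exp.
by move=> t; exact: (w0_taylor t v0 v'0).1.
Qed.

(** [- lap1] is the derivative of [lap0]; the quadratic error is the one of the
    exponential, integrated. *)
Lemma lap0_taylor (v v' : R) : 0 <= v -> 0 <= v' ->
  `|lap0 v' - lap0 v + (v' - v) * lap1 v| <= M ^+ 2 * (v' - v) ^+ 2 * s.
Proof.
move=> v0 v'0.
have [i1 _] := integ_mu_bnd (mf_w0exp v) (fun t => w0_exp t v0).
have [i2 _] := integ_mu_bnd (mf_w0exp v') (fun t => w0_exp t v'0).
have [i3 _] := integ_mu_bnd (mf_w0texp v) (fun t => w0_texp t v0).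
rewrite /lap0 /lap1 -(RintB i2 i1) -(RintZ _ i3) -RintD; [|exact: integB|exact: integZ].
apply: (integ_mu_bnd _ _).2.
  apply: measurable_funD; first by apply: measurable_funB; exact: mf_w0exp.
  by apply: measurable_funM; [exact: mf_cst|exact: mf_w0texp].
by move=> t; exact: (w0_taylor t v0 v'0).2.
Qed.

End laplace_weights.

(** * Kernel ridge regression *)

Section ridge.
Context {R : realType}.
Variables (q : nat) (hq : (q = 1 \/ q = 2)%N).
Variables (mu : {finite_measure set (measurableTypeR R) -> \bar R}) (M : R).
Hypothesis hM : msupport mu `<=` `[0, M].
Variables (p : nat) (H : set (p.-tuple R -> R)).
Variable dot : (p.-tuple R -> R) -> (p.-tuple R -> R) -> R.
Hypothesis hH : is_rkhs (lq_kernel q mu) H dot.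
Context d (Om : measurableType d) (P : probability Om R).
Local Notation E f := (\int[P]_w f w)%R.

Let s := fine (mu setT).

Definition nq (x y : p.-tuple R) : R := \sum_(i < p) `|tnth x i - tnth y i| ^+ q.

Lemma nq_ge0 x y : 0 <= nq x y.
Proof. by apply: sumr_ge0 => i _; rewrite exprn_ge0. Qed.

Lemma nqC x y : nq x y = nq y x.
Proof. by apply: eq_bigr => i _; rewrite distrC. Qed.

Lemma nqxx x : nq x x = 0.
Proof.
by apply: big1 => i _; rewrite subrr normr0; case: hq => ->; rewrite expr0n.
Qed.

Lemma lq_kernelE x y : lq_kernel q mu x y = lap0 mu M (nq x y).
Proof. exact: laplaceE. Qed.

Lemma countable_comp (I : countType) (c : Om -> I) (F : I -> R) :
  (forall j, measurable (c @^-1` [set j])) -> measurable_fun setT (fun w => F (c w)).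
Proof.
move=> mc _ Z mZ; rewrite setTI.
pose G n : set Om := if unpickle n is Some j then
  (if `[< Z (F j) >] then c @^-1` [set j] else set0) else set0.
rewrite (_ : _ @^-1` _ = \bigcup_n G n).
  apply: bigcup_measurable => n _; rewrite /G; case: unpickle => [j|]//.
  by case: ifP.
apply/seteqP; split => w /=.
  move=> Zw; exists (pickle (c w)); first by [].
  by rewrite /G pickleK; case: asboolP.
by move=> [n _]; rewrite /G; case: unpickle => [j|]//; case: asboolP => // Zj /= ->.
Qed.

Variable phi : Om -> p.-tuple R.
Hypothesis mphi : forall i, measurable_fun setT (fun w => tnth (phi w) i).

(** Nothing is assumed on the functions of [H]: their measurability comes from
    the reproducing property, which makes them continuous, hence pointwise
    limits of functions that are constant on the cells of ever finer grids. *)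
Lemma measurable_rkhs f : H f -> measurable_fun setT (fun w => f (phi w)).
Proof.
move=> Hf.
pose c n w : p.-tuple int := [tuple Num.floor (n.+1%:R * tnth (phi w) i) | i < p].
pose r n (j : p.-tuple int) : p.-tuple R := [tuple (tnth j i)%:~R / n.+1%:R | i < p].
apply: (@measurable_fun_cvg _ _ _ _ (fun n w => f (r n (c n w)))).
  move=> n; apply: (@countable_comp _ (c n) (fun j => f (r n j))) => j.
  rewrite (_ : _ @^-1` _ = \bigcap_(i in [set: 'I_p])
      (fun w => n.+1%:R * tnth (phi w) i) @^-1` `[(tnth j i)%:~R, (tnth j i + 1)%:~R[%classic).
    apply: fin_bigcap_measurable => // i _.
    rewrite -[X in measurable X]setTI.
    have mi := mphi i.
    have mg : measurable_fun setT (fun w => n.+1%:R * tnth (phi w) i) by mfun.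
    by apply: mg => //; exact: measurable_itv.
  apply/seteqP; split => w /=.
    move=> <- i _ /=; rewrite tnth_mktuple in_itv/=.
    by rewrite floor_le floorD1_gt.
  move=> h; apply: eq_from_tnth => i; rewrite tnth_mktuple.
  have := h i I; rewrite /= in_itv/= => hi.
  by apply: floor_def.
move=> w _.
set x := phi w.
have hx n i : `|tnth (r n (c n w)) i - tnth x i| <= n.+1%:R^-1.
  rewrite !tnth_mktuple.
  have n0 : 0 < (n.+1%:R : R) by [].
  have := floor_le (n.+1%:R * tnth x i).
  have := floorD1_gt (n.+1%:R * tnth x i).
  rewrite intrD; move: (Num.floor _)%:~R => z h1 h2.
  rewrite -(ler_pM2r n0) mulVf ?gt_eqF// -{2}(gtr0_norm n0) -normrM mulrBl divfK ?gt_eqF//.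
  by rewrite ler_norml; apply/andP; split; lra.
have nqb n : nq (r n (c n w)) x <= p%:R * n.+1%:R^-1.
  rewrite /nq -[X in X%:R * _]card_ord mulr_natl -sumr_const; apply: ler_sum => i _.
  apply: le_trans (hx n i).
  case: hq => ->; first by rewrite expr1.
  rewrite expr2 ler_piMl// (le_trans (hx n i))// invf_le1 ?ler1n//.
(* [(f x - f y)^2 <= |f|^2 (2 h(0) - 2 h(|x - y|_q^q))], and [h] is Lipschitz *)
have sq n : (f (r n (c n w)) - f x) ^+ 2 <=
    dot f f * (2 * (`|M| * (p%:R * n.+1%:R^-1) * s)).
  rewrite (le_trans (rkhs_diff hH _ _ Hf))// ler_wpM2l ?(rkhs_dot_ge0 hH)//.
  rewrite !lq_kernelE !nqxx.
  have n0 := nq_ge0 (r n (c n w)) x.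
  have h1 := lap0_diff mu M (lexx 0) n0; rewrite subr0 (ger0_norm n0) -/s in h1.
  have h2 : lap0 mu M 0 - lap0 mu M (nq (r n (c n w)) x) <=
      `|M| * (p%:R * n.+1%:R^-1) * s.
    rewrite (le_trans (ler_norm _))// distrC (le_trans h1)//.
    by rewrite ler_wpM2r ?s_ge0// ler_wpM2l.
  move: h2; move: (lap0 mu M _) (lap0 mu M _) (_ * s) => a b e h2; lra.
have c2 : (f (r n (c n w)) - f x) ^+ 2 @[n --> \oo] --> 0.
  apply: (@squeeze_cvgr _ _ _ _ (cst 0)
    (fun n => dot f f * (2 * (`|M| * (p%:R * n.+1%:R^-1) * s)))).
  - by apply: nearW => n; rewrite /= sqr_ge0 sq.
  - exact: cvg_cst.
  - have -> : (0 : R) = dot f f * (2 * (`|M| * (p%:R * 0) * s)).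
      by rewrite !(mulr0, mul0r).
    apply: cvgMl_tmp; apply: cvgMl_tmp; apply: cvgMr_tmp.
    apply: cvgMl_tmp; apply: cvgMl_tmp; exact: cvg_harmonic.
apply/subr_cvg0/norm_cvg0P.
have -> : (fun n => `|f (r n (c n w)) - f x|) =
    (fun n => Num.sqrt ((f (r n (c n w)) - f x) ^+ 2)).
  by apply/funext => n; rewrite sqrtr_sqr.
rewrite -(sqrtr0 R); apply: continuous_cvg => //; exact: sqrt_continuous.
Qed.

Variable Y : Om -> R.
Hypothesis YL : L2 P Y.
Variable lambda : R.
Hypothesis lambda0 : 0 < lambda.

Lemma rkhs_comp_bnd f w : H f -> f (phi w) ^+ 2 <= lap0 mu M 0 * dot f f.
Proof.
move=> Hf; rewrite (le_trans (rkhs_bound hH (phi w) Hf))//.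
by rewrite lq_kernelE nqxx mulrC.
Qed.

Lemma rkhs_comp_L2 f : H f -> L2 P (fun w => f (phi w)).
Proof.
move=> Hf; apply: (@L2_bnd _ _ _ _ _ (Num.sqrt (lap0 mu M 0 * dot f f))).
  exact: measurable_rkhs.
by move=> w; rewrite -sqrtr_sqr ler_wsqrtr// rkhs_comp_bnd.
Qed.

Lemma rkhs_comp_E2 f : H f -> E (fun w => f (phi w) ^+ 2) <= lap0 mu M 0 * dot f f.
Proof.
move=> Hf; rewrite -[leRHS](Rint_cstP P); apply: le_Rint.
- exact: (rkhs_comp_L2 Hf).2.
- exact: integ_cst.
- by move=> w; exact: rkhs_comp_bnd.
Qed.

(** The input is an arbitrary map [phi] into the domain of [H], because problems
    with different scalings of the same variable are compared below. *)
Definition obj f : R :=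
  2^-1 * fine 'E_P[fun w => (Y w - f (phi w)) ^+ 2] + lambda / 2 * dot f f.

Let A f g := E (fun w => f (phi w) * g (phi w)) + lambda * dot f g.
Let L f := E (fun w => Y w * f (phi w)).

Lemma expE (f : Om -> R) : fine 'E_P[f] = E f.
Proof. by rewrite unlock. Qed.

Let A_psd : psd_form H A.
Proof.
split.
- move=> f g Hf Hg; rewrite /A (rkhs_dotC hH Hf Hg); congr (_ + _).
  by apply: eq_Rint => w; rewrite mulrC.
- move=> a f g e Hf Hg He; rewrite /A (rkhs_dotl hH)//.
  have -> : E (fun w => (a * f (phi w) + g (phi w)) * e (phi w)) =
      a * E (fun w => f (phi w) * e (phi w)) + E (fun w => g (phi w) * e (phi w)).
    have i1 := L2_integM (rkhs_comp_L2 Hf) (rkhs_comp_L2 He).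
    have i2 := L2_integM (rkhs_comp_L2 Hg) (rkhs_comp_L2 He).
    rewrite -(RintZ _ i1) -(RintD (integZ a i1) i2).
    by apply: eq_Rint => w; ring.
  ring.
- move=> f Hf; apply: addr_ge0; last by rewrite mulr_ge0 ?(rkhs_dot_ge0 hH) ?ltW.
  by apply: Rintegral_ge0 => w _; rewrite -expr2 sqr_ge0.
Qed.

Let A_lb f : H f -> lambda * dot f f <= A f f.
Proof.
move=> Hf; rewrite lerDr; apply: Rintegral_ge0 => w _.
by rewrite -expr2 sqr_ge0.
Qed.

Let A_ub f : H f -> A f f <= (lap0 mu M 0 + lambda) * dot f f.
Proof.
move=> Hf; rewrite mulrDl lerD2r; apply: le_trans (rkhs_comp_E2 Hf).
by rewrite le_eqVlt; apply/orP; left; apply/eqP; apply: eq_Rint => w; rewrite expr2.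
Qed.

Let L_lin a f g : H f -> H g -> L (fun x => a * f x + g x) = a * L f + L g.
Proof.
move=> Hf Hg; rewrite /L.
have i1 := L2_integM YL (rkhs_comp_L2 Hf); have i2 := L2_integM YL (rkhs_comp_L2 Hg).
by rewrite -(RintZ _ i1) -(RintD (integZ a i1) i2); apply: eq_Rint => w; ring.
Qed.

Let L_bnd f : H f -> L f ^+ 2 <= E (fun w => Y w ^+ 2) * lap0 mu M 0 * dot f f.
Proof.
move=> Hf; rewrite (le_trans (L2_CS YL (rkhs_comp_L2 Hf)))// -mulrA ler_wpM2l//.
  by apply: Rintegral_ge0 => w _; exact: sqr_ge0.
exact: rkhs_comp_E2.
Qed.

Lemma objE f : H f ->
  obj f = 2^-1 * E (fun w => Y w ^+ 2) + (2^-1 * A f f - L f).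
Proof.
move=> Hf; rewrite /obj expE /A /L.
have i1 := YL.2; have i2 := L2_integM YL (rkhs_comp_L2 Hf).
have i3 := L2_integM (rkhs_comp_L2 Hf) (rkhs_comp_L2 Hf).
have -> : E (fun w => (Y w - f (phi w)) ^+ 2) = E (fun w => Y w ^+ 2)
   - 2 * E (fun w => Y w * f (phi w)) + E (fun w => f (phi w) * f (phi w)).
  rewrite -(RintZ _ i2) -(RintB i1 (integZ _ i2)) -RintD//; last first.
    by apply: integB => //; exact: integZ.
  by apply: eq_Rint => w; ring.
by field.
Qed.

(** Up to a constant the objective is the functional [Phi] of the form [A], which
    is equivalent to [lambda * dot] because the kernel is bounded. *)
Lemma obj_min : exists f, H f /\ forall g, H g -> obj f <= obj g.
Proof.
have [f Hf fm] := Phi_min hH A_psd lambda0 A_lb A_ub L_lin L_bnd.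
by exists f; split=> // g Hg; rewrite !objE// lerD2l; exact: fm.
Qed.

Lemma obj_euler f : H f -> (forall g, H g -> obj f <= obj g) ->
  forall g, H g -> E (fun w => (Y w - f (phi w)) * g (phi w)) = lambda * dot f g.
Proof.
move=> Hf fm g Hg.
have := @Phi_euler _ _ _ _ _ hH A L A_psd L_lin f Hf _ g Hg; rewrite /A /L => e.
have i1 := L2_integM YL (rkhs_comp_L2 Hg).
have i2 := L2_integM (rkhs_comp_L2 Hf) (rkhs_comp_L2 Hg).
have -> : E (fun w => (Y w - f (phi w)) * g (phi w)) =
  E (fun w => Y w * g (phi w)) - E (fun w => f (phi w) * g (phi w)).
  by rewrite -(RintB i1 i2); apply: eq_Rint => w; ring.
rewrite -e; first by rewrite addrC addKr.
by move=> u Hu; have := fm _ Hu; rewrite !objE// lerD2l.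
Qed.

End ridge.

(** * Bilinear forms of bounded kernels *)

Lemma measurable_Rint_param d1 d2 (T1 : measurableType d1) (T2 : measurableType d2)
    (R : realType) (m1 : {sigma_finite_measure set T1 -> \bar R}) (F : T1 * T2 -> R) :
  measurable_fun setT F -> measurable_fun setT (fun y => \int[m1]_x F (x, y))%R.
Proof.
move=> mF; apply: (measurableT_comp (fine_measurable measurableT)).
have mE : measurable_fun setT (EFin \o F) by exact/measurable_EFinP.
pose Fp y := (\int[m1]_x (EFin \o F)^\+ (x, y))%E.
pose Fm y := (\int[m1]_x (EFin \o F)^\- (x, y))%E.
have -> : (fun y => \int[m1]_x (F (x, y))%:E)%E = (Fp \- Fm)%E.
  apply/funext => y; rewrite [LHS]integralE /Fp /Fm/=.
  by congr (_ - _)%E; apply: eq_integral => x _; rewrite ?funeposE ?funenegE.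
apply: emeasurable_funB.
- by apply: measurable_fun_fubini_tonelli_G => //; exact: measurable_funepos.
- by apply: measurable_fun_fubini_tonelli_G => //; exact: measurable_funeneg.
Qed.

Section bform.
Context d (Om : measurableType d) (R : realType) (P : probability Om R).
Local Notation PP := (P \x P)%E.
Local Notation PPp := ((P \x P)%E : probability (Om * Om)%type R).
Implicit Types (kap : Om * Om -> R) (a b : Om -> R).

Definition bform kap a b : R := (\int[PP]_z (a z.1 * b z.2 * kap z))%R.

Definition bdd kap c := measurable_fun setT kap /\ forall z, `|kap z| <= c.

Lemma mf_fst a : measurable_fun setT a -> measurable_fun setT (fun z : Om * Om => a z.1).
Proof. by move=> ma; exact: (mf_comp1 ma). Qed.

Lemma mf_snd a : measurable_fun setT a -> measurable_fun setT (fun z : Om * Om => a z.2).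
Proof. by move=> ma; exact: (mf_comp2 ma). Qed.

Lemma measurable_bform kap a b c : bdd kap c -> integ P a -> integ P b ->
  measurable_fun setT (fun z : Om * Om => a z.1 * b z.2 * kap z).
Proof.
move=> [mk _] ia ib; have ma := mf_fst (integ_measurable ia).
have mb := mf_snd (integ_measurable ib); mfun.
Qed.

Lemma bform_dom kap a b c x y : bdd kap c ->
  `|a x * b y * kap (x, y)| <= (c * `|a x|) * `|b y|.
Proof.
move=> [_ kc]; by rewrite !normrM (mulrC c) [leRHS]mulrAC ler_wpM2l// mulr_ge0.
Qed.

Lemma bform_integ kap a b c : bdd kap c -> integ P a -> integ P b ->
  integ PP (fun z => a z.1 * b z.2 * kap z).
Proof.
move=> hk ia ib.
apply: (fubini_dom_prod (measurable_bform hk ia ib) (fun x y => bform_dom a b x y hk)).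
  by apply: integZ; exact: integ_abs.
exact: integ_abs.
Qed.

Lemma bform_iter kap a b c : bdd kap c -> integ P a -> integ P b ->
  bform kap a b = (\int[P]_x \int[P]_y (a x * b y * kap (x, y)))%R.
Proof.
move=> hk ia ib.
apply: (fubini_domE1 (measurable_bform hk ia ib) (fun x y => bform_dom a b x y hk)).
  by apply: integZ; exact: integ_abs.
exact: integ_abs.
Qed.

Lemma bform_iter2 kap a b c : bdd kap c -> integ P a -> integ P b ->
  bform kap a b = (\int[P]_y \int[P]_x (a x * b y * kap (x, y)))%R.
Proof.
move=> hk ia ib.
apply: (fubini_domE2 (measurable_bform hk ia ib) (fun x y => bform_dom a b x y hk)).
  by apply: integZ; exact: integ_abs.
exact: integ_abs.
Qed.

Lemma bform_bnd kap a b c : bdd kap c -> integ P a -> integ P b ->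
  `|bform kap a b| <= c * (\int[P]_w `|a w|)%R * (\int[P]_w `|b w|)%R.
Proof.
move=> hk ia ib.
have ia' := integZ c (integ_abs ia); have ib' := integ_abs ib.
have ip : integ PP (fun z => c * `|a z.1| * `|b z.2|) by exact: (integ_prod ia' ib').
have i := bform_integ hk ia ib.
have le z : `|a z.1 * b z.2 * kap z| <= c * `|a z.1| * `|b z.2|.
  by case: z => x y; exact: bform_dom.
rewrite (le_trans (normr_Rint i ip le))//.
have m : measurable_fun setT (fun z : Om * Om => c * `|a z.1| * `|b z.2|).
  exact: integ_measurable ip.
have le2 x y : `|c * `|a (x, y).1| * `|b (x, y).2| | <= `|c| * `|a x| * `|b y|.
  by rewrite !normrM !normr_id.
rewrite (fubini_domE1 m le2 (integZ `|c| (integ_abs ia)) ib').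
rewrite -(RintZ _ (integ_abs ia)) mulrC -RintZ; last exact: ia'.
rewrite le_eqVlt; apply/orP; left; apply/eqP; apply: eq_Rint => x /=.
by rewrite (RintZ _ ib') mulrC.
Qed.

Lemma bform_linl kap a1 a2 b c x : bdd kap c -> integ P a1 -> integ P a2 -> integ P b ->
  bform kap (fun w => x * a1 w + a2 w) b = x * bform kap a1 b + bform kap a2 b.
Proof.
move=> hk i1 i2 ib; have j1 := bform_integ hk i1 ib; have j2 := bform_integ hk i2 ib.
by rewrite /bform -(RintZ _ j1) -(RintD (integZ x j1) j2); apply: eq_Rint => z; ring.
Qed.

Lemma bform_linr kap a b1 b2 c x : bdd kap c -> integ P a -> integ P b1 -> integ P b2 ->
  bform kap a (fun w => x * b1 w + b2 w) = x * bform kap a b1 + bform kap a b2.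
Proof.
move=> hk ia i1 i2; have j1 := bform_integ hk ia i1; have j2 := bform_integ hk ia i2.
by rewrite /bform -(RintZ _ j1) -(RintD (integZ x j1) j2); apply: eq_Rint => z; ring.
Qed.

Lemma bform_kap kap1 kap2 a b c1 c2 x : bdd kap1 c1 -> bdd kap2 c2 ->
  integ P a -> integ P b ->
  bform (fun z => x * kap1 z + kap2 z) a b = x * bform kap1 a b + bform kap2 a b.
Proof.
move=> h1 h2 ia ib; have j1 := bform_integ h1 ia ib; have j2 := bform_integ h2 ia ib.
by rewrite /bform -(RintZ _ j1) -(RintD (integZ x j1) j2); apply: eq_Rint => z; ring.
Qed.

Lemma bform_sym kap a b c : bdd kap c -> (forall x y, kap (x, y) = kap (y, x)) ->
  integ P a -> integ P b -> bform kap a b = bform kap b a.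
Proof.
move=> hk ks ia ib; rewrite (bform_iter hk ia ib) (bform_iter2 hk ib ia).
apply: eq_Rint => x; apply: eq_Rint => y; rewrite ks; ring.
Qed.

Lemma eq_bform kap1 kap2 a1 a2 b1 b2 :
  (forall x y, a1 x * b1 y * kap1 (x, y) = a2 x * b2 y * kap2 (x, y)) ->
  bform kap1 a1 b1 = bform kap2 a2 b2.
Proof. by move=> h; apply: eq_Rint => -[x y]; exact: h. Qed.

Lemma bform_CS kap a b c : bdd kap c -> (forall x y, kap (x, y) = kap (y, x)) ->
  (forall u, integ P u -> 0 <= bform kap u u) ->
  integ P a -> integ P b ->
  bform kap a b ^+ 2 <= bform kap a a * bform kap b b.
Proof.
move=> hk ks psd ia ib; apply: quad_ge0 => t.
have it : integ P (fun w => t * b w + a w) by apply: integD => //; exact: integZ.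
have := psd _ it.
rewrite (bform_linl t hk ib ia it) !(bform_linr t hk _ ib ia)//.
by rewrite (bform_sym hk ks ib ia); congr (_ <= _); ring.
Qed.

Variable mu : {finite_measure set (measurableTypeR R) -> \bar R}.
Variable D : Om * Om -> R.
Hypothesis mD : measurable_fun setT D.
Hypothesis D0 : forall z, 0 <= D z.

Definition expk (t : R) : Om * Om -> R := fun z => expR (- t * D z).
(** With [D] the distance between the scaled inputs, the weight [rho0] gives the
    Gram kernel, and [rho1] minus its derivative with respect to [D]. *)
Definition mixk (rho : R -> R) : Om * Om -> R :=
  fun z => (\int[mu]_t (rho t * expR (- t * D z)))%R.

(** Weights vanish on the negative axis, where [exp (- t D)] is unbounded. *)
Definition wgt (rho : R -> R) (c : R) :=
  [/\ measurable_fun [set: R] rho, (forall t, `|rho t| <= c) &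
     forall t, t < 0 -> rho t = 0].

Lemma expk_bdd t : 0 <= t -> bdd (expk t) 1.
Proof.
move=> t0; split; first by rewrite /expk; mfun.
move=> z; rewrite /expk ger0_norm ?expR_ge0// -expR0 ler_expR mulNr oppr_le0.
by rewrite mulr_ge0.
Qed.

Lemma wgt_exp rho c t z : wgt rho c -> `|rho t * expR (- t * D z)| <= c.
Proof.
move=> [_ rc r0]; have [t0|t0] := ltP t 0.
  by rewrite r0// mul0r normr0 (le_trans _ (rc t)).
rewrite normrM (le_trans _ (rc t))// ler_piMr//.
exact: (expk_bdd t0).2.
Qed.

Lemma mf_wgt_exp rho c : wgt rho c ->
  measurable_fun setT (fun zt : (Om * Om) * R => rho zt.2 * expR (- zt.2 * D zt.1)).
Proof.
move=> [mr _ _].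
have m1 : measurable_fun setT (fun zt : (Om * Om) * R => rho zt.2).
  exact: (mf_comp2 mr).
have m2 : measurable_fun setT (fun zt : (Om * Om) * R => D zt.1).
  exact: (mf_comp1 mD).
mfun.
Qed.

Lemma integ_mu_cst (c : R) : integ mu (fun=> c).
Proof. exact: finite_measure_integrable_cst. Qed.

Lemma integ_PP_cst (c : R) : integ PP (fun=> c).
Proof.
have := integ_prod (integ_cst P c) (integ_cst P 1).
by apply: eq_integ => z; rewrite mulr1.
Qed.

Lemma mixk_bdd rho c : wgt rho c -> bdd (mixk rho) (c * fine (mu setT)).
Proof.
move=> hr; split.
  have := @fubini_dom_int1 _ _ (Om * Om)%type (measurableTypeR R) R PPp mu _ (fun=> 1) (fun=> c) _ _
    (integ_PP_cst 1) (integ_mu_cst c) => /(_ _ (mf_wgt_exp hr)) h.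
  apply: (integ_measurable (m := PP)); apply: h => z t /=.
  by rewrite mul1r; exact: wgt_exp.
move=> z; have [mr _ _] := hr.
apply: (integ_mu_bnd mu _ _).2; first by mfun.
by move=> t; exact: wgt_exp.
Qed.

Lemma bform_mixk rho c a b : wgt rho c -> integ P a -> integ P b ->
  integ mu (fun t => rho t * bform (expk t) a b) /\
  bform (mixk rho) a b = (\int[mu]_t (rho t * bform (expk t) a b))%R.
Proof.
move=> hr ia ib; have [mr _ r0] := hr.
pose F (zt : (Om * Om) * R) := a zt.1.1 * b zt.1.2 * (rho zt.2 * expR (- zt.2 * D zt.1)).
have mF : measurable_fun setT F.
  have ma : measurable_fun setT (fun zt : (Om * Om) * R => a zt.1.1).
    exact: (mf_comp1 (mf_fst (integ_measurable ia))).
  have mb : measurable_fun setT (fun zt : (Om * Om) * R => b zt.1.2).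
    exact: (mf_comp1 (mf_snd (integ_measurable ib))).
  have mw := mf_wgt_exp hr.
  by apply: measurable_funM => //; exact: measurable_funM.
have le z t : `|F (z, t)| <= `|a z.1| * `|b z.2| * c.
  rewrite /F normrM normrM ler_wpM2l ?mulr_ge0//; exact: wgt_exp.
have ig : integ PP (fun z => `|a z.1| * `|b z.2|).
  exact: (integ_prod (integ_abs ia) (integ_abs ib)).
have E2 t : (\int[PP]_z F (z, t) = rho t * bform (expk t) a b)%R.
  have [t0|t0] := ltP t 0.
    rewrite r0// mul0r /Rintegral integral0_eq// => z _.
    by rewrite /F/= r0// mul0r mulr0.
  rewrite /bform -(RintZ _ (bform_integ (expk_bdd t0) ia ib)).
  by apply: eq_Rint => z; rewrite /F/= /expk; ring.
split.
  have := @fubini_dom_int2 _ _ (Om * Om)%type (measurableTypeR R) R PPp mu F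
    _ _ mF le ig (integ_mu_cst c).
  by apply: eq_integ.
have := @fubini_dom _ _ (Om * Om)%type (measurableTypeR R) R PPp mu F
    _ _ mF le ig (integ_mu_cst c).
rewrite (eq_Rint mu E2) => <-.
apply: eq_Rint => z; rewrite /F/= /mixk RintZ//.
apply: (integ_mu_bnd mu _ (fun t => wgt_exp t z hr)).1; by mfun.
Qed.
End bform.

(** * Spectral representation of the forms *)

Section spectral.
Context {R : realType}.
Variables (q : nat) (hq : (q = 1 \/ q = 2)%N).
Variables (mu : {finite_measure set (measurableTypeR R) -> \bar R}) (M : R).
Hypothesis hM : msupport mu `<=` `[0, M].
Variable p : nat.
Context d (Om : measurableType d) (P : probability Om R).
Variable phi : Om -> p.-tuple R.
Hypothesis mphi : forall i, measurable_fun setT (fun w => tnth (phi w) i).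
Local Notation PP := (P \x P)%E.
Local Notation PPp := ((P \x P)%E : probability (Om * Om)%type R).
Local Notation E f := (\int[P]_w f w)%R.
Local Notation lebp := (mpower (@lebesgue_measure R) p).

Definition distk : Om * Om -> R := fun z => nq q (phi z.1) (phi z.2).

Lemma distk_ge0 z : 0 <= distk z. Proof. exact: nq_ge0. Qed.

Lemma distk_sym x y : distk (x, y) = distk (y, x). Proof. exact: nqC. Qed.

Lemma measurable_distk : measurable_fun setT distk.
Proof.
apply: mf_sum => i; have m1 := mf_fst (mphi i); have m2 := mf_snd (mphi i); mfun.
Qed.

(** Real and imaginary parts of [E ((a1 + i a2) exp (i <om, phi>))]. *)
Definition wave_re (a1 a2 : Om -> R) (om : p.-tuple R) : R :=
  E (fun w => a1 w * cos (tdot om (phi w)) - a2 w * sin (tdot om (phi w))).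
Definition wave_im (a1 a2 : Om -> R) (om : p.-tuple R) : R :=
  E (fun w => a1 w * sin (tdot om (phi w)) + a2 w * cos (tdot om (phi w))).
Definition wave_sq (a1 a2 : Om -> R) (om : p.-tuple R) : R :=
  wave_re a1 a2 om ^+ 2 + wave_im a1 a2 om ^+ 2.

Lemma wave_sq_ge0 a1 a2 om : 0 <= wave_sq a1 a2 om.
Proof. by rewrite addr_ge0// sqr_ge0. Qed.

Lemma measurable_phase1 om : measurable_fun setT (fun w => tdot om (phi w)).
Proof. by apply: mf_sum => i; have mi := mphi i; mfun. Qed.

Lemma measurable_wave_sq d' (T : measurableType d') (a1 a2 : Om * T -> R) :
  measurable_fun setT a1 -> measurable_fun setT a2 ->
  measurable_fun setT (fun oz : p.-tuple R * T =>
    wave_sq (fun w => a1 (w, oz.2)) (fun w => a2 (w, oz.2)) oz.1).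
Proof.
move=> ma1 ma2.
have sel (a : Om * T -> R) : measurable_fun setT a ->
    measurable_fun setT (fun woz : Om * (p.-tuple R * T) => a (woz.1, woz.2.2)).
  move=> ma; apply: (measurableT_comp ma); apply/measurable_fun_pair => //=.
  exact: (mf_comp2 measurable_snd).
have m1 := sel _ ma1; have m2 := sel _ ma2.
have mp : measurable_fun setT
    (fun woz : Om * (p.-tuple R * T) => tdot woz.2.1 (phi woz.1)).
  apply: mf_sum => i; have n1 := @mf_comp1 _ _ _ _ (p.-tuple R * T)%type _ _ (mphi i).
  have n2 : measurable_fun setT (fun woz : Om * (p.-tuple R * T) => tnth woz.2.1 i).
    exact: (mf_comp2 (mf_comp1 (measurable_tnth i))).
  exact: measurable_funM.
apply: measurable_funD; apply: measurable_funX.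
- apply: (@measurable_Rint_param _ _ _ _ R P (fun woz : Om * (p.-tuple R * T) =>
    a1 (woz.1, woz.2.2) * cos (tdot woz.2.1 (phi woz.1)) -
    a2 (woz.1, woz.2.2) * sin (tdot woz.2.1 (phi woz.1)))); mfun.
- apply: (@measurable_Rint_param _ _ _ _ R P (fun woz : Om * (p.-tuple R * T) =>
    a1 (woz.1, woz.2.2) * sin (tdot woz.2.1 (phi woz.1)) +
    a2 (woz.1, woz.2.2) * cos (tdot woz.2.1 (phi woz.1)))); mfun.
Qed.

Lemma integ_cosphase a om : integ P a -> integ P (fun w => a w * cos (tdot om (phi w))).
Proof.
move=> ia; apply: integMb ia _ (fun=> cos_max _).
by apply: mf_cos; exact: measurable_phase1.
Qed.

Lemma integ_sinphase a om : integ P a -> integ P (fun w => a w * sin (tdot om (phi w))).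
Proof.
move=> ia; apply: integMb ia _ (fun=> sin_max _).
by apply: mf_sin; exact: measurable_phase1.
Qed.

Lemma bdd1 : bdd (fun _ : Om * Om => (1 : R)) 1.
Proof. by split; [exact: mf_cst|move=> z; rewrite normr1]. Qed.

Lemma bform1 a b : integ P a -> integ P b -> bform P (fun=> 1) a b = E a * E b.
Proof.
move=> ia ib; rewrite (bform_iter bdd1 ia ib) mulrC -(RintZ _ ia).
apply: eq_Rint => x; rewrite mulrC -(RintZ _ ib).
by apply: eq_Rint => y; rewrite mulr1.
Qed.

Definition delta (z : Om * Om) : p.-tuple R :=
  [tuple tnth (phi z.1) i - tnth (phi z.2) i | i < p].

Lemma tdot_delta om z : tdot om (delta z) = tdot om (phi z.1) - tdot om (phi z.2).
Proof.
rewrite /tdot -sumrB; apply: eq_bigr => i _.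
by rewrite tnth_mktuple mulrBr.
Qed.

Lemma distkE z : \sum_(i < p) `|tnth (delta z) i| ^+ q = distk z.
Proof. by apply: eq_bigr => i _; rewrite tnth_mktuple. Qed.

Let G a1 a2 (z : Om * Om) (om : p.-tuple R) : R :=
  (a1 z.1 * a1 z.2 + a2 z.1 * a2 z.2) * cos (tdot om (delta z)) +
  (a1 z.1 * a2 z.2 - a2 z.1 * a1 z.2) * sin (tdot om (delta z)).

(** The square of an expectation is a double integral over independent copies;
    the phases then combine into the phase of a difference. *)
Lemma wave_sqE a1 a2 om : integ P a1 -> integ P a2 ->
  wave_sq a1 a2 om = (\int[PP]_z G a1 a2 z om)%R.
Proof.
move=> i1 i2.
have iu := integB (integ_cosphase om i1) (integ_sinphase om i2).
have iv := integD (integ_sinphase om i1) (integ_cosphase om i2).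
rewrite /wave_sq !expr2 /wave_re /wave_im -(bform1 iu iu) -(bform1 iv iv).
rewrite /bform -RintD; last 2 first.
- exact: (bform_integ bdd1 iu iu).
- exact: (bform_integ bdd1 iv iv).
apply: eq_Rint => z; rewrite /G tdot_delta cosB sinB; ring.
Qed.

Lemma measurable_q_t t : 0 < t -> measurable_fun setT (@q_t R p q t).
Proof. by move=> t0; have [/integ_measurable] := q_t_transform (phi point) hq t0. Qed.

Lemma q_t_ge0 t om : 0 <= @q_t R p q t om.
Proof. by apply: prodr_ge0 => i _; exact: psi_t_ge0. Qed.

(** [exp (- t D)] is the Fourier transform of [q_t] at the difference of the two
    inputs, so Fubini turns the form into an integral of squared moduli. *)
Lemma spectral_t a1 a2 t : 0 < t -> integ P a1 -> integ P a2 ->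
  integ lebp (fun om => q_t q t om * wave_sq a1 a2 om) /\
  (\int[lebp]_om (q_t q t om * wave_sq a1 a2 om) =
   bform P (expk distk t) a1 a1 + bform P (expk distk t) a2 a2)%R.
Proof.
move=> t0 i1 i2.
pose F (zo : (Om * Om) * p.-tuple R) := q_t q t zo.2 * G a1 a2 zo.1 zo.2.
pose g z := (`|a1 z.1| + `|a2 z.1|) * (`|a1 z.2| + `|a2 z.2|).
have ia : integ P (fun w => `|a1 w| + `|a2 w|) by apply: integD; exact: integ_abs.
have ig : integ PPp g by exact: (integ_prod ia ia).
have [iq _ _] := q_t_transform (phi point) hq t0.
have mF : measurable_fun setT F.
  have mq := measurable_q_t t0.
  have mqz : measurable_fun setT (fun zo : (Om * Om) * p.-tuple R => q_t q t zo.2).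
    exact: (mf_comp2 mq).
  have k1 a : integ P a -> measurable_fun setT (fun zo : (Om * Om) * p.-tuple R => a zo.1.1).
    move=> ja; exact: (mf_comp1 (mf_fst (integ_measurable ja))).
  have k2 a : integ P a -> measurable_fun setT (fun zo : (Om * Om) * p.-tuple R => a zo.1.2).
    move=> ja; exact: (mf_comp1 (mf_snd (integ_measurable ja))).
  have m11 := k1 _ i1; have m12 := k1 _ i2; have m21 := k2 _ i1; have m22 := k2 _ i2.
  have md : measurable_fun setT (fun zo : (Om * Om) * p.-tuple R => tdot zo.2 (delta zo.1)).
    apply: mf_sum => i.
    have n0 : measurable_fun setT (fun zo : (Om * Om) * p.-tuple R => tnth zo.2 i).
      exact: (mf_comp2 (measurable_tnth i)).
    have n1 : measurable_fun setT (fun zo : (Om * Om) * p.-tuple R => tnth (phi zo.1.1) i).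
      exact: (mf_comp1 (mf_fst (mphi i))).
    have n2 : measurable_fun setT (fun zo : (Om * Om) * p.-tuple R => tnth (phi zo.1.2) i).
      exact: (mf_comp1 (mf_snd (mphi i))).
    under eq_fun do rewrite tnth_mktuple.
    mfun.
  by rewrite /F /G; mfun.
have Gb z om : `|G a1 a2 z om| <= g z.
  rewrite /G (le_trans (ler_normD _ _))//.
  apply: (@le_trans _ _ (`|a1 z.1 * a1 z.2 + a2 z.1 * a2 z.2| +
     `|a1 z.1 * a2 z.2 - a2 z.1 * a1 z.2|)).
    by rewrite lerD// normrM ler_piMr// ?cos_max ?sin_max.
  have h1 := ler_normD (a1 z.1 * a1 z.2) (a2 z.1 * a2 z.2).
  have h2 := ler_normB (a1 z.1 * a2 z.2) (a2 z.1 * a1 z.2).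
  move: h1 h2; rewrite /g !normrM => h1 h2.
  by rewrite (le_trans (lerD h1 h2))//; nra.
have le z om : `|F (z, om)| <= g z * q_t q t om.
  by rewrite /F normrM mulrC (ger0_norm (q_t_ge0 _ _)) ler_wpM2r ?q_t_ge0 ?Gb.
have E2 om : (\int[PP]_z F (z, om) = q_t q t om * wave_sq a1 a2 om)%R.
  rewrite (wave_sqE _ i1 i2) -RintZ//.
  apply: (@integ_le _ _ _ PP _ g); [|by move=> z; exact: Gb|exact: ig].
  have j1 := bform_integ bdd1 i1 i1; have j2 := bform_integ bdd1 i2 i2.
  have m11 := mf_fst (integ_measurable i1); have m12 := mf_snd (integ_measurable i1).
  have m21 := mf_fst (integ_measurable i2); have m22 := mf_snd (integ_measurable i2).
  have md : measurable_fun setT (fun z : Om * Om => tdot om (delta z)).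
    apply: mf_sum => i; have n1 := mf_fst (mphi i); have n2 := mf_snd (mphi i).
    under eq_fun do rewrite tnth_mktuple.
    mfun.
  by rewrite /G; mfun.
split.
  have := @fubini_dom_int2 _ _ (Om * Om)%type (p.-tuple (measurableTypeR R)) R PPp lebp F _ _ mF le ig iq.
  exact: eq_integ.
have := @fubini_dom _ _ (Om * Om)%type (p.-tuple (measurableTypeR R)) R PPp lebp F _ _ mF le ig iq.
rewrite (eq_Rint lebp E2) => <-.
have hk := expk_bdd measurable_distk distk_ge0 (ltW t0).
rewrite /bform -(RintD (bform_integ hk i1 i1) (bform_integ hk i2 i2)).
apply: eq_Rint => z.
have [_ e1 e2] := q_t_transform (delta z) hq t0.
pose u := a1 z.1 * a1 z.2 + a2 z.1 * a2 z.2.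
pose v := a1 z.1 * a2 z.2 - a2 z.1 * a1 z.2.
have ic : integ lebp (fun om => q_t q t om * cos (tdot om (delta z))).
  by apply: integMb iq _ (fun=> cos_max _); apply: mf_cos; exact: measurable_tdot.
have isn : integ lebp (fun om => q_t q t om * sin (tdot om (delta z))).
  by apply: integMb iq _ (fun=> sin_max _); apply: mf_sin; exact: measurable_tdot.
have E3 om : F (z, om) = u * (q_t q t om * cos (tdot om (delta z))) +
    v * (q_t q t om * sin (tdot om (delta z))) by rewrite /F /G /u /v /=; ring.
rewrite (eq_Rint lebp E3) (RintD (integZ u ic) (integZ v isn)) (RintZ _ ic) (RintZ _ isn).
by rewrite e1 e2 distkE /expk /u mulNr; ring.
Qed.

(** For [t > 0] the spectral formula with [a2 = 0] exhibits the form as an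
    integral of squares. *)
Lemma bform_psd_expk a t : 0 <= t -> integ P a -> 0 <= bform P (expk distk t) a a.
Proof.
rewrite le_eqVlt => /predU1P[<-|t0] ia.
  have -> : bform P (expk distk 0) a a = bform P (fun=> 1) a a.
    by apply: eq_bform => x y; rewrite /expk oppr0 mul0r expR0.
  by rewrite bform1// -expr2 sqr_ge0.
have i0 : integ P (fun=> 0) by exact: integ_cst.
have [_ e] := spectral_t t0 ia i0.
have z0 : bform P (expk distk t) (fun=> 0) (fun=> 0) = 0.
  have -> : bform P (expk distk t) (fun=> 0) (fun=> 0) = (\int[PP]_z ((fun=> 0) z : R))%R.
    by apply: eq_Rint => z; rewrite !mul0r.
  by rewrite /Rintegral integral0_eq.
rewrite z0 addr0 in e; rewrite -e; apply: Rintegral_ge0 => om _.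
by rewrite mulr_ge0 ?q_t_ge0 ?wave_sq_ge0.
Qed.

Lemma bform_psd_mixk rho c a : wgt rho c -> (forall t, 0 <= rho t) -> integ P a ->
  0 <= bform P (mixk mu distk rho) a a.
Proof.
move=> hr r0 ia; have [_ ->] := bform_mixk mu measurable_distk distk_ge0 hr ia ia.
apply: Rintegral_ge0 => t _; have [t0|t0] := ltP t 0.
  by have [_ _ ->] := hr; rewrite ?mul0r.
by rewrite mulr_ge0// bform_psd_expk.
Qed.

(** Each [exp (- t D)] is positive semidefinite, so forms of mixtures are ordered
    like their weights. *)
Lemma bform_mixk_le rho1 rho2 c1 c2 (K : R) a : wgt rho1 c1 -> wgt rho2 c2 ->
  (forall t, rho1 t <= K * rho2 t) -> integ P a ->
  bform P (mixk mu distk rho1) a a <= K * bform P (mixk mu distk rho2) a a.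
Proof.
move=> h1 h2 le ia.
have [i1 ->] := bform_mixk mu measurable_distk distk_ge0 h1 ia ia.
have [i2 ->] := bform_mixk mu measurable_distk distk_ge0 h2 ia ia.
rewrite -(RintZ _ i2); apply: le_Rint => //; first exact: integZ.
move=> t; have [t0|t0] := ltP t 0.
  by have [_ _ e1] := h1; have [_ _ e2] := h2; rewrite e1// e2// !mul0r mulr0.
by rewrite mulrA ler_wpM2r// bform_psd_expk.
Qed.

Definition rho0 : R -> R := w0 M.
Definition rho1 (t : R) : R := w0 M t * t.

Lemma wgt_rho0 : wgt rho0 1.
Proof.
split; first exact: measurable_w0.
- by move=> t; rewrite /rho0 w0E; case: ifP => _; rewrite ?normr1// normr0.
- by move=> t t0; rewrite /rho0 w0E leNgt t0.
Qed.

Lemma wgt_rho1 : wgt rho1 `|M|.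
Proof.
split; first by have := measurable_w0 M => m; rewrite /rho1; mfun.
- move=> t; rewrite /rho1 w0E; case: ifP => [/andP[t0 tM]|_]; last by rewrite mul0r normr0.
  by rewrite mul1r ger0_norm// (le_trans tM)// ler_norm.
- by move=> t t0; rewrite /rho1 w0E leNgt t0 mul0r.
Qed.

Lemma rho0_ge0 t : 0 <= rho0 t. Proof. exact: w0_ge0. Qed.

Lemma rho1_ge0 t : 0 <= rho1 t.
Proof. by rewrite /rho1 w0E; case: ifP => [/andP[t0 _]|_]; rewrite ?mul1r// mul0r. Qed.

Lemma rho1_le t : rho1 t <= `|M| * rho0 t.
Proof.
rewrite /rho1 /rho0 w0E; case: ifP => [/andP[t0 tM]|_]; last by rewrite mul0r mulr0.
by rewrite mul1r mulr1 (le_trans tM)// ler_norm.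
Qed.

Lemma mf_q_t_joint : measurable_fun setT
  (fun ot : p.-tuple R * R => rho1 ot.2 * q_t q ot.2 ot.1).
Proof.
have [m1 _ _] := wgt_rho1.
apply: measurable_funM; first exact: (mf_comp2 m1).
apply: mf_prod => i; rewrite /psi_t.
have mt : measurable_fun setT (fun ot : p.-tuple R * R => ot.2 `^ (- q%:R^-1)).
  exact: (mf_comp2 (@measurable_powR R _)).
have mo : measurable_fun setT (fun ot : p.-tuple R * R => tnth ot.1 i).
  exact: (mf_comp1 (measurable_tnth i)).
apply: measurable_funM => //; apply: mf_cont; first exact: continuous_psi.
exact: measurable_funM.
Qed.

Lemma QtildeE (om : p.-tuple R) : Qtilde mu q om = (\int[mu]_t (rho1 t * q_t q t om)%:E)%E.
Proof.
rewrite /Qtilde (integral_w0 hM); last first.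
  apply: measurable_funM => //; apply: mf_prod => i; rewrite /psi_t.
  have mt := @measurable_powR R (- q%:R^-1).
  apply: measurable_funM => //; apply: mf_cont; first exact: continuous_psi.
  by apply: measurable_funM => //; exact: measurable_cst.
by apply: eq_integral => t _; rewrite /rho1 mulrA.
Qed.

(** [spectral_t] averaged over [t] with weight [rho1], exchanging by Tonelli. *)
Lemma spectral_Q a1 a2 : integ P a1 -> integ P a2 ->
  (\int[lebp]_om ((wave_sq a1 a2 om)%:E * Qtilde mu q om) =
   (bform P (mixk mu distk rho1) a1 a1 + bform P (mixk mu distk rho1) a2 a2)%:E)%E.
Proof.
move=> i1 i2.
pose F (ot : p.-tuple R * R) := wave_sq a1 a2 ot.1 * (rho1 ot.2 * q_t q ot.2 ot.1).
have mF : measurable_fun setT F.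
  apply: measurable_funM; last exact: mf_q_t_joint.
  apply: (@measurable_wave_sq _ R (fun wt => a1 wt.1) (fun wt => a2 wt.1)).
    exact: (mf_comp1 (integ_measurable i1)).
  exact: (mf_comp1 (integ_measurable i2)).
have F0 ot : (0 <= (F ot)%:E)%E.
  rewrite lee_fin /F; apply: mulr_ge0; first exact: wave_sq_ge0.
  by apply: mulr_ge0; [exact: rho1_ge0|exact: q_t_ge0].
have mFE : measurable_fun setT (fun ot => (F ot)%:E) by exact/measurable_EFinP.
transitivity (\int[lebp]_om \int[mu]_t (F (om, t))%:E)%E.
  apply: eq_integral => om _; rewrite QtildeE.
  rewrite -integralZ_ge0 ?wave_sq_ge0//.
    have := measurableT_comp mf_q_t_joint (@measurable_pair1 _ _ _ _ om).
    by [].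
  by move=> t; apply: mulr_ge0; [exact: rho1_ge0|exact: q_t_ge0].
have := @fubini_tonelli _ _ (p.-tuple (measurableTypeR R)) (measurableTypeR R) R lebp mu _ mFE F0.
move=> ->.
have [j1 ->] := bform_mixk mu measurable_distk distk_ge0 wgt_rho1 i1 i1.
have [j2 ->] := bform_mixk mu measurable_distk distk_ge0 wgt_rho1 i2 i2.
rewrite -(RintD j1 j2) (EFin_Rint (integD j1 j2)).
apply: eq_integral => t _; rewrite /F/=.
have [t0|t0] := leP t 0.
  have r0 : rho1 t = 0.
    move: t0; rewrite le_eqVlt => /predU1P[->|t0]; first by rewrite /rho1 mulr0.
    by have [_ _ ->] := wgt_rho1.
  rewrite r0 !mul0r addr0; apply: integral0_eq => om _.
  by rewrite mul0r mulr0.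
have [iN eN] := spectral_t t0 i1 i2.
rewrite -mulrDr -eN -(RintZ _ iN) (EFin_Rint (integZ _ iN)).
by apply: eq_integral => om _; congr EFin; ring.
Qed.

End spectral.

(** * Duality for the ridge problem *)

Section dual.
Context {R : realType}.
Variables (q : nat) (hq : (q = 1 \/ q = 2)%N).
Variables (mu : {finite_measure set (measurableTypeR R) -> \bar R}) (M : R).
Hypothesis hM : msupport mu `<=` `[0, M].
Variables (p : nat) (H : set (p.-tuple R -> R)).
Variable dot : (p.-tuple R -> R) -> (p.-tuple R -> R) -> R.
Hypothesis hH : is_rkhs (lq_kernel q mu) H dot.
Context d (Om : measurableType d) (P : probability Om R).
Local Notation E f := (\int[P]_w f w)%R.
Variable phi : Om -> p.-tuple R.
Hypothesis mphi : forall i, measurable_fun setT (fun w => tnth (phi w) i).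
Variable Y : Om -> R.
Hypothesis YL : L2 P Y.
Variable lambda : R.
Hypothesis lambda0 : 0 < lambda.
Variable f : p.-tuple R -> R.
Hypothesis Hf : H f.
Hypothesis fm : forall g, H g ->
  obj dot P phi Y lambda f <= obj dot P phi Y lambda g.

Let r w := Y w - f (phi w).
Let K := mixk mu (distk q phi) (rho0 M).

Lemma resid_L2 : L2 P r.
Proof. by apply: L2B => //; exact: (rkhs_comp_L2 hq hM hH P mphi Hf). Qed.

Lemma gram_bdd : bdd K (fine (mu setT)).
Proof.
have := mixk_bdd P mu (measurable_distk q mphi) (distk_ge0 q phi) (wgt_rho0 M).
by rewrite mul1r.
Qed.

Lemma gramE x y : K (x, y) = lq_kernel q mu (phi x) (phi y).
Proof. by rewrite (lq_kernelE q hM). Qed.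

Lemma gram_sym x y : K (x, y) = K (y, x).
Proof. by rewrite /K /mixk distk_sym. Qed.

(** The representer formula: the normal equations tested against the sections
    of the kernel. *)
Lemma fit_repr w : f (phi w) = lambda^-1 * E (fun w' => r w' * K (w', w)).
Proof.
have Hk := rkhs_kernel hH (phi w).
have := obj_euler hq hM hH mphi YL lambda0 Hf fm Hk.
rewrite -(rkhs_repr hH _ Hf) => e.
rewrite -[LHS](mulKf (lt0r_neq0 lambda0)) -e; congr (_ * _).
by apply: eq_Rint => w'; rewrite gramE.
Qed.

Lemma fit_dual a : L2 P a -> E (fun w => f (phi w) * a w) = lambda^-1 * bform P K r a.
Proof.
move=> aL; have ir := L2_integ resid_L2; have ia := L2_integ aL.
rewrite (bform_iter2 gram_bdd ir ia) -RintZ; last first.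
  have mb := measurable_bform gram_bdd ir ia.
  have := @fubini_dom_int2 _ _ Om Om R P P _ _ _ mb
    (fun x y => bform_dom r a x y gram_bdd) (integZ _ (integ_abs ir)) (integ_abs ia).
  by apply: eq_integ.
apply: eq_Rint => w; rewrite fit_repr -mulrA; congr (_ * _).
have ik : integ P (fun w' => r w' * K (w', w)).
  apply: (@integMb _ _ _ P _ _ (fine (mu setT)) ir).
    by apply: (measurableT_comp gram_bdd.1); exact: measurable_pair2.
  by move=> x; exact: gram_bdd.2.
by rewrite mulrC -(RintZ _ ik); apply: eq_Rint => w' /=; ring.
Qed.

Lemma dot_dual : lambda * dot f f = lambda^-1 * bform P K r r.
Proof.
rewrite -(obj_euler hq hM hH mphi YL lambda0 Hf fm Hf) -(fit_dual resid_L2).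
by apply: eq_Rint => w; rewrite mulrC.
Qed.

Lemma obj_resid : obj dot P phi Y lambda f =
  2^-1 * E (fun w => r w ^+ 2) + (2 * lambda)^-1 * bform P K r r.
Proof.
rewrite /obj expE; congr (_ + _).
have -> : lambda / 2 * dot f f = 2^-1 * (lambda * dot f f) by ring.
by rewrite dot_dual invfM mulrA.
Qed.

(** Fenchel duality with the gap in closed form. The first three terms depend on
    the scaling of the inputs through [K] alone, and the last two are nonnegative
    and vanish at [a = r]: this is what allows the optimal values of two problems
    to be compared. *)
Lemma dual_gap a : L2 P a ->
  obj dot P phi Y lambda f = E (fun w => Y w * a w) - 2^-1 * E (fun w => a w ^+ 2)
    - (2 * lambda)^-1 * bform P K a a
    + 2^-1 * E (fun w => (r w - a w) ^+ 2)
    + (2 * lambda)^-1 * bform P K (fun w => r w - a w) (fun w => r w - a w).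
Proof.
move=> aL; have rL := resid_L2.
have ia := L2_integ aL; have ir := L2_integ rL.
have fL := rkhs_comp_L2 hq hM hH P mphi Hf.
have i1 := L2_integM rL aL; have i2 := L2_integM fL aL.
have e1 : E (fun w => Y w * a w) = E (fun w => r w * a w) + E (fun w => f (phi w) * a w).
  by rewrite -(RintD i1 i2); apply: eq_Rint => w; rewrite /r; ring.
have e2 : E (fun w => (r w - a w) ^+ 2) = E (fun w => r w ^+ 2)
    - 2 * E (fun w => r w * a w) + E (fun w => a w ^+ 2).
  rewrite -(RintZ _ i1) -(RintB rL.2 (integZ 2 i1)) -RintD; [|exact: (integB rL.2 (integZ 2 i1))|exact: aL.2].
  by apply: eq_Rint => w; ring.
have e3 : bform P K (fun w => r w - a w) (fun w => r w - a w) =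
    bform P K r r - 2 * bform P K r a + bform P K a a.
  have -> : (fun w => r w - a w) = (fun w => -1 * a w + r w).
    by apply/funext => w; rewrite mulN1r addrC.
  have ii : integ P (fun w => -1 * a w + r w) by apply: integD => //; exact: integZ.
  rewrite (bform_linl _ gram_bdd ia ir ii) !(bform_linr _ gram_bdd _ ia ir)//.
  rewrite (bform_sym gram_bdd gram_sym ia ir); ring.
rewrite obj_resid e1 e2 e3 (fit_dual aL) invfM; field.
by rewrite gt_eqF.
Qed.

Lemma gram_psd a : integ P a -> 0 <= bform P K a a.
Proof.
move=> ia; apply: (bform_psd_mixk hq mu mphi (wgt_rho0 M)) => // t; exact: rho0_ge0.
Qed.

(** The zero function is a competitor. *)
Lemma obj_le : obj dot P phi Y lambda f <= 2^-1 * E (fun w => Y w ^+ 2).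
Proof.
rewrite (le_trans (fm (rkhs_zero hH)))// /obj expE.
have d0 : dot (fun=> 0) (fun=> 0) = 0.
  have := rkhs_dotl hH (-1) (rkhs_zero hH) (rkhs_zero hH) (rkhs_zero hH).
  have -> : (fun x : p.-tuple R => -1 * 0 + 0 : R) = (fun=> 0).
    by apply/funext => x; rewrite mulr0 addr0.
  by rewrite mulN1r addNr.
rewrite d0 mulr0 addr0 le_eqVlt; apply/orP; left; apply/eqP; congr (_ * _).
by apply: eq_Rint => w; rewrite subr0.
Qed.

Lemma resid_bnd : E (fun w => r w ^+ 2) <= E (fun w => Y w ^+ 2).
Proof.
have := obj_le; rewrite obj_resid => h.
have : 0 <= (2 * lambda)^-1 * bform P K r r.
  rewrite mulr_ge0 ?(gram_psd (L2_integ resid_L2))// invr_ge0 mulr_ge0// ltW//.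
lra.
Qed.

(** The source of the factor [sqrt lambda]: in [obj_resid] the form of the
    residual carries [1 / lambda], while the optimal value is bounded
    independently of [lambda]. *)
Lemma gram_resid_bnd : bform P K r r <= lambda * E (fun w => Y w ^+ 2).
Proof.
have := obj_le; rewrite obj_resid => h.
have h2 : 0 <= E (fun w => r w ^+ 2) by apply: Rintegral_ge0 => w _; exact: sqr_ge0.
have : (2 * lambda)^-1 * bform P K r r <= 2^-1 * E (fun w => Y w ^+ 2) by lra.
rewrite invfM -mulrA ler_pM2l ?invr_gt0// => h3.
by rewrite -ler_pdivrMl.
Qed.

End dual.

(** * Differentiating the optimal value *)

(** An envelope argument along sequences. The kernel [K h] varies with [h] at an
    unbounded rate, but its increments are dominated by [V w * V w'] with [V]
    square-integrable; dividing them by this product gives the bounded kernels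
    [kap h], tested against [r h * V]. *)
Section envelope.
Context {R : realType} d (Om : measurableType d) (P : probability Om R).
Local Notation E f := (\int[P]_w f w)%R.
Local Notation PPp := ((P \x P)%E : probability (Om * Om)%type R).
Variables (lambda c c2 k B : R) (V : Om -> R) (W : Om * Om -> R).
Hypothesis lambda0 : 0 < lambda.
Hypothesis V1 : forall w, 1 <= V w.
Hypothesis VL : L2 P V.
Variables (S : set R) (J : R -> R) (r : R -> Om -> R) (K : R -> Om * Om -> R).
Variable g : Om * Om -> R.
Hypothesis S0 : S 0.
Hypothesis rL : forall h, S h -> L2 P (r h).
Hypothesis rB : forall h, S h -> E (fun w => r h w ^+ 2) <= B.
Hypothesis Kbdd : forall h, S h -> bdd (K h) k.
Hypothesis Kdiff : forall h z, S h ->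
  `|K h z - K 0 z| <= c * `|h| * (V z.1 * V z.2).
Hypothesis Kderiv : forall h z, S h -> h != 0 ->
  `|h^-1 * (K h z - K 0 z) + g z| <= c2 * `|h| * W z.
Hypothesis J_lb : forall h h', S h -> S h' ->
  J h' - (2 * lambda)^-1 * (bform P (K h) (r h') (r h') - bform P (K h') (r h') (r h'))
   + 2^-1 * E (fun w => (r h w - r h' w) ^+ 2) <= J h.

Let kap h (z : Om * Om) := h^-1 * (K h z - K 0 z) / (V z.1 * V z.2).
Let rV h w := r h w * V w.

Let V0 w : 0 < V w. Proof. exact: lt_le_trans (V1 w). Qed.
Let VV0 (z : Om * Om) : 0 < V z.1 * V z.2. Proof. exact: mulr_gt0. Qed.

Let kap_bdd h : S h -> h != 0 -> bdd (kap h) c.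
Proof.
move=> Sh hn; split.
  have [m1 _] := Kbdd Sh; have [m2 _] := Kbdd S0.
  have n1 := mf_fst VL.1; have n2 := mf_snd VL.1; rewrite /kap; mfun.
move=> z; rewrite /kap !normrM normfV normfV (gtr0_norm (VV0 z)).
rewrite ler_pdivrMr// ler_pdivrMl ?normr_gt0// mulrCA mulrA.
exact: Kdiff.
Qed.

Let rV_int h : S h -> integ P (rV h).
Proof. by move=> Sh; exact: (L2_integM (rL Sh) VL). Qed.

Let form_diff h h' : S h -> h != 0 -> S h' ->
  bform P (K h) (r h') (r h') - bform P (K 0) (r h') (r h') =
  h * bform P (kap h) (rV h') (rV h').
Proof.
move=> Sh hn Sh'; have i := L2_integ (rL Sh').
have e := bform_kap (-1) (Kbdd S0) (Kbdd Sh) i i.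
rewrite mulN1r addrC in e; rewrite -e.
have j := bform_integ (kap_bdd Sh hn) (rV_int Sh') (rV_int Sh').
rewrite /bform -(RintZ _ j); apply: eq_Rint => z.
rewrite /rV /kap; have := V0 z.1; have := V0 z.2.
by move=> v1 v2; field; rewrite hn !gt_eqF.
Qed.

Let b2 := Num.sqrt (B * E (fun w => V w ^+ 2)).

Let EV0 : 0 <= E (fun w => V w ^+ 2).
Proof. by apply: Rintegral_ge0 => w _; exact: sqr_ge0. Qed.

Let abs_mul a : L2 P a ->
  E (fun w => `|a w * V w|) <= Num.sqrt (E (fun w => a w ^+ 2) * E (fun w => V w ^+ 2)).
Proof.
move=> aL; have := L2_CS (L2_abs aL) VL; rewrite Rint_sqr_abs => h.
have -> : E (fun w => `|a w * V w|) = E (fun w => `|a w| * V w).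
  by apply: eq_Rint => w; rewrite normrM (gtr0_norm (V0 w)).
have e0 : 0 <= E (fun w => `|a w| * V w).
  by apply: Rintegral_ge0 => w _; rewrite mulr_ge0// ltW.
by rewrite -[leLHS](ger0_norm e0) -sqrtr_sqr ler_wsqrtr.
Qed.

Let rV_bnd h : S h -> E (fun w => `|rV h w|) <= b2.
Proof.
move=> Sh; apply: (le_trans (abs_mul (rL Sh))).
by rewrite ler_wsqrtr// ler_wpM2r// rB.
Qed.

Let form_bnd h a b x y : S h -> h != 0 -> integ P a -> integ P b ->
  E (fun w => `|a w|) <= x -> E (fun w => `|b w|) <= y ->
  `|bform P (kap h) a b| <= c * x * y.
Proof.
move=> Sh hn ia ib ax bx; apply: (le_trans (bform_bnd (kap_bdd Sh hn) ia ib)).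
have c0 : 0 <= c.
  have [w _] : exists w : Om, True by exists point.
  have [_ h1] := kap_bdd Sh hn; exact: le_trans (h1 (w, w)).
have a0 : 0 <= E (fun w => `|a w|) by apply: Rintegral_ge0 => w _.
have e0 : 0 <= E (fun w => `|b w|) by apply: Rintegral_ge0 => w _.
by rewrite ler_pM ?mulr_ge0// ler_wpM2l.
Qed.

Let q1 h := - (2 * lambda)^-1 * bform P (kap h) (rV 0) (rV 0).
Let q2 h := - (2 * lambda)^-1 * bform P (kap h) (rV h) (rV h).

(** Bounding [J h] at the residual for [0], and [J 0] at the residual for [h]. The
    squared distance of the two residuals is gained on both sides. *)
Let sandwich h : S h -> h != 0 ->
  h * q1 h + 2^-1 * E (fun w => (r h w - r 0 w) ^+ 2) <= J h - J 0 /\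
  J h - J 0 <= h * q2 h - 2^-1 * E (fun w => (r h w - r 0 w) ^+ 2).
Proof.
move=> Sh hn.
have l1 := J_lb Sh S0; have l2 := J_lb S0 Sh.
have e1 := form_diff Sh hn S0; have e2 := form_diff Sh hn Sh.
have e3 : E (fun w => (r 0 w - r h w) ^+ 2) = E (fun w => (r h w - r 0 w) ^+ 2).
  by apply: eq_Rint => w; ring.
rewrite e1 in l1; rewrite e3 -(opprB (bform P (K h) _ _)) e2 in l2.
rewrite /q1 /q2 !mulNr !mulrN.
rewrite mulrCA in l1; rewrite mulrN mulrCA in l2.
move: l1 l2; move: (h * _) (h * _) (2^-1 * _) => x y z l1 l2; split; lra.
Qed.

(** The two bounds of [sandwich] have to be compatible: this makes the residuals
    Hoelder continuous of order 1/2 at [h = 0]. *)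
Let resid_diff h : S h -> h != 0 ->
  E (fun w => (r h w - r 0 w) ^+ 2) <= `|h| * (lambda^-1 * (c * b2 * b2)).
Proof.
move=> Sh hn; have [s1 s2] := sandwich Sh hn.
have f1 := form_bnd Sh hn (rV_int S0) (rV_int S0) (rV_bnd S0) (rV_bnd S0).
have f2 := form_bnd Sh hn (rV_int Sh) (rV_int Sh) (rV_bnd Sh) (rV_bnd Sh).
have : E (fun w => (r h w - r 0 w) ^+ 2) <= h * (q2 h - q1 h) by move: s1 s2; rewrite mulrBr; lra.
move=> /le_trans; apply.
apply: (le_trans (ler_norm _)); rewrite normrM ler_wpM2l// /q1 /q2 -mulrBr normrM normrN.
rewrite invfM normrM -mulrA (gtr0_norm (_ : 0 < 2^-1))// (gtr0_norm (_ : 0 < lambda^-1)) ?invr_gt0//.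
rewrite mulrCA ler_wpM2l ?invr_ge0 ?(ltW lambda0)//.
have f3 := ler_normB (bform P (kap h) (rV h) (rV h)) (bform P (kap h) (rV 0) (rV 0)).
have f4 := le_trans f3 (lerD f2 f1).
by move: f4; move: (`|_|) (c * _ * _) => ? ? ?; lra.
Qed.

Let b3 := Num.sqrt (lambda^-1 * (c * b2 * b2) * E (fun w => V w ^+ 2)).

Let q_diff h : S h -> h != 0 ->
  `|q2 h - q1 h| <= Num.sqrt `|h| * (lambda^-1 * (c * b3 * b2)).
Proof.
move=> Sh hn.
pose e w := r h w - r 0 w.
have eL : L2 P e by apply: L2B; exact: rL.
have ie : integ P (fun w => e w * V w) by exact: L2_integM eL VL.
have be : E (fun w => `|e w * V w|) <= Num.sqrt `|h| * b3.
  apply: (le_trans (abs_mul eL)); rewrite /b3 -sqrtrM// ler_wsqrtr// mulrA ler_wpM2r//.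
  exact: resid_diff.
have f1 := form_bnd Sh hn ie (rV_int Sh) be (rV_bnd Sh).
have f2 := form_bnd Sh hn (rV_int S0) ie (rV_bnd S0) be.
have d1 : bform P (kap h) (rV h) (rV h) - bform P (kap h) (rV 0) (rV 0) =
    bform P (kap h) (fun w => e w * V w) (rV h) + bform P (kap h) (rV 0) (fun w => e w * V w).
  have kb := kap_bdd Sh hn.
  have j1 := bform_integ kb (rV_int Sh) (rV_int Sh).
  have j2 := bform_integ kb (rV_int S0) (rV_int S0).
  have j3 := bform_integ kb ie (rV_int Sh).
  have j4 := bform_integ kb (rV_int S0) ie.
  rewrite /bform -(RintB j1 j2) -(RintD j3 j4); apply: eq_Rint => z.
  by rewrite /e /rV; ring.
rewrite /q1 /q2 -mulrBr normrM normrN d1.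
rewrite invfM normrM (gtr0_norm (_ : 0 < 2^-1))// (gtr0_norm (_ : 0 < lambda^-1)) ?invr_gt0//.
rewrite mulrCA (mulrC _ lambda^-1) -[leLHS]mulrA ler_wpM2l ?invr_ge0 ?(ltW lambda0)//.
have f3 := ler_normD (bform P (kap h) (fun w => e w * V w) (rV h)) (bform P (kap h) (rV 0) (fun w => e w * V w)).
have E1 : c * (Num.sqrt `|h| * b3) * b2 = Num.sqrt `|h| * (c * b3 * b2) by ring.
have E2 : c * b2 * (Num.sqrt `|h| * b3) = Num.sqrt `|h| * (c * b3 * b2) by ring.
rewrite E1 in f1; rewrite E2 in f2.
have f4 := le_trans f3 (lerD f1 f2).
by move: f4; move: (`|_ + _|) (Num.sqrt _ * (c * b3 * b2)) => ? ? ?; lra.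
Qed.

(** The difference quotient lies between [q1 h] and [q2 h], whatever the sign of
    [h], and only the residual at 0 enters [q1 h]. *)
Let quotient_close h : S h -> h != 0 ->
  `|h^-1 * (J h - J 0) - q1 h| <= Num.sqrt `|h| * (lambda^-1 * (c * b3 * b2)).
Proof.
move=> Sh hn; apply: (le_trans _ (q_diff Sh hn)).
rewrite -(ler_pM2l (_ : 0 < `|h|)) ?normr_gt0// -!normrM mulrBr mulrA mulfV// mul1r mulrBr.
have [s1 s2] := sandwich Sh hn.
have e0 : 0 <= E (fun w => (r h w - r 0 w) ^+ 2) by apply: Rintegral_ge0 => w _; exact: sqr_ge0.
have d0 : 0 <= J h - J 0 - h * q1 h by move: s1 e0; lra.
rewrite (ger0_norm d0) (le_trans _ (ler_norm _))//; move: s2 e0; lra.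
Qed.

Let lin_cvg (h_ : nat -> R) (a : R) : h_ @ \oo --> 0 -> `|h_ n| * a @[n --> \oo] --> 0.
Proof.
move=> h0; rewrite -[X in _ --> X](mul0r a); apply: cvgMr_tmp.
by rewrite -(normr0 R); apply: cvg_norm.
Qed.

Lemma envelope_cvg (h_ : nat -> R) : (forall n, S (h_ n)) -> (forall n, h_ n != 0) ->
  h_ @ \oo --> 0 ->
  (h_ n)^-1 * (J (h_ n) - J 0) @[n --> \oo] --> (2 * lambda)^-1 * bform P g (r 0) (r 0).
Proof.
move=> Sh hn h0.
have ptw z : (h_ n)^-1 * (K (h_ n) z - K 0 z) @[n --> \oo] --> - g z.
  apply/subr_cvg0/norm_cvg0P.
  apply: (@squeeze_cvgr _ _ _ _ (cst 0) (fun n => `|h_ n| * (c2 * W z))).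
  - apply: nearW => n; rewrite normr_ge0 opprK/=.
    by rewrite (le_trans (Kderiv z (Sh n) (hn n)))// mulrCA mulrA.
  - exact: cvg_cst.
  - exact: lin_cvg.
have c1 : q1 (h_ n) @[n --> \oo] --> (2 * lambda)^-1 * bform P g (r 0) (r 0).
  have [] := @Rint_cvg _ _ _ PPp (fun n z => rV 0 z.1 * rV 0 z.2 * kap (h_ n) z)
    (fun z => r 0 z.1 * r 0 z.2 * - g z) (fun z => c * `|rV 0 z.1| * `|rV 0 z.2|).
  - by move=> n; apply: (measurable_bform (kap_bdd (Sh n) (hn n))); exact: rV_int.
  - move=> z.
    have -> : (fun n => rV 0 z.1 * rV 0 z.2 * kap (h_ n) z) =
        (fun n => r 0 z.1 * r 0 z.2 * ((h_ n)^-1 * (K (h_ n) z - K 0 z))).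
      apply/funext => n; rewrite /rV /kap; have := V0 z.1; have := V0 z.2.
      by move=> v1 v2; field; rewrite hn !gt_eqF.
    by apply: cvgMl_tmp.
  - exact: (integ_prod (integZ c (integ_abs (rV_int S0))) (integ_abs (rV_int S0))).
  - by move=> n [x y]; exact: (bform_dom _ _ _ _ (kap_bdd (Sh n) (hn n))).
  move=> ig cg.
  have -> : (2 * lambda)^-1 * bform P g (r 0) (r 0) =
      - (2 * lambda)^-1 * (\int[PPp]_z (r 0 z.1 * r 0 z.2 * - g z))%R.
    rewrite mulNr -mulrN -mulN1r -(RintZ _ ig); congr (_ * _).
    by apply: eq_Rint => z; rewrite mulN1r mulrN opprK.
  by apply: cvgMl_tmp.
have c3 : (h_ n)^-1 * (J (h_ n) - J 0) - q1 (h_ n) @[n --> \oo] --> 0.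
  apply/norm_cvg0P.
  apply: (@squeeze_cvgr _ _ _ _ (cst 0) (fun n => Num.sqrt `|h_ n| * (lambda^-1 * (c * b3 * b2)))).
  - by apply: nearW => n; rewrite normr_ge0/= quotient_close.
  - exact: cvg_cst.
  - rewrite -[X in _ --> X](mul0r (lambda^-1 * (c * b3 * b2))); apply: cvgMr_tmp.
    rewrite -(sqrtr0 R); apply: continuous_cvg; first exact: sqrt_continuous.
    by rewrite -(normr0 R); apply: cvg_norm.
have -> : (fun n => (h_ n)^-1 * (J (h_ n) - J 0)) =
    (fun n => (h_ n)^-1 * (J (h_ n) - J 0) - q1 (h_ n) + q1 (h_ n)).
  by apply/funext => n; rewrite subrK.
by rewrite -[X in _ --> X]add0r; exact: cvgD c3 c1.
Qed.

End envelope.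

(** * Moments and the size of the remainder *)

Section moments.
Context {R : realType} d (Om : measurableType d) (P : probability Om R).
Local Notation E f := (\int[P]_w f w)%R.
Variable x : Om -> R.
Hypothesis mx : measurable_fun setT x.
Hypothesis x4 : integ P (fun w => x w ^+ 4).

Lemma L2_sqr_of4 : L2 P (fun w => x w ^+ 2).
Proof.
split; first exact: measurable_funX.
by apply: eq_integ x4 => w; rewrite -exprM.
Qed.

Lemma L2_of4 : L2 P x.
Proof. by split=> //; exact: (L2_integ L2_sqr_of4). Qed.

Lemma moment2_le : E (fun w => x w ^+ 2) ^+ 2 <= E (fun w => x w ^+ 4).
Proof.
have := L2_abs_le L2_sqr_of4.
have -> : E (fun w => `|x w ^+ 2|) = E (fun w => x w ^+ 2).
  by apply: eq_Rint => w; rewrite ger0_norm// sqr_ge0.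
by move=> /le_trans; apply; rewrite le_eqVlt; apply/orP; left; apply/eqP;
  apply: eq_Rint => w; rewrite -exprM.
Qed.

Let m := E x.
Let m1 := E (fun w => `|x w|).

Lemma mean_sq_le : m ^+ 2 <= E (fun w => x w ^+ 2).
Proof.
have := L2_CS L2_of4 (L2_cst P 1); rewrite Rint_cstP expr1n mulr1.
by have -> : E (fun w => x w * 1) = m by apply: eq_Rint => w; rewrite mulr1.
Qed.

Definition centered w := x w - E x.

Lemma L2_centered : L2 P centered.
Proof. by apply: L2B; [exact: L2_of4|exact: L2_cst]. Qed.

Lemma L2_centered_sq : L2 P (fun w => centered w ^+ 2) /\
  E (fun w => (centered w ^+ 2) ^+ 2) <= 16 * E (fun w => x w ^+ 4).
Proof.
have mc : measurable_fun setT centered := L2_centered.1.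
have ii : integ P (fun w => 8 * (x w ^+ 4 + m ^+ 4)).
  by apply: integZ; apply: integD => //; exact: integ_cst.
have le w : (centered w ^+ 2) ^+ 2 <= 8 * (x w ^+ 4 + m ^+ 4).
  rewrite /centered -/m; move: (x w) => a.
  have h := sqr_ge0 (a + m); have h1 := sqr_ge0 (a - m).
  have h2 : (a - m) ^+ 2 <= 2 * (a ^+ 2 + m ^+ 2) by nra.
  have h3 : ((a - m) ^+ 2) ^+ 2 <= (2 * (a ^+ 2 + m ^+ 2)) ^+ 2.
    by rewrite lerXn2r// nnegrE ?sqr_ge0// (le_trans h1).
  apply: (le_trans h3); have := sqr_ge0 (a ^+ 2 - m ^+ 2).
  have -> : a ^+ 4 = (a ^+ 2) ^+ 2 by rewrite -exprM.
  have -> : m ^+ 4 = (m ^+ 2) ^+ 2 by rewrite -exprM.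
  by move: (a ^+ 2) (m ^+ 2) => A B; nra.
have iL : integ P (fun w => (centered w ^+ 2) ^+ 2).
  apply: integ_le ii; first by do 2 apply: measurable_funX.
  by move=> w; rewrite ger0_norm ?sqr_ge0.
split; first by split=> //; exact: measurable_funX.
apply: (le_trans (le_Rint iL ii le)).
rewrite (RintZ _ (integD x4 (integ_cst P (m ^+ 4)))) (RintD x4 (integ_cst P (m ^+ 4))) Rint_cstP.
have h1 := mean_sq_le; have h2 := moment2_le.
have h3 : (m ^+ 2) ^+ 2 <= E (fun w => x w ^+ 2) ^+ 2.
  by rewrite lerXn2r// nnegrE ?sqr_ge0// (le_trans (sqr_ge0 m)).
have -> : m ^+ 4 = (m ^+ 2) ^+ 2 by rewrite -exprM.
have h4 := le_trans h3 h2.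
by move: h4; move: (E (fun w => x w ^+ 4)) (_ ^+ 2) => A B h4; lra.
Qed.

Lemma L2_of_abs_le (g : Om -> R) : measurable_fun setT g ->
  (forall w, `|g w| <= `|x w| + 2 * m1) ->
  L2 P g /\ E (fun w => g w ^+ 2) <= 16 * (1 + E (fun w => x w ^+ 4)).
Proof.
move=> mg gle; have i2 := L2_of4.2.
have m10 : 0 <= m1 by apply: Rintegral_ge0 => w _.
have le w : g w ^+ 2 <= 2 * x w ^+ 2 + 8 * m1 ^+ 2.
  have h : g w ^+ 2 <= (`|x w| + 2 * m1) ^+ 2.
    by rewrite -[leLHS]real_normK ?num_real// lerXn2r ?nnegrE ?addr_ge0 ?mulr_ge0// (le_trans _ (gle w)).
  apply: (le_trans h); rewrite -(real_normK (num_real (x w))).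
  by have := sqr_ge0 (`|x w| - 2 * m1); move: (`|x w|) => A; nra.
have ii : integ P (fun w => 2 * x w ^+ 2 + 8 * m1 ^+ 2).
  by apply: integD; [exact: integZ|exact: integ_cst].
have ig : integ P (fun w => g w ^+ 2).
  apply: integ_le ii; first exact: measurable_funX.
  by move=> w; rewrite ger0_norm ?sqr_ge0.
split=> //; apply: (le_trans (le_Rint ig ii le)).
rewrite (RintD (integZ 2 i2) (integ_cst P (8 * m1 ^+ 2))) (RintZ 2 i2) Rint_cstP.
have h1 := L2_abs_le L2_of4; have h2 := moment2_le; rewrite -/m1 in h1.
by move: h1 h2; move: (m1 ^+ 2) (E (fun w => x w ^+ 2)) (E (fun w => x w ^+ 4)) => A B D h1 h2; nra.
Qed.

End moments.

Section remainder.
Context {R : realType}.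
Variables (q : nat) (hq : (q = 1 \/ q = 2)%N).
Variables (mu : {finite_measure set (measurableTypeR R) -> \bar R}) (M : R).
Variable p : nat.
Context d (Om : measurableType d) (P : probability Om R).
Local Notation E f := (\int[P]_w f w)%R.
Variable phi : Om -> p.-tuple R.
Hypothesis mphi : forall i, measurable_fun setT (fun w => tnth (phi w) i).
Let K := mixk mu (distk q phi) (rho0 M).
Let G := mixk mu (distk q phi) (rho1 M).
Let s := fine (mu setT).

Lemma dgram_bdd : bdd G (`|M| * s).
Proof. exact: (mixk_bdd P mu (measurable_distk q mphi) (distk_ge0 q phi) (wgt_rho1 M)). Qed.

Lemma dgram_sym x y : G (x, y) = G (y, x).
Proof. by rewrite /G /mixk distk_sym. Qed.

Lemma dgram_psd a : integ P a -> 0 <= bform P G a a.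
Proof.
move=> ia; apply: (bform_psd_mixk hq mu mphi (wgt_rho1 M)) => // t; exact: rho1_ge0.
Qed.

(** Cauchy-Schwarz for the positive semidefinite form of [G]. The factor
    [bform P G r r] is at most [|M|] times [bform P K r r], because [t <= M] on the
    support of [mu]; the other one is bounded through [|G| <= |M| s]. *)
Lemma remainder_bnd (r g : Om -> R) (b c lambda : R) : L2 P r -> L2 P g -> 0 <= lambda ->
  E (fun w => r w ^+ 2) <= b -> E (fun w => g w ^+ 2) <= c -> bform P K r r <= lambda * b ->
  `|bform P G (fun w => r w * g w) r| <=
    `|M| * b * Num.sqrt s * Num.sqrt c * Num.sqrt lambda.
Proof.
move=> rL gL l0 rb gc Kb.
have irg := L2_integM rL gL; have ir := L2_integ rL.
have s0 : 0 <= s by exact: s_ge0.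
have b0 : 0 <= b by apply: le_trans rb; apply: Rintegral_ge0 => w _; exact: sqr_ge0.
have c0 : 0 <= c by apply: le_trans gc; apply: Rintegral_ge0 => w _; exact: sqr_ge0.
have h1 := bform_CS dgram_bdd dgram_sym dgram_psd irg ir.
have h2 : bform P G r r <= `|M| * (lambda * b).
  apply: (le_trans (bform_mixk_le hq mu mphi (wgt_rho1 M) (wgt_rho0 M) (rho1_le M) ir)).
  by rewrite ler_wpM2l.
have h3 : E (fun w => `|r w * g w|) ^+ 2 <= b * c.
  have := L2_CS (L2_abs rL) (L2_abs gL); rewrite !Rint_sqr_abs.
  have -> : E (fun w => `|r w| * `|g w|) = E (fun w => `|r w * g w|).
    by apply: eq_Rint => w; rewrite normrM.
  move=> /le_trans; apply; apply: ler_pM => //;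
    by apply: Rintegral_ge0 => w _; exact: sqr_ge0.
have h4 : bform P G (fun w => r w * g w) (fun w => r w * g w) <= `|M| * s * (b * c).
  apply: (le_trans (ler_norm _)); apply: (le_trans (bform_bnd dgram_bdd irg irg)).
  by rewrite -mulrA -expr2 ler_wpM2l// mulr_ge0.
have h5 : bform P G (fun w => r w * g w) r ^+ 2 <=
    (`|M| * s * (b * c)) * (`|M| * (lambda * b)).
  by apply: (le_trans h1); apply: ler_pM => //; exact: dgram_psd.
rewrite -sqrtr_sqr; apply: (le_trans (ler_wsqrtr h5)).
have -> : `|M| * s * (b * c) * (`|M| * (lambda * b)) = (`|M| * b) ^+ 2 * (s * c * lambda) by ring.
rewrite sqrtrM ?sqr_ge0// sqrtr_sqr ger0_norm ?mulr_ge0//.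
by rewrite !sqrtrM ?mulr_ge0// !mulrA.
Qed.

(** The square of a difference is expanded around [m]. In the last form the
    variables have separated: with [m] the mean of [x] it becomes the covariance
    integral, and the first form becomes the remainder. *)
Lemma bform_sqdist (x r : Om -> R) (m : R) : L2 P r -> L2 P (fun w => x w - m) ->
  L2 P (fun w => (x w - m) ^+ 2) ->
  bform P (fun z => G z * `|x z.1 - x z.2| ^+ 2) r r =
  2 * bform P G (fun w => r w * (x w - m) ^+ 2) r
  - 2 * bform P G (fun w => r w * (x w - m)) (fun w => r w * (x w - m)).
Proof.
move=> rL xL x2L.
have ir := L2_integ rL; have i1 := L2_integM rL xL; have i2 := L2_integM rL x2L.
have hG := dgram_bdd.
have j1 := bform_integ hG i2 ir; have j2 := bform_integ hG ir i2.
have j3 := bform_integ hG i1 i1.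
have -> : 2 * bform P G (fun w => r w * (x w - m) ^+ 2) r =
   bform P G (fun w => r w * (x w - m) ^+ 2) r + bform P G r (fun w => r w * (x w - m) ^+ 2).
  by rewrite -(bform_sym hG dgram_sym i2 ir); ring.
rewrite /bform -(RintD j1 j2) -(RintZ 2 j3) -(RintB (integD j1 j2) (integZ 2 j3)).
by apply: eq_Rint => z; rewrite real_normK ?num_real//; ring.
Qed.

End remainder.

(** * Covariances of waves *)

Section covariance.
Context {R : realType} d (Om : measurableType d) (P : probability Om R).
Local Notation E f := (\int[P]_w f w)%R.
Variable p : nat.
Variable phi : Om -> p.-tuple R.
Hypothesis mphi : forall i, measurable_fun setT (fun w => tnth (phi w) i).

Local Notation cosp om w := (cos (tdot om (phi w))).
Local Notation sinp om w := (sin (tdot om (phi w))).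

(** Subtracting the product of expectations amounts to centering the
    observable [u + i v], which turns the covariance into a plain expectation. *)
Lemma sqmod_ccov (r u v : Om -> R) om : L2 P r -> L2 P u -> L2 P v ->
  sqmod (ccov P (fun w => expi (tdot om (phi w)) * (r w)%:C) (fun w => u w +i* v w)) =
  wave_sq P phi (fun w => r w * (u w - E u)) (fun w => r w * (v w - E v)) om.
Proof.
move=> rL uL vL.
have rcL : L2 P (fun w => r w * cosp om w).
  apply: (@L2_le _ _ _ _ _ r) => //.
    by apply: measurable_funM; [exact: rL.1|apply: mf_cos; exact: measurable_phase1].
  by move=> w; rewrite normrM ler_piMr// cos_max.
have rsL : L2 P (fun w => r w * sinp om w).
  apply: (@L2_le _ _ _ _ _ r) => //.
    by apply: measurable_funM; [exact: rL.1|apply: mf_sin; exact: measurable_phase1].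
  by move=> w; rewrite normrM ler_piMr// sin_max.
have ic := L2_integ rcL; have isn := L2_integ rsL.
have icu := L2_integM rcL uL; have icv := L2_integM rcL vL.
have isu := L2_integM rsL uL; have isv := L2_integM rsL vL.
rewrite /sqmod /wave_sq /ccov /cexpectation !expE /=.
congr (_ ^+ 2 + _ ^+ 2).
- rewrite /wave_re.
  have -> : E (fun w => r w * (u w - E u) * cosp om w -
      r w * (v w - E v) * sinp om w) =
    E (fun w => (r w * cosp om w * u w - r w * sinp om w * v w) -
      (E u * (r w * cosp om w) - E v * (r w * sinp om w))).
    by apply: eq_Rint => w; ring.
  rewrite (RintB (integB icu isv) (integB (integZ (E u) ic) (integZ (E v) isn))).
  rewrite (RintB (integZ (E u) ic) (integZ (E v) isn)) (RintZ _ ic) (RintZ _ isn).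
  congr (_ - _); first by apply: eq_Rint => w; ring.
  rewrite [E u * _]mulrC [E v * _]mulrC.
  by congr (_ * _ - _ * _); apply: eq_Rint => w; ring.
- rewrite /wave_im.
  have -> : E (fun w => r w * (u w - E u) * sinp om w +
      r w * (v w - E v) * cosp om w) =
    E (fun w => (r w * cosp om w * v w + r w * sinp om w * u w) -
      (E v * (r w * cosp om w) + E u * (r w * sinp om w))).
    by apply: eq_Rint => w; ring.
  rewrite (RintB (integD icv isu) (integD (integZ (E v) ic) (integZ (E u) isn))).
  rewrite (RintD (integZ (E v) ic) (integZ (E u) isn)) (RintZ _ ic) (RintZ _ isn).
  congr (_ - _); first by apply: eq_Rint => w; ring.
  rewrite [E u * _]mulrC [E v * _]mulrC.
  by congr (_ * _ + _ * _); apply: eq_Rint => w; ring.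
Qed.

End covariance.

(** * From absolute distances to covariances *)

Section cosine_kernel.
Context {R : realType}.
Local Notation leb := (@lebesgue_measure R).

Lemma oneB_cos_le (t : R) : 1 - cos t <= t ^+ 2 / 2.
Proof.
have e : 1 - cos t = 2 * sin (t / 2) ^+ 2.
  have := cosD (t / 2) (t / 2); rewrite -splitr => ->.
  by have := cos2Dsin2 (t / 2); rewrite !expr2 => h; lra.
have h : sin (t / 2) ^+ 2 <= (t / 2) ^+ 2.
  by rewrite -(real_normK (num_real (sin _))) -(real_normK (num_real (t / 2)))
     lerXn2r ?nnegrE// sin_le_norm.
by rewrite e; move: h; rewrite exprMn; move: (sin _ ^+ 2) (t ^+ 2) => a b; rewrite expr2; lra.
Qed.

(** Bounded by [v^2 / 2] near 0 and by [2 / z^2] far away. *)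
Lemma cosk_le (v z : R) : cosk v z <= 4 * (1 + v ^+ 2) * cauchy z.
Proof.
rewrite /cosk /cauchy; have [->|z0] := eqVneq z 0.
  by rewrite expr0n invr0 mulr0 mulr_ge0 ?invr_ge0 ?mulr_ge0 ?addr_ge0// sqr_ge0.
have z2 : 0 < z ^+ 2 by rewrite exprn_even_gt0.
have z3 : 0 < 1 + z ^+ 2 by rewrite ltr_wpDr// ltW.
rewrite ler_pdivrMr// mulrAC ler_pdivlMr//.
have h := oneB_cos_le (v * z); rewrite exprMn in h.
have h2 : -1 <= cos (v * z) by exact: cos_geN1.
have v2 := sqr_ge0 v.
move: h h2 z2 v2; move: (cos _) (v ^+ 2) (z ^+ 2) => a b D h h2 z2 v2; nra.
Qed.

(** A majorant in product form, as needed for Fubini. *)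
Lemma cosk_le2 (x y z : R) :
  `|cosk (x - y) z| <= 8 * (1 + x ^+ 2) * (1 + y ^+ 2) * cauchy z.
Proof.
rewrite ger0_norm ?cosk_ge0// (le_trans (cosk_le _ _))// ler_wpM2r ?cauchy_ge0//.
have := sqr_ge0 (x + y); have := sqr_ge0 (x * y); rewrite exprMn; nra.
Qed.

Lemma Rint_cosk (v : R) : (\int[leb]_z cosk v z)%R = pi * `|v|.
Proof. by rewrite /Rintegral integral_cosk. Qed.

End cosine_kernel.

Section absolute_distance.
Context {R : realType}.
Variables (q : nat) (hq : (q = 1 \/ q = 2)%N).
Local Notation mR := (measurableTypeR R).
Variables (mu : {finite_measure set mR -> \bar R}) (M : R).
Hypothesis hM : msupport mu `<=` `[0, M].
Variable p : nat.
Context d (Om : measurableType d) (P : probability Om R).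
Local Notation E f := (\int[P]_w f w)%R.
Local Notation PPp := ((P \x P)%E : probability (Om * Om)%type R).
Local Notation leb := (@lebesgue_measure R).
Local Notation lebp := (mpower (@lebesgue_measure R) p).
Variable phi : Om -> p.-tuple R.
Hypothesis mphi : forall i, measurable_fun setT (fun w => tnth (phi w) i).
Variables (x r : Om -> R).
Hypothesis mx : measurable_fun setT x.
Hypothesis x4 : integ P (fun w => x w ^+ 4).
Hypothesis rL : L2 P r.
Let G := mixk mu (distk q phi) (rho1 M).

Let V w := 1 + x w ^+ 2.
Let VL : L2 P V.
Proof. by apply: L2D; [exact: L2_cst|exact: L2_sqr_of4]. Qed.
Let iV : integ P V := L2_integ VL.
Let V0 w : 0 <= V w. Proof. by rewrite addr_ge0// sqr_ge0. Qed.
Let e := E V.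

Let mc u : measurable_fun setT (fun wz : Om * mR => cosk (u - x wz.1) wz.2).
Proof.
have m1 : measurable_fun setT (fun wz : Om * mR => x wz.1).
  exact: (mf_comp1 mx).
have m2 : measurable_fun setT (fun wz : Om * mR => wz.2 : R).
  exact: measurable_snd.
by rewrite /cosk; mfun.
Qed.

Let mc2 : measurable_fun setT
  (fun wz : (Om * Om) * mR => cosk (x wz.1.1 - x wz.1.2) wz.2).
Proof.
have m1 : measurable_fun setT (fun wz : (Om * Om) * mR => x wz.1.1).
  exact: (mf_comp1 (mf_fst mx)).
have m3 : measurable_fun setT (fun wz : (Om * Om) * mR => x wz.1.2).
  exact: (mf_comp1 (mf_snd mx)).
have m2 : measurable_fun setT (fun wz : (Om * Om) * mR => wz.2 : R).
  exact: measurable_snd.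
by rewrite /cosk; mfun.
Qed.

Definition mdist (u : R) : R := E (fun w => `|u - x w|).
Definition mmdist : R := (\int[PPp]_z `|x z.1 - x z.2|)%R.

Let Ak z u : R := E (fun w => cosk (u - x w) z).
Let Ck z : R := (\int[PPp]_y cosk (x y.1 - x y.2) z)%R.

Let cg u : forall w (z : mR),
  `|cosk (u - x w) z| <= (8 * (1 + u ^+ 2) * V w) * cauchy z.
Proof. by move=> w z; exact: cosk_le2. Qed.
Let icg u : integ P (fun w => 8 * (1 + u ^+ 2) * V w). Proof. exact: integZ. Qed.

Let cg2 : forall (y : Om * Om) (z : mR),
  `|cosk (x y.1 - x y.2) z| <= (8 * V y.1 * V y.2) * cauchy z.
Proof. by move=> y z; exact: cosk_le2. Qed.
Let icg2 : integ PPp (fun y => 8 * V y.1 * V y.2).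
Proof. exact: (integ_prod (integZ 8 iV) iV). Qed.

(** Integrated over the frequencies, the averages of the cosine kernel become mean
    absolute distances. *)
Let A_int u : integ leb (fun z => Ak z u) /\ (\int[leb]_z Ak z u)%R = pi * mdist u.
Proof.
have h2 := @fubini_dom_int2 _ _ Om mR R P leb _ _ _ (mc u) (cg u) (icg u) (@integ_cauchy R).
have h := @fubini_dom _ _ Om mR R P leb _ _ _ (mc u) (cg u) (icg u) (@integ_cauchy R).
split; first exact: h2.
have h' : (\int[leb]_z Ak z u)%R = E (fun w => (\int[leb]_z cosk (u - x w) z)%R) by rewrite h.
rewrite h' /mdist -RintZ; last first.
  apply: integ_abs; apply: integB; [exact: integ_cst|exact: (L2_integ (L2_of4 mx x4))].
by apply: eq_Rint => w; exact: Rint_cosk.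
Qed.

Let x_abs : integ PPp (fun z => `|x z.1 - x z.2|).
Proof.
apply: integ_abs.
have ix := L2_integ (L2_of4 mx x4).
have j1 := integ_prod ix (integ_cst P 1); have j2 := integ_prod (integ_cst P 1) ix.
apply: integB; [apply: eq_integ j1 => z|apply: eq_integ j2 => z].
  by rewrite mulr1.
by rewrite mul1r.
Qed.

Let C_int : integ leb Ck /\ (\int[leb]_z Ck z)%R = pi * mmdist.
Proof.
have h2 := @fubini_dom_int2 _ _ (Om * Om)%type mR R PPp leb _ _ _ mc2 cg2 icg2 (@integ_cauchy R).
have h := @fubini_dom _ _ (Om * Om)%type mR R PPp leb _ _ _ mc2 cg2 icg2 (@integ_cauchy R).
split; first exact: h2.
have h' : (\int[leb]_z Ck z)%R = (\int[PPp]_y (\int[leb]_z cosk (x y.1 - x y.2) z))%R by rewrite h.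
rewrite h' /mmdist -(RintZ _ x_abs).
by apply: eq_Rint => y; exact: Rint_cosk.
Qed.

(** The kernel [- (1 - cos (z (x - x'))) / z^2] centered in both variables under
    the law of [x]. Double centering turns the conditionally positive definite
    kernel [- |x - x'|] into a positive definite one. *)
Definition ckern z (y : Om * Om) : R :=
  Ak z (x y.1) + Ak z (x y.2) - Ck z - cosk (x y.1 - x y.2) z.

Local Notation mcos z := (E (fun w => cos (z * x w))).
Local Notation msin z := (E (fun w => sin (z * x w))).
Let a1 z w := r w * (cos (z * x w) - mcos z).
Let a2 z w := r w * (sin (z * x w) - msin z).

Let icos z : integ P (fun w => cos (z * x w)).
Proof.
apply: (integ_le _ _ (integ_cst P 1)) => [|w]; last exact: cos_max.
by mfun.
Qed.
Let isin z : integ P (fun w => sin (z * x w)).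
Proof.
apply: (integ_le _ _ (integ_cst P 1)) => [|w]; last exact: sin_max.
by mfun.
Qed.

Let a1_int z : integ P (a1 z).
Proof.
apply: L2_integM => //; apply: L2B; last exact: L2_cst.
by apply: (@L2_bnd _ _ _ _ _ 1) => [|w]; [mfun|exact: cos_max].
Qed.
Let a2_int z : integ P (a2 z).
Proof.
apply: L2_integM => //; apply: L2B; last exact: L2_cst.
by apply: (@L2_bnd _ _ _ _ _ 1) => [|w]; [mfun|exact: sin_max].
Qed.

Let Ak_E z u : Ak z u =
  (1 - (mcos z * cos (z * u) + msin z * sin (z * u))) / z ^+ 2.
Proof.
have i1 := integZ (cos (z * u)) (icos z); have i2 := integZ (sin (z * u)) (isin z).
have i3 := integB (integ_cst P 1) (integD i1 i2).
have -> : Ak z u = E (fun w => (z ^+ 2)^-1 * (1 - (cos (z * u) * cos (z * x w) + sin (z * u) * sin (z * x w)))).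
  apply: eq_Rint => w; rewrite /cosk (mulrBl z u (x w)) cosB [u * z]mulrC [x w * z]mulrC; ring.
rewrite (RintZ _ i3) (RintB (integ_cst P 1) (integD i1 i2)) Rint_cstP (RintD i1 i2) (RintZ _ (icos z)) (RintZ _ (isin z)).
by ring.
Qed.

Let Ck_E z : Ck z =
  (1 - (mcos z ^+ 2 + msin z ^+ 2)) / z ^+ 2.
Proof.
have i1 := integZ (mcos z) (icos z).
have i2 := integZ (msin z) (isin z).
have i3 := integB (integ_cst P 1) (integD i1 i2).
have cf w (z' : Om) : `|cosk (x w - x z') z| <= 8 * V w * cauchy z * V z'.
  by have := cosk_le2 (x w) (x z') z; rewrite [_ * cauchy z]mulrAC.
have m : measurable_fun setT (fun y : Om * Om => cosk (x y.1 - x y.2) z).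
  have m1 := mf_fst mx; have m2 := mf_snd mx; rewrite /cosk; mfun.
have ig : integ P (fun w => 8 * V w * cauchy z).
  by apply: eq_integ (integZ (8 * cauchy z) iV) => w; ring.
rewrite /Ck (fubini_domE1 m cf ig iV).
transitivity (E (fun w => (z ^+ 2)^-1 * (1 - (mcos z * cos (z * x w) + msin z * sin (z * x w))))).
  by apply: eq_Rint => w /=; rewrite -/(Ak z (x w)) Ak_E mulrC.
rewrite (RintZ _ i3) (RintB (integ_cst P 1) (integD i1 i2)) Rint_cstP (RintD i1 i2) (RintZ _ (icos z)) (RintZ _ (isin z)).
by rewrite !expr2 mulrC.
Qed.

Let hG : bdd G (`|M| * fine (mu setT)).
Proof. exact: dgram_bdd. Qed.

(** For each frequency, centering [cos (z x)] and [sin (z x)] is the same as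
    double centering of the cosine kernel. *)
Let wave_form z :
  (bform P G (a1 z) (a1 z) + bform P G (a2 z) (a2 z)) / z ^+ 2 =
  (\int[PPp]_y (r y.1 * r y.2 * G y * ckern z y))%R.
Proof.
have [->|z0] := eqVneq z 0.
  rewrite expr0n invr0 mulr0 -[LHS](mul0r (\int[PPp]_y (r y.1 * r y.2 * G y))%R).
  rewrite -(RintZ _ (bform_integ hG (L2_integ rL) (L2_integ rL))).
  apply: eq_Rint => y; rewrite /ckern !Ak_E Ck_E /cosk expr0n invr0; ring.
have j1 := bform_integ hG (a1_int z) (a1_int z); have j2 := bform_integ hG (a2_int z) (a2_int z).
rewrite /bform -(RintD j1 j2) mulrC -(RintZ _ (integD j1 j2)).
apply: eq_Rint => y; rewrite /ckern !Ak_E Ck_E /cosk (mulrBl z (x y.1) (x y.2)) cosB /a1 /a2.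
rewrite ![x _ * z]mulrC.
by field.
Qed.

Lemma ckern_bnd (y : Om * Om) (z : mR) :
  `|r y.1 * r y.2 * G y * ckern z y| <=
  (`|M| * fine (mu setT) * (8 * (1 + e) ^+ 2)) * `|r y.1 * V y.1| * `|r y.2 * V y.2| * cauchy z.
Proof.
have V1 w : 1 <= V w by rewrite lerDl sqr_ge0.
have e1 : 1 <= e by rewrite -(Rint_cstP P 1); apply: le_Rint => //; exact: integ_cst.
have Ab u : `|Ak z u| <= 8 * (1 + u ^+ 2) * e * cauchy z.
  have ig : integ P (fun w => 8 * (1 + u ^+ 2) * V w * cauchy z).
    by apply: eq_integ (integZ (8 * (1 + u ^+ 2) * cauchy z) iV) => w; ring.
  have ia : integ P (fun w => cosk (u - x w) z).
    by apply: integ_le ig; [rewrite /cosk; mfun|move=> w; exact: cosk_le2].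
  apply: (le_trans (normr_Rint ia ig (fun w => cosk_le2 u (x w) z))).
  have -> : E (fun w => 8 * (1 + u ^+ 2) * V w * cauchy z) = E (fun w => 8 * (1 + u ^+ 2) * cauchy z * V w).
    by apply: eq_Rint => w; ring.
  by rewrite (RintZ _ iV) -/e mulrAC.
have Cb : `|Ck z| <= 8 * e * e * cauchy z.
  have ig : integ PPp (fun y => 8 * V y.1 * V y.2 * cauchy z).
    by apply: eq_integ (integZ (cauchy z) icg2) => w; ring.
  have m : measurable_fun setT (fun y : Om * Om => cosk (x y.1 - x y.2) z).
    have m1 := mf_fst mx; have m2 := mf_snd mx; rewrite /cosk; mfun.
  have ia : integ PPp (fun y => cosk (x y.1 - x y.2) z).
    by apply: (integ_le m _ ig) => y'; exact: cosk_le2.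
  apply: (le_trans (normr_Rint ia ig (fun y => cosk_le2 (x y.1) (x y.2) z))).
  have -> : (\int[PPp]_y (8 * V y.1 * V y.2 * cauchy z))%R = bform P (fun=> 1) (fun w => (8 * cauchy z) * V w) V.
    by apply: eq_Rint => w; ring.
  have i8 := integZ (8 * cauchy z) iV.
  by rewrite (bform1 i8 iV) (RintZ _ iV) -/e le_eqVlt; apply/orP; left; apply/eqP; ring.
have hk : `|ckern z y| <= 8 * (1 + e) ^+ 2 * (V y.1 * V y.2) * cauchy z.
  rewrite /ckern.
  have t1 := ler_normB (Ak z (x y.1) + Ak z (x y.2) - Ck z) (cosk (x y.1 - x y.2) z).
  have t2 := ler_normB (Ak z (x y.1) + Ak z (x y.2)) (Ck z).
  have t3 := ler_normD (Ak z (x y.1)) (Ak z (x y.2)).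
  have b1 := Ab (x y.1); have b2 := Ab (x y.2); have b4 := cosk_le2 (x y.1) (x y.2) z.
  apply: (le_trans t1); apply: (le_trans (lerD (le_trans t2 (lerD (le_trans t3 (lerD b1 b2)) Cb)) b4)).
  rewrite -/(V y.1) -/(V y.2) -!mulrDl ler_wpM2r ?cauchy_ge0//.
  have v1 := V1 y.1; have v2 := V1 y.2; move: v1 v2 e1.
  move: (V y.1) (V y.2) e => v1 v2 ee h1 h2 h3.
  have q1 : v1 <= v1 * v2 by rewrite ler_peMr// (le_trans _ h1).
  have q2 : v2 <= v1 * v2 by rewrite ler_peMl// (le_trans _ h2).
  have q3 : 1 <= v1 * v2 by exact: le_trans q1.
  have p1 : v1 * ee <= v1 * v2 * ee by rewrite ler_wpM2r// (le_trans _ h3).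
  have p2 : v2 * ee <= v1 * v2 * ee by rewrite ler_wpM2r// (le_trans _ h3).
  have p3 : ee * ee <= v1 * v2 * (ee * ee) by rewrite ler_peMl// mulr_ge0// (le_trans _ h3).
  (* all products of [1], [e], [V] and [V'] are absorbed by [(1 + e)^2 V V'] *)
  have -> : 8 * (1 + ee) ^+ 2 * (v1 * v2) = 8 * (v1 * v2 + 2 * (v1 * v2 * ee) + v1 * v2 * (ee * ee)) by ring.
  by move: p1 p2 p3; rewrite -!mulrA; lra.
rewrite !normrM.
have gb := hG.2 y.
apply: (@le_trans _ _ (`|r y.1| * `|r y.2| * (`|M| * fine (mu setT)) * (8 * (1 + e) ^+ 2 * (V y.1 * V y.2) * cauchy z))).
  by rewrite ler_pM ?mulr_ge0// ler_wpM2l ?mulr_ge0.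
by rewrite (ger0_norm (V0 y.1)) (ger0_norm (V0 y.2)) le_eqVlt; apply/orP; left; apply/eqP; ring.
Qed.

Let F (yz : (Om * Om) * mR) : R :=
  r yz.1.1 * r yz.1.2 * G yz.1 * ckern yz.2 yz.1.

Let mAk (f : (Om * Om) * mR -> R) : measurable_fun setT f ->
  measurable_fun setT (fun yz : (Om * Om) * mR => Ak yz.2 (f yz)).
Proof.
move=> mf.
apply: (@measurable_Rint_param _ _ _ _ R P
  (fun wy : Om * ((Om * Om) * mR) => cosk (f wy.2 - x wy.1) wy.2.2)).
have m1 : measurable_fun setT (fun wy : Om * ((Om * Om) * mR) => f wy.2).
  exact: (mf_comp2 mf).
have m2 : measurable_fun setT (fun wy : Om * ((Om * Om) * mR) => x wy.1).
  exact: (mf_comp1 mx).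
have m3 : measurable_fun setT (fun wy : Om * ((Om * Om) * mR) => wy.2.2 : R).
  exact: (mf_comp2 measurable_snd).
by rewrite /cosk; mfun.
Qed.

Let mFm : measurable_fun setT F.
Proof.
have fst1 (f : Om * Om -> R) : measurable_fun setT f ->
    measurable_fun setT (fun yz : (Om * Om) * mR => f yz.1).
  by move=> mf; exact: (mf_comp1 mf).
have mr := rL.1.
have m1 := fst1 _ (mf_fst mr); have m2 := fst1 _ (mf_snd mr); have m3 := fst1 _ hG.1.
have n1 := mAk (fst1 _ (mf_fst mx)); have n2 := mAk (fst1 _ (mf_snd mx)).
have n3 : measurable_fun setT (fun yz : (Om * Om) * mR => Ck yz.2).
  exact: (mf_comp2 (integ_measurable C_int.1)).
have n4 := mc2.
rewrite /F /ckern; apply: measurable_funM; first by mfun.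
by apply: measurable_funB => //; apply: measurable_funB => //; exact: measurable_funD.
Qed.

Let irV : integ P (fun w => `|r w * V w|).
Proof. by apply: integ_abs; exact: (L2_integM rL VL). Qed.

Let iGd : integ PPp (fun y => (`|M| * fine (mu setT) * (8 * (1 + e) ^+ 2)) * `|r y.1 * V y.1| * `|r y.2 * V y.2|).
Proof. exact: (integ_prod (integZ _ irV) irV). Qed.

Let Fle : forall (y : Om * Om) (z : mR), `|F (y, z)| <=
  ((`|M| * fine (mu setT) * (8 * (1 + e) ^+ 2)) * `|r y.1 * V y.1| * `|r y.2 * V y.2|) * cauchy z.
Proof. exact: ckern_bnd. Qed.

Let ckern_int y : (\int[leb]_z ckern z y)%R =
  pi * (mdist (x y.1) + mdist (x y.2) - mmdist - `|x y.1 - x y.2|).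
Proof.
have [i1 e1] := A_int (x y.1); have [i2 e2] := A_int (x y.2); have [i3 e3] := C_int.
have i4 := integ_cosk (x y.1 - x y.2).
rewrite /ckern (@RintB _ _ _ leb _ _ (integB (integD i1 i2) i3) i4) (@RintB _ _ _ leb _ _ (integD i1 i2) i3).
rewrite (@RintD _ _ _ leb _ _ i1 i2) e1 e2 e3 Rint_cosk; ring.
Qed.

(** The part of [|x - x'|] that depends on one variable only: double centering
    subtracts [potential w + potential w'] from the distance. *)
Definition potential w := mdist (x w) - mmdist / 2.

Lemma potential_L2 : L2 P potential /\
  E (fun w => potential w ^+ 2) <= 16 * (1 + E (fun w => x w ^+ 4)).
Proof.
have ix := L2_integ (L2_of4 mx x4); have ia := integ_abs ix.
apply: (L2_of_abs_le mx x4).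
  apply: measurable_funB; last exact: mf_cst.
  apply: (@measurable_Rint_param _ _ _ _ R P (fun wy : Om * Om => `|x wy.2 - x wy.1|)).
  have m1 := mf_fst mx; have m2 := mf_snd mx; mfun.
move=> w.
have d0 : 0 <= mdist (x w) by apply: Rintegral_ge0 => v _.
have c0 : 0 <= mmdist by apply: Rintegral_ge0 => v _.
have d1 : mdist (x w) <= `|x w| + E (fun w => `|x w|).
  rewrite -[X in _ <= X + _](Rint_cstP P) -(RintD (integ_cst P _) ia).
  apply: le_Rint; [|exact: (integD (integ_cst P _) ia)|by move=> v; exact: ler_normB].
  by apply: integ_abs; apply: integB => //; exact: integ_cst.
have c1 : mmdist <= E (fun w => `|x w|) + E (fun w => `|x w|).
  have j1 := integ_prod ia (integ_cst P 1); have j2 := integ_prod (integ_cst P 1) ia.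
  have -> : E (fun w => `|x w|) + E (fun w => `|x w|) =
     (\int[PPp]_z (`|x z.1| * 1 + 1 * `|x z.2|))%R.
    rewrite (RintD j1 j2); congr (_ + _).
      have := bform1 ia (integ_cst P 1); rewrite Rint_cstP mulr1 => <-.
      by apply: eq_Rint => z; rewrite !mulr1.
    have := bform1 (integ_cst P 1) ia; rewrite Rint_cstP mul1r => <-.
    by apply: eq_Rint => z; rewrite mulr1.
  apply: le_Rint; [exact: x_abs|exact: (integD j1 j2)|].
  by move=> z; rewrite mulr1 mul1r; exact: ler_normB.
rewrite /potential ler_norml.
move: d0 c0 d1 c1 (normr_ge0 (x w)); move: (mdist _) mmdist (E (fun w => `|x w|)) (`|x w|) => A B D F'.
by move=> *; apply/andP; split; lra.
Qed.

(** Integrate [ckern] over [z]: the doubly centered distance appears, and the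
    potentials that it contains give the first form by symmetry of [G]. *)
Lemma bform_absdist :
  bform P (fun z => G z * `|x z.1 - x z.2|) r r =
  2 * bform P G (fun w => r w * potential w) r
  - pi^-1 * (\int[leb]_z \int[PPp]_y F (y, z))%R.
Proof.
have ir := L2_integ rL; have ig := L2_integM rL potential_L2.1.
have j1 := bform_integ hG ig ir; have j2 := bform_integ hG ir ig.
have iS := @fubini_dom_int1 _ _ (Om * Om)%type mR R PPp leb _ _ _ mFm Fle iGd (@integ_cauchy R).
have <- := @fubini_dom _ _ (Om * Om)%type mR R PPp leb _ _ _ mFm Fle iGd (@integ_cauchy R).
have -> : 2 * bform P G (fun w => r w * potential w) r =
   bform P G (fun w => r w * potential w) r + bform P G r (fun w => r w * potential w).
  by rewrite -(bform_sym hG (dgram_sym _ _ _ _) ig ir); ring.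
rewrite /bform -(RintD j1 j2) -(RintZ _ iS) -(RintB (integD j1 j2) (integZ _ iS)).
apply: eq_Rint => y /=.
have ic : integ leb (fun z => ckern z y).
  have [i1 _] := A_int (x y.1); have [i2 _] := A_int (x y.2); have [i3 _] := C_int.
  have i4 := integ_cosk (x y.1 - x y.2).
  exact: (integB (integB (integD i1 i2) i3) i4).
have -> : (\int[leb]_z F (y, z) = r y.1 * r y.2 * G y * \int[leb]_z ckern z y)%R.
  transitivity (\int[leb]_z (r y.1 * r y.2 * G y * ckern z y))%R; first by [].
  by rewrite (@RintZ _ _ _ leb _ _ ic).
have pn : (pi : R) != 0 by rewrite gt_eqF// pi_gt0.
rewrite ckern_int /potential; move: (pi : R) pn => c cn; by field.
Qed.

Let wz (oz : p.-tuple R * mR) : R := wave_sq P phi (a1 oz.2) (a2 oz.2) oz.1.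

Let m_wz : measurable_fun setT wz.
Proof.
have mh (h : R -> R) : continuous h -> measurable_fun setT
    (fun wz : Om * mR =>
      r wz.1 * (h (wz.2 * x wz.1) - E (fun w => h (wz.2 * x w)))).
  move=> ch.
  have mhx : measurable_fun setT (fun wz : Om * mR => h (wz.2 * x wz.1)).
    apply: mf_cont => //; apply: measurable_funM; first exact: measurable_snd.
    exact: (mf_comp1 mx).
  apply: measurable_funM; first exact: (mf_comp1 rL.1).
  apply: measurable_funB => //.
  exact: (mf_comp2 (@measurable_Rint_param _ _ _ _ R P _ mhx)).
exact: (measurable_wave_sq P mphi (mh _ (@continuous_cos R)) (mh _ (@continuous_sin R))).
Qed.

Let Q_ge0 (om : p.-tuple R) : (0 <= Qtilde mu q om)%E.
Proof.
rewrite (QtildeE hq hM); apply: integral_ge0 => t _; rewrite lee_fin.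
by apply: mulr_ge0; [exact: rho1_ge0|exact: q_t_ge0].
Qed.

Let mQ : measurable_fun setT (fun om : p.-tuple R => Qtilde mu q om).
Proof.
have -> : (fun om : p.-tuple R => Qtilde mu q om) =
    (fun om => \int[mu]_t (rho1 M t * q_t q t om)%:E)%E.
  by apply/funext => om; rewrite (QtildeE hq hM).
have m := @mf_q_t_joint R q hq M p.
have mE : measurable_fun setT (fun ot : p.-tuple R * mR =>
    (rho1 M ot.2 * q_t q ot.2 ot.1)%:E) by exact/measurable_EFinP.
have F0 (ot : p.-tuple R * mR) : (0 <= (rho1 M ot.2 * q_t q ot.2 ot.1)%:E)%E.
  by rewrite lee_fin; apply: mulr_ge0; [exact: rho1_ge0|exact: q_t_ge0].
exact: (@measurable_fun_fubini_tonelli_F _ _ (p.-tuple mR) mR R mu _ mE F0).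
Qed.

(** Tonelli brings the integral over [om] inside, where [spectral_Q] applies at
    each frequency [z]. *)
Lemma spectral_abs :
  (\int[lebp]_om ((\int[leb]_z (wz (om, z) / (pi * z ^+ 2))%:E) * Qtilde mu q om) =
   (pi^-1 * (\int[leb]_z \int[PPp]_y F (y, z))%R)%:E)%E.
Proof.
pose cz (z : R) : R := (pi * z ^+ 2)^-1.
have cz0 z : 0 <= cz z by rewrite invr_ge0 mulr_ge0 ?pi_ge0 ?sqr_ge0.
have mcz : measurable_fun [set: R] cz by rewrite /cz; mfun.
pose Fn (oz : p.-tuple R * mR) := ((wz oz * cz oz.2)%:E * Qtilde mu q oz.1)%E.
have w0 oz : 0 <= wz oz * cz oz.2 by rewrite mulr_ge0// /wz wave_sq_ge0.
have m1 : measurable_fun setT (fun oz : p.-tuple R * mR => wz oz * cz oz.2).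
  by apply: measurable_funM => //; exact: (mf_comp2 mcz).
have mFn : measurable_fun setT Fn.
  apply: emeasurable_funM; first exact/measurable_EFinP.
  exact: (mf_comp1 mQ).
have Fn0 oz : (0 <= Fn oz)%E by apply: mule_ge0; [rewrite lee_fin; exact: w0|exact: Q_ge0].
transitivity (\int[lebp]_om \int[leb]_z Fn (om, z))%E.
  apply: eq_integral => om _; rewrite -ge0_integralZr//.
  - by apply/measurable_EFinP; exact: (measurableT_comp m1 (@measurable_pair1 _ _ _ _ om)).
  - by move=> z _; rewrite lee_fin; exact: (w0 (om, z)).
have := @fubini_tonelli _ _ (p.-tuple mR) mR R lebp leb _ mFn Fn0.
move=> ->.
have iT := @fubini_dom_int2 _ _ (Om * Om)%type mR R PPp leb _ _ _ mFm Fle iGd (@integ_cauchy R).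
rewrite -(@RintZ _ _ _ leb _ _ iT) (@EFin_Rint _ _ _ leb _ (integZ _ iT)).
apply: eq_integral => z _; rewrite /Fn/=.
have -> : (\int[lebp]_om ((wz (om, z) * cz z)%:E * Qtilde mu q om) =
    (cz z)%:E * \int[lebp]_om ((wz (om, z))%:E * Qtilde mu q om))%E.
  rewrite -ge0_integralZl_EFin//.
  - by apply: eq_integral => om _; rewrite muleA -EFinM [cz z * _]mulrC.
  - by move=> om _; rewrite mule_ge0// lee_fin /wz wave_sq_ge0.
  - apply: emeasurable_funM => //; apply/measurable_EFinP.
    exact: (measurableT_comp m_wz (@measurable_pair2 _ _ _ _ z)).
rewrite (spectral_Q hq hM mphi (a1_int z) (a2_int z)) -EFinM /F/=; congr EFin.
rewrite -(wave_form z) /cz invfM; ring.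
Qed.

Lemma absdist_spectral : exists2 I : R,
  (\int[lebp]_om ((\int[leb]_z (wave_sq P phi
      (fun w => r w * (cos (z * x w) - mcos z))
      (fun w => r w * (sin (z * x w) - msin z)) om / (pi * z ^+ 2))%:E)
     * Qtilde mu q om) = I%:E)%E &
  bform P (fun z => G z * `|x z.1 - x z.2|) r r =
  2 * bform P G (fun w => r w * potential w) r - I.
Proof. by eexists; [exact: spectral_abs|exact: bform_absdist]. Qed.

End absolute_distance.

(** * The partial derivative of the optimal value *)

Lemma dual_lower_arith (R : realFieldType) (j j' a c b1 b2 k f t : R) :
  j = a - c - k * b1 + f + t -> j' = a - c - k * b2 -> 0 <= t ->
  j' - k * (b1 - b2) + f <= j.
Proof. by move=> -> -> t0; rewrite mulrBr; lra. Qed.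

Section scaling.
Context {R : realType}.
Variables (q : nat) (hq : (q = 1 \/ q = 2)%N) (p : nat).
Context d (Om : measurableType d).
Variable X : Om -> p.-tuple R.
Hypothesis mX : measurable_fun setT X.

Lemma measurable_scale b i :
  measurable_fun setT (fun w => tnth (scale q b (X w)) i).
Proof.
under eq_fun do rewrite tnth_mktuple.
by apply: measurable_funM; [exact: mf_cst|exact: mf_tnth].
Qed.

Lemma powR_rootX (a : R) : 0 <= a -> (a `^ q%:R^-1) ^+ q = a.
Proof.
move=> a0; rewrite -powR_mulrn ?powR_ge0// -powRrM mulVf ?powRr1//.
by case: hq => ->; rewrite pnatr_eq0.
Qed.

Lemma distk_scale b z : (forall i, 0 <= tnth b i) ->
  distk q (fun w => scale q b (X w)) z =
  \sum_(i < p) tnth b i * `|tnth (X z.1) i - tnth (X z.2) i| ^+ q.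
Proof.
move=> b0; apply: eq_bigr => i _; rewrite !tnth_mktuple -mulrBr normrM exprMn.
by rewrite ger0_norm ?powR_ge0// powR_rootX.
Qed.

Lemma shift_coord_ge0 (b : p.-tuple R) l h : (forall i, 0 <= tnth b i) ->
  0 <= tnth b l + h -> forall i, 0 <= tnth (shift_coord b l h) i.
Proof.
move=> b0 bh i; rewrite tnth_mktuple.
by case: eqP => [->|_]; rewrite ?addr0.
Qed.

Lemma shift_coord0 (b : p.-tuple R) l : shift_coord b l 0 = b.
Proof. by apply: eq_from_tnth => i; rewrite tnth_mktuple if_same addr0. Qed.

(** The factor [1 / q] in the exponent of the scaling makes the distance affine in
    [beta]. *)
Lemma distk_shift b l h z : (forall i, 0 <= tnth b i) -> 0 <= tnth b l + h ->
  distk q (fun w => scale q (shift_coord b l h) (X w)) z =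
  distk q (fun w => scale q b (X w)) z + h * `|tnth (X z.1) l - tnth (X z.2) l| ^+ q.
Proof.
move=> b0 bh; rewrite !distk_scale//; last exact: shift_coord_ge0.
rewrite (bigD1 l)//= [in RHS](bigD1 l)//= tnth_mktuple eqxx mulrDl -!addrA; congr (_ + _).
rewrite addrC; congr (_ + _); apply: eq_bigr => i /negbTE il.
by rewrite tnth_mktuple il addr0.
Qed.

Lemma dist_pow_le (a b : R) : `|a - b| ^+ q <= 2 * ((1 + a ^+ 2) * (1 + b ^+ 2)).
Proof.
have ab : 0 <= (a ^+ 2) * (b ^+ 2) by rewrite mulr_ge0// sqr_ge0.
have := sqr_ge0 (a + b); have := sqr_ge0 a; have := sqr_ge0 b.
case: hq => ->; last by rewrite real_normK ?num_real//; nra.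
rewrite expr1 => h1 h2 h3; have h4 := sqr_ge0 (`|a - b| - 1).
have h5 := real_normK (num_real (a - b)).
have h6 : `|a - b| ^+ 2 = (a - b) ^+ 2 by [].
by move: h4 h6; move: (`|a - b|) => c; nra.
Qed.

End scaling.

Section partial.
Context {R : realType}.
Variables (q : nat) (hq : (q = 1 \/ q = 2)%N).
Variables (mu : {finite_measure set (measurableTypeR R) -> \bar R}) (M : R).
Hypothesis hM : msupport mu `<=` `[0, M].
Variables (p : nat) (H : set (p.-tuple R -> R)).
Variable dot : (p.-tuple R -> R) -> (p.-tuple R -> R) -> R.
Hypothesis hH : is_rkhs (lq_kernel q mu) H dot.
Context d (Om : measurableType d) (P : probability Om R).
Local Notation E f := (\int[P]_w f w)%R.
Variable X : Om -> p.-tuple R.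
Hypothesis mX : measurable_fun setT X.
Variable Y : Om -> R.
Hypothesis YL : L2 P Y.
Variable lambda : R.
Hypothesis lambda0 : 0 < lambda.

Let phi b w := scale q b (X w).
Let mphi b i : measurable_fun setT (fun w => tnth (phi b w) i).
Proof. exact: measurable_scale. Qed.
Let fm b := fmin P q X Y lambda H dot b.
Let J := Jobj P q X Y lambda H dot.

Lemma fminP b : H (fm b) /\
  forall g, H g -> obj dot P (phi b) Y lambda (fm b) <= obj dot P (phi b) Y lambda g.
Proof. exact: (xgetPex _ (obj_min hq hM hH (mphi b) YL lambda0)). Qed.

Lemma JobjE b : J b = obj dot P (phi b) Y lambda (fm b).
Proof.
have [Hf fmn] := fminP b; apply/eqP; rewrite eq_le /J /Jobj; apply/andP; split.
  apply: ge_inf; last by exists (fm b).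
  by exists (obj dot P (phi b) Y lambda (fm b)) => _ [g Hg <-]; exact: fmn.
by apply: lb_le_inf; [exists (obj dot P (phi b) Y lambda (fm b)); exists (fm b)|move=> _ [g Hg <-]; exact: fmn].
Qed.

Let r b w := Y w - fm b (phi b w).
Let K b := mixk mu (distk q (phi b)) (rho0 M).

(** The exact duality at [b] and at [b'], both tested with the residual at
    [b']. *)
Lemma J_lower b b' :
  J b' - (2 * lambda)^-1 * (bform P (K b) (r b') (r b') - bform P (K b') (r b') (r b'))
   + 2^-1 * E (fun w => (r b w - r b' w) ^+ 2) <= J b.
Proof.
have [Hb mb] := fminP b; have [Hb' mb'] := fminP b'.
have rL := resid_L2 hq hM hH (mphi b) YL Hb.
have rL' := resid_L2 hq hM hH (mphi b') YL Hb'.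
pose m := (2 * lambda)^-1; pose e w := r b w - r b' w.
pose a0 := E (fun w => Y w * r b' w); pose a1 := 2^-1 * E (fun w => r b' w ^+ 2).
have g1 : J b = a0 - a1 - m * bform P (K b) (r b') (r b')
    + 2^-1 * E (fun w => e w ^+ 2) + m * bform P (K b) e e.
  by rewrite JobjE; exact: (dual_gap hq hM hH (mphi b) YL lambda0 Hb mb rL').
have g2 : J b' = a0 - a1 - m * bform P (K b') (r b') (r b')
    + 2^-1 * E (fun w => (r b' w - r b' w) ^+ 2)
    + m * bform P (K b') (fun w => r b' w - r b' w) (fun w => r b' w - r b' w).
  by rewrite JobjE; exact: (dual_gap hq hM hH (mphi b') YL lambda0 Hb' mb' rL').
have psd := gram_psd hq mu M (mphi b) (L2_integ (L2B rL rL')).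
have z1 : E (fun w => (r b' w - r b' w) ^+ 2) = 0.
  by rewrite -[RHS](Rint_cstP P 0); apply: eq_Rint => w; rewrite subrr expr0n.
have z2 : bform P (K b') (fun w => r b' w - r b' w) (fun w => r b' w - r b' w) = 0.
  rewrite -[RHS](mul0r (E (fun=> 0))) -[X in X * _](Rint_cstP P 0).
  rewrite -(bform1 (integ_cst P 0) (integ_cst P 0)).
  by apply: eq_bform => x y; rewrite subrr !mul0r.
rewrite z1 z2 !mulr0 !addr0 in g2.
have m0 : 0 <= m by rewrite invr_ge0 mulr_ge0// ltW.
have t0 : 0 <= m * bform P (K b) e e := mulr_ge0 m0 psd.
exact: (dual_lower_arith g1 g2 t0).
Qed.

Variables (beta : p.-tuple R) (l : 'I_p).
Hypothesis beta0 : forall i, 0 <= tnth beta i.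
Let x w := tnth (X w) l.
Hypothesis x4 : integ P (fun w => x w ^+ 4).
Let G := mixk mu (distk q (phi beta)) (rho1 M).
Let u (z : Om * Om) := `|x z.1 - x z.2| ^+ q.

Let S : set R := [set h | 0 <= tnth beta l + h].
Let bb h := shift_coord beta l h.

Let quotient_cvg (h_ : nat -> R) : (forall n, S (h_ n)) -> (forall n, h_ n != 0) ->
  h_ @ \oo --> 0 ->
  (h_ n)^-1 * (J (bb (h_ n)) - J (bb 0)) @[n --> \oo] -->
  (2 * lambda)^-1 * bform P (fun z => G z * u z) (r (bb 0)) (r (bb 0)).
Proof.
have mx : measurable_fun setT x by exact: mf_tnth.
have s0 : 0 <= fine (mu setT) by exact: s_ge0.
have u0 z : 0 <= u z by rewrite exprn_ge0.
have VL : L2 P (fun w => 1 + x w ^+ 2).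
  by apply: L2D; [exact: L2_cst|exact: L2_sqr_of4].
have dE h z : S h -> distk q (phi (bb h)) z = distk q (phi (bb 0)) z + h * u z.
  by move=> Sh; rewrite /phi /bb distk_shift// shift_coord0.
have := @envelope_cvg R _ Om P lambda (2 * `|M| * fine (mu setT)) (M ^+ 2 * fine (mu setT))
  (fine (mu setT)) (E (fun w => Y w ^+ 2)) (fun w => 1 + x w ^+ 2) (fun z => u z ^+ 2)
  lambda0 _ VL S (fun h => J (bb h)) (fun h => r (bb h)) (fun h => K (bb h))
  (fun z => G z * u z).
apply.
- by move=> w; rewrite lerDl sqr_ge0.
- by rewrite /S/= addr0.
- by move=> h _; have [Hb _] := fminP (bb h); exact: (resid_L2 hq hM hH (mphi (bb h)) YL Hb).
- by move=> h _; have [Hb mb] := fminP (bb h); exact: (resid_bnd hq hM hH (mphi (bb h)) YL lambda0 Hb mb).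
- by move=> h _; exact: gram_bdd.
- move=> h z Sh.
  have := lap0_diff mu M (distk_ge0 q (phi (bb 0)) z) (distk_ge0 q (phi (bb h)) z).
  rewrite -/(K (bb h) z) -/(K (bb 0) z) => /le_trans; apply.
  rewrite (dE h z Sh) [_ + h * _]addrC addrK normrM (ger0_norm (u0 z)).
  have := dist_pow_le hq (x z.1) (x z.2); rewrite -/(u z) => hu.
  have c0 : 0 <= `|M| * `|h| * fine (mu setT) by rewrite !mulr_ge0.
  have := ler_wpM2l c0 hu; congr (_ <= _); ring.
- move=> h z Sh hn.
  have : `|K (bb h) z - K (bb 0) z + (distk q (phi (bb h)) z - distk q (phi (bb 0)) z)
      * lap1 mu M (distk q (phi (bb 0)) z)| <=
    M ^+ 2 * (distk q (phi (bb h)) z - distk q (phi (bb 0)) z) ^+ 2 * fine (mu setT).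
    exact: (lap0_taylor mu M (distk_ge0 q (phi (bb 0)) z) (distk_ge0 q (phi (bb h)) z)).
  rewrite (dE h z Sh) [_ + h * _]addrC addrK.
  have -> : lap1 mu M (distk q (phi (bb 0)) z) = G z.
    rewrite /bb shift_coord0; apply: eq_Rint => t; rewrite /rho1 mulrA//.
  move=> h1; rewrite -(ler_pM2l (_ : 0 < `|h|)) ?normr_gt0// -normrM.
  have -> : h * (h^-1 * (K (bb h) z - K (bb 0) z) + G z * u z) =
     K (bb h) z - K (bb 0) z + h * u z * G z.
    by rewrite mulrDr mulVKf// [G z * _]mulrC mulrA.
  apply: (le_trans h1); rewrite exprMn -(real_normK (num_real h)) le_eqVlt.
  by apply/orP; left; apply/eqP; ring.
- by move=> h h' _ _; exact: J_lower.
Qed.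

Let bb0 : bb 0 = beta. Proof. exact: shift_coord0. Qed.

(** Limits are tested along sequences. When [tnth beta l] is positive, the terms
    of the sequence that leave the orthant are finitely many, and are replaced by
    an admissible value. *)
Lemma J_partial :
  is_partial J beta l ((2 * lambda)^-1 * bform P (fun z => G z * u z) (r beta) (r beta)).
Proof.
rewrite /is_partial; have [bl|bl] := eqVneq (tnth beta l) 0.
  apply/cvg_at_rightP => h_ [hp h0].
  have := @quotient_cvg h_ _ _ h0; rewrite bb0; apply => n.
    by rewrite /S/= bl add0r ltW.
  by rewrite gt_eqF.
apply/cvgr_dnbhsP => h_ [hn h0].
have bp : 0 < tnth beta l by rewrite lt_neqAle eq_sym bl beta0.
pose k n := if 0 <= tnth beta l + h_ n then h_ n else tnth beta l.
have kE : \forall n \near \oo, k n = h_ n.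
  have hf : \forall n \near \oo, `|h_ n| < tnth beta l by apply: cvgr0_norm_lt.
  apply: filterS hf => n hlt; rewrite /k ifT//.
  by move: hlt; rewrite ltr_norml => /andP[h1 _]; lra.
have k0 : k @ \oo --> 0.
  apply: cvg_trans h0; apply: near_eq_cvg; near=> n; near: n.
  by apply: filterS kE => n ->.
have Sk n : S (k n) by rewrite /S/= /k; case: ifP => // _; rewrite addr_ge0// ltW.
have kn n : k n != 0 by rewrite /k; case: ifP.
have := quotient_cvg Sk kn k0; rewrite bb0.
apply: cvg_trans; apply: near_eq_cvg.
by apply: filterS kE => n ->.
Unshelve. all: by end_near.
Qed.

End partial.

(** * The expansion of the partial derivatives *)

Theorem proposition5 (R : realType) :
  exists C : R -> R -> R -> R -> R,
  (forall a b M s : R, 0 < C a b M s) /\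
  forall (q : nat) (hq : q = 1%N \/ q = 2%N)
    (mu : {finite_measure set (measurableTypeR R) -> \bar R})
    (hmu : kernel_measure mu q)
    (Mmu : R) (hM : msupport mu `<=` `[0, Mmu])
    (p : nat) (H : set (p.-tuple R -> R))
    (dot : (p.-tuple R -> R) -> (p.-tuple R -> R) -> R)
    (hH : is_rkhs (lq_kernel q mu) H dot)
    (d : measure_display) (Om : measurableType d) (P : probability Om R)
    (X : {RV P >-> p.-tuple R}) (Y : {RV P >-> R})
    (hY0 : ('E_P[Y] = 0)%E)
    (hX4 : forall i : 'I_p, ('E_P[fun w => ((tnth (X w) i) ^+ 4)%R] < +oo)%E)
    (hY2 : ('E_P[fun w => ((Y w) ^+ 2)%R] < +oo)%E)
    (lambda : R) (hlambda : 0 < lambda)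
    (beta : p.-tuple R) (hbeta : forall i : 'I_p, 0 <= tnth beta i)
    (l : 'I_p),
  let J := Jobj P q X Y lambda H dot in
  let Rw om w :=
    residual_wave P q X Y lambda H dot beta om (scale q beta (X w)) (Y w) in
  let leb := @lebesgue_measure R in
  let covE om z := sqmod (ccov P (Rw om) (fun w => expi (z * tnth (X w) l))) in
  let covX om := sqmod (ccov P (Rw om) (fun w => (tnth (X w) l)%:C)) in
  exists dJ rem : R,
  [/\ is_partial J beta l dJ,
      `|rem| <= C (fine 'E_P[fun w => (tnth (X w) l) ^+ 4])
                  (fine 'E_P[fun w => (Y w) ^+ 2])
                  Mmu (fine (mu setT)) * Num.sqrt lambda,
      q = 1%N ->
        dJ%:E = ((- lambda^-1)%:E *
          ((2^-1)%:E * (\int[mpower leb p]_om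
             ((\int[leb]_z (covE om z / (pi * z ^+ 2))%:E) * Qtilde mu q om))
           + rem%:E))%E
    & q = 2%N ->
        dJ%:E = ((- lambda^-1)%:E *
          ((\int[mpower leb p]_om ((covX om)%:E * Qtilde mu q om))
           + rem%:E))%E].
Proof.
(* [4 sqrt (1 + a)] bounds the L2 norm of both multipliers, [centered ^+ 2] and
   [potential]; the summand 1 keeps the constant positive *)
exists (fun a b M s => 1 + 4 * `|M| * `|b| * Num.sqrt s * Num.sqrt (1 + `|a|)).
split=> [a b M s|]; first by rewrite ltr_wpDr// !mulr_ge0// sqrtr_ge0.
move=> q hq mu _ M hM p H dot hH d Om P X Y _ hX4 hY2 lambda lambda0 beta beta0 l.
move=> J Rw leb covE covX; rewrite !expE.
have mX : measurable_fun setT X by exact: measurable_funPT.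
have mY : measurable_fun setT Y by exact: measurable_funPT.
have YL : L2 P Y.
  split=> //; apply: integ_ge0P; first exact: measurable_funX.
    by move=> w; exact: sqr_ge0.
  by move: hY2; rewrite unlock.
pose x w := tnth (X w) l.
have mx : measurable_fun setT x by exact: mf_tnth.
have x4 : integ P (fun w => x w ^+ 4).
  apply: integ_ge0P; first exact: measurable_funX.
    by move=> w; exact: exprn_even_ge0.
  by move: (hX4 l); rewrite unlock.
pose phi w := scale q beta (X w).
have mphi i : measurable_fun setT (fun w => tnth (phi w) i).
  exact: (measurable_scale q mX).
have [Hf fm] := fminP hq hM hH mX YL lambda0 beta.
pose r w := Y w - fmin P q X Y lambda H dot beta (phi w).
have rL : L2 P r := resid_L2 hq hM hH mphi YL Hf.
have rb := resid_bnd hq hM hH mphi YL lambda0 Hf fm.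
have rK := gram_resid_bnd hq hM hH mphi YL lambda0 Hf fm.
pose G := mixk mu (distk q phi) (rho1 M).
pose D := (2 * lambda)^-1 * bform P (fun z => G z * `|x z.1 - x z.2| ^+ q) r r.
have dJ : is_partial J beta l D by exact: (J_partial hq hM hH mX YL lambda0 beta0 x4).
pose a := (\int[P]_w (x w ^+ 4))%R; pose b := (\int[P]_w (Y w ^+ 2))%R.
have a0 : 0 <= a by apply: Rintegral_ge0 => w _; exact: exprn_even_ge0.
have b0 : 0 <= b by apply: Rintegral_ge0 => w _; exact: sqr_ge0.
have bnd (g : Om -> R) : L2 P g -> (\int[P]_w (g w ^+ 2))%R <= 16 * (1 + a) ->
    `|- bform P G (fun w => r w * g w) r| <=
    (1 + 4 * `|M| * `|b| * Num.sqrt (fine (mu setT)) * Num.sqrt (1 + `|a|)) * Num.sqrt lambda.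
  move=> gL ga; rewrite normrN.
  apply: (le_trans (remainder_bnd hq mphi rL gL (ltW lambda0) rb ga rK)).
  rewrite ler_wpM2r ?sqrtr_ge0// (ger0_norm a0) (ger0_norm b0).
  have -> : Num.sqrt (16 * (1 + a)) = 4 * Num.sqrt (1 + a).
    have -> : 16 = 4 ^+ 2 :> R by ring.
    by rewrite sqrtrM ?sqr_ge0// sqrtr_sqr ger0_norm.
  by rewrite -/b -[leLHS]add0r lerD// le_eqVlt; apply/orP; left; apply/eqP; ring.
have covM (u v : Om -> R) om : L2 P u -> L2 P v ->
    sqmod (ccov P (Rw om) (fun w => u w +i* v w)) =
    wave_sq P phi (fun w => r w * (u w - \int[P]_w u w)%R) (fun w => r w * (v w - \int[P]_w v w)%R) om.
  by move=> uL vL; exact: (sqmod_ccov mphi om rL uL vL).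
case: (hq) => hq'.
  have [gL gb] := potential_L2 mx x4.
  exists D, (- bform P G (fun w => r w * potential P x w) r); split; last by rewrite hq'.
  - exact: dJ.
  - exact: (bnd _ gL gb).
  move=> _.
  have [I eI eB] := absdist_spectral hq hM mphi mx x4 rL.
  have -> : (\int[mpower leb p]_om
      ((\int[leb]_z (covE om z / (pi * z ^+ 2))%:E) * Qtilde mu q om) = I%:E)%E.
    rewrite -eI; apply: eq_integral => om _; congr (_ * _)%E; apply: eq_integral => z _.
    congr (_ / _)%:E; apply: covM.
      by apply: (@L2_bnd _ _ _ _ _ 1) => [|w]; [by apply: mf_cos; apply: measurable_funM => //; exact: mf_cst|exact: cos_max].
    by apply: (@L2_bnd _ _ _ _ _ 1) => [|w]; [by apply: mf_sin; apply: measurable_funM => //; exact: mf_cst|exact: sin_max].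
  rewrite -(EFinM 2^-1 I) -EFinD -EFinM; congr EFin.
  have -> : D = (2 * lambda)^-1 * bform P (fun z => G z * `|x z.1 - x z.2|) r r.
    by rewrite /D hq'.
  rewrite eB -/G; move: (bform _ _ _ _) => t; field; exact: lt0r_neq0.
have [gL gb] := L2_centered_sq mx x4.
exists D, (- bform P G (fun w => r w * centered P x w ^+ 2) r); split; [exact: dJ| |by rewrite hq'|].
  apply: (bnd _ gL); apply: (le_trans gb); rewrite -/a; move: (a) => t; lra.
move=> _.
have cL := L2_centered mx x4.
have irc := L2_integM rL cL; have i0 := integ_cst P 0.
have -> : (\int[mpower leb p]_om ((covX om)%:E * Qtilde mu q om) =
    (bform P G (fun w => r w * centered P x w) (fun w => r w * centered P x w))%:E)%E.
  have z0 : bform P G (fun=> 0) (fun=> 0) = 0.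
    rewrite -[RHS](mul0r (\int[P]_w ((fun=> 0) w : R))%R) -[X in X * _](Rint_cstP P 0).
    by rewrite -(bform1 i0 i0); apply: eq_bform => y y'; rewrite !mul0r.
  rewrite -[X in X%:E]addr0 -[X in (_ + X)%:E]z0 -(spectral_Q hq hM mphi irc i0).
  apply: eq_integral => om _; congr (_%:E * _)%E.
  rewrite /covX (covM x (fun=> 0) om (L2_of4 mx x4) (L2_cst P 0)); congr (wave_sq _ _ _ _ _).
  by apply/funext => w; rewrite Rint_cstP subrr mulr0.
rewrite -EFinD -EFinM; congr EFin.
have -> : D = (2 * lambda)^-1 * bform P (fun z => G z * `|x z.1 - x z.2| ^+ 2) r r.
  by rewrite /D hq'.
have eB := bform_sqdist q mu M mphi rL cL gL.
rewrite eB -/G -/(centered P x).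
move: (bform _ _ _ _) (bform _ _ _ _) => t t'; field; exact: lt0r_neq0.
Qed.
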